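(* Let $T:\mathbb{T}\to\mathbb{T}$, $Tx=x+\alpha$, be the rotation by an irrational number $\alpha=[0;a_1,a_2,\dots]$ with bounded partial quotients, and let $f:\mathbb{T}\to\mathbb{R}$ be a positive and bounded away from zero piecewise absolutely continuous function with a non-zero sum of jumps $S=S(f)\ne 0$, with points of discontinuity $\beta_1,\dots,\beta_k$ and jumps $d_1,\dots,d_k$. Put $C=\sup\{a_n:n\in\mathbb{N}\}+1$, $$D=\{n_1d_1+\dots+n_kd_k:\ n_1,\dots,n_k\in\mathbb{Z},\ 0\le n_1,\dots,n_k\le 2C+1\},$$ and let $p\in(0,|S|)\setminus(D\cup(-D))$. Then the special flow $T^f$ has the property $\mathrm{R}\big(\gamma,(\operatorname{sgn}(S)p-D)\cup(-\operatorname{sgn}(S)p+D)\big)$ for every $\gamma>0$.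
   Context: $\mathbb{T}=\mathbb{R}/\mathbb{Z}$ is identified with $[0,1)$ and carries Lebesgue measure $\mu$; $\|t\|$ denotes the distance of $t$ to the nearest integer. Bounded partial quotients means that the sequence $(a_n)$ of continued fraction digits of $\alpha$ is bounded. A function $f:\mathbb{T}\to\mathbb{R}$ is piecewise absolutely continuous if there are $\beta_1,\dots,\beta_k\in\mathbb{T}$ (in cyclic order, $\beta_{k+1}=\beta_1$) such that $f|_{(\beta_j,\beta_{j+1})}$ is absolutely continuous for $j=1,\dots,k$. With $f_\pm(\beta)=\lim_{y\to\beta^\pm}f(y)$, the jumps are $d_j=f_-(\beta_j)-f_+(\beta_j)$, and the sum of jumps is $S(f)=\sum_{j=1}^kd_j=\int_{\mathbb{T}}f'(x)\,dx$. For $m\in\mathbb{Z}$, $f^{(m)}(x)=\sum_{i=0}^{m-1}f(T^ix)$ if $m>0$, $f^{(0)}=0$, and $f^{(m)}(x)=-\sum_{i=m}^{-1}f(T^ix)$ if $m<0$. The special flow $T^f=(T^f_t)_{t\in\mathbb R}$ acts on $\mathbb{T}^f=\{(x,s)\in\mathbb{T}\times\mathbb{R}:0\le s<f(x)\}$, equipped with the measure $\mu^f$ which is the restriction of $\mu\otimes\lambda$ ($\lambda$ = Lebesgue measure on $\mathbb{R}$), normalized to be a probability measure, by $T^f_t(x,s)=(T^nx,s+t-f^{(n)}(x))$ where $n\in\mathbb{Z}$ is the unique integer with $f^{(n)}(x)\le s+t<f^{(n+1)}(x)$. The metric on $\mathbb{T}^f$ is induced from $d((x,s),(y,t))=\|x-y\|+|s-t|$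 on $\mathbb{T}\times\mathbb{R}$. Property $\mathrm{R}(t_0,P)$: let $(X,d)$ be a $\sigma$-compact metric space with Borel $\sigma$-algebra $\mathcal{B}$ and a Borel probability measure $\mu$, let $(S_t)_{t\in\mathbb{R}}$ be a measure-preserving flow on $(X,\mathcal{B},\mu)$, let $P\subset\mathbb{R}\setminus\{0\}$ be finite and $t_0\in\mathbb{R}\setminus\{0\}$. The flow has the property $\mathrm{R}(t_0,P)$ if for every $\varepsilon>0$ there is $\kappa=\kappa(\varepsilon)>0$ such that for every $N\in\mathbb{N}$ there are $\delta=\delta(\varepsilon,N)>0$ and $Z=Z(\varepsilon,N)\in\mathcal{B}$ with $\mu(Z)>1-\varepsilon$ such that whenever $x,x'\in Z$, $x'$ is not in the orbit of $x$ and $d(x,x')<\delta$, there are real numbers $M=M(x,x')\ge N$, $L=L(x,x')\geq N$ with $L/M\ge\kappa$ and $p=p(x,x')\in P$ such that $$\frac{\#\{n\in\mathbb{Z}\cap[M,M+L]:\ d(S_{nt_0}(x),S_{nt_0+p}(x'))<\varepsilon\}}{L}>1-\varepsilon.$$ *)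

(* Defs.v *)
From HB Require Import structures.
From mathcomp Require Import all_boot all_order all_algebra.
From mathcomp Require Import finmap.
From mathcomp Require Import all_classical all_reals all_analysis.
From mathcomp Require Import zify lra.

Set Implicit Arguments.
Unset Strict Implicit.
Unset Printing Implicit Defensive.

Import Order.TTheory GRing.Theory Num.Theory.
Import numFieldNormedType.Exports.

Local Open Scope classical_set_scope.
Local Open Scope ring_scope.

(* The circle R/Z is identified with [0, 1[ ; a function on the circle is a
   function R -> R of which only the values on [0, 1[ are ever used. *)

Section circle.
Context {R : realType}.
Implicit Types x y t : R.

Definition frac x : R := x - (Num.floor x)%:~R.

Definition dist_int t : R := inf (range (fun n : int => `|t - n%:~R|)).

Lemma dist_int_le t (n : int) : dist_int t <= `|t - n%:~R|.
Proof.
apply: ge_inf; last by exists n.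
by exists 0 => _ [m _ <-].
Qed.

Lemma dist_int_attained t : exists n : int, dist_int t = `|t - n%:~R|.
Proof.
have /andP[f0 f1] := floor_itv t.
rewrite intrD1 in f1.
have key (c : R) : (forall n : int, c <= `|t - n%:~R|) -> c <= dist_int t.
  move=> h; apply: lb_le_inf; first by exists `|t - 0%:~R|, 0.
  by move=> _ [m _ <-].
have lo (n : int) : (n <= Num.floor t)%R ->
    t - (Num.floor t)%:~R <= `|t - n%:~R|.
  by rewrite -(ler_int R) => ?; rewrite (le_trans _ (ler_norm _))//; lra.
have hi (n : int) : (Num.floor t < n)%R ->
    (Num.floor t)%:~R + 1 - t <= `|t - n%:~R|.
  rewrite -lezD1 -(ler_int R) intrD1 => ?.
  by rewrite distrC (le_trans _ (ler_norm _))//; lra.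
have [le|lt] := leP (t - (Num.floor t)%:~R) ((Num.floor t)%:~R + 1 - t).
- exists (Num.floor t); apply/eqP; rewrite eq_le dist_int_le/=.
  rewrite (@ger0_norm _ (t - _)); last by rewrite subr_ge0.
  by apply: key => n; have [/lo//|/hi] := leP n (Num.floor t); apply: le_trans.
- exists (Num.floor t + 1)%R; apply/eqP; rewrite eq_le dist_int_le/= intrD1.
  rewrite distrC (@ger0_norm _ (_ - t)); last by rewrite subr_ge0 ltW.
  apply: key => n; have [/lo|/hi//] := leP n (Num.floor t).
  by apply: le_trans; apply: ltW.
Qed.

Lemma dist_int_ge0 t : 0 <= dist_int t.
Proof. by have [n ->] := dist_int_attained t. Qed.

Lemma dist_int0 : dist_int 0 = 0.
Proof.
apply/eqP; rewrite eq_le dist_int_ge0 andbT.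
by have := dist_int_le 0 0; rewrite subrr normr0.
Qed.

Lemma dist_intN t : dist_int (- t) = dist_int t.
Proof.
suff le s : dist_int (- s) <= dist_int s.
  by apply/eqP; rewrite eq_le le -{1}(opprK t) le.
have [n ->] := dist_int_attained s.
apply: le_trans (dist_int_le _ (- n)) _.
by rewrite mulrNz -opprD normrN.
Qed.

Lemma dist_intD s t : dist_int (s + t) <= dist_int s + dist_int t.
Proof.
have [n ->] := dist_int_attained s; have [m ->] := dist_int_attained t.
apply: le_trans (dist_int_le _ (n + m)) _.
by apply: le_trans (ler_normD _ _); rewrite intrD opprD addrACA.
Qed.

Lemma dist_int_eq x y : 0 <= x < 1 -> 0 <= y < 1 -> dist_int (x - y) = 0 ->
  x = y.
Proof.
move=> /andP[x0 x1] /andP[y0 y1]; have [n ->] := dist_int_attained (x - y).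
move/normr0_eq0/eqP; rewrite subr_eq0 => /eqP xyn.
suff n0 : n = 0 by move: xyn; rewrite n0 => /eqP; rewrite subr_eq0 => /eqP.
have n1 : (n < 1)%R by rewrite -(ltr_int R) -xyn; lra.
have n2 : (-1 < n)%R by rewrite -(ltr_int R) -xyn; lra.
by apply/eqP; rewrite eq_le; apply/andP; split; lia.
Qed.

End circle.

Section continued_fraction.
Context {R : realType}.

Definition gauss_map (x : R) : R := frac x^-1.

(* With a = [0; a_1, a_2, ...], this is a_(n+1). *)
Definition partial_quotient (a : R) (n : nat) : int :=
  Num.floor (iter n gauss_map a)^-1.

Definition partial_quotients (a : R) : set R :=
  range (fun n => (partial_quotient a n)%:~R).

End continued_fraction.

Section piecewise_absolutely_continuous.
Context {R : realType}.
Implicit Types (f g : R -> R) (k : nat) (b : nat -> R).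

Definition absolutely_continuous_on (I : set R) g : Prop :=
  forall e : R, 0 < e -> exists2 d : R, 0 < d &
    forall (n : nat) (u v : 'I_n -> R),
      (forall i, [/\ u i <= v i, I (u i) & I (v i)]) ->
      trivIset [set: 'I_n] (fun i => `]u i, v i[%classic) ->
      \sum_(i < n) (v i - u i) < d ->
      \sum_(i < n) `|g (v i) - g (u i)| < e.

(* The points b 0 < ... < b (k - 1) < b k = b 0 + 1 are representatives in R
   of k points of the circle in cyclic order; b k represents the same point
   as b 0. *)
Definition piecewise_ac f k b : Prop :=
  [/\ (0 < k)%N,
      b k = b 0%N + 1,
      forall j, (j < k)%N -> b j < b j.+1 &
      forall j, (j < k)%N ->
        absolutely_continuous_on `]b j, b j.+1[%classic (f \o frac)].

Definition jump f (x : R) : R :=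
  lim (f (frac y) @[y --> x^'-]) - lim (f (frac y) @[y --> x^'+]).

Definition sum_of_jumps f k b : R := \sum_(j < k) jump f (b j).

Definition jump_combinations f k b (C : R) : set R :=
  [set \sum_(j < k) (n j)%:~R * jump f (b j) | n in
    [set n : 'I_k -> int |
      forall j, (0 <= n j)%R /\ (n j)%:~R <= 2 * C + 1]].

End piecewise_absolutely_continuous.

(* Measurable types are nonempty in the library, hence this join; a metric
   space that carries a probability measure is nonempty anyway. *)
#[short(type="pmetricType")]
HB.structure Definition PMetric (K : numDomainType) :=
  {M of Pointed M & Metric K M}.

Section property_R.
Context {R : realType}.
Implicit Type X : pmetricType R.

Definition borel X := g_sigma_algebraType (@open X).

Definition borel_probability X (mu : set X -> \bar R) : Prop :=
  exists P : probability (borel X) R,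
    forall A : set (borel X), measurable A -> mu A = P A.

Definition sigma_compact X : Prop :=
  exists2 K : nat -> set X, (forall n, compact (K n)) & \bigcup_n K n = setT.

Definition measure_preserving_flow X (mu : set X -> \bar R)
    (S : R -> X -> X) : Prop :=
  [/\ forall x, S 0 x = x,
      forall s t x, S (s + t) x = S s (S t x),
      forall t, measurable_fun [set: borel X] (S t : borel X -> borel X) &
      forall t (A : set (borel X)), measurable A -> mu (S t @^-1` A) = mu A].

Definition property_R X (mu : set X -> \bar R) (S : R -> X -> X)
    (t0 : R) (P : set R) : Prop :=
  [/\ sigma_compact X, borel_probability mu & measure_preserving_flow mu S] /\
  [/\ finite_set P, ~ P 0 & t0 != 0] /\
  forall eps : R, 0 < eps -> exists2 kappa : R, 0 < kappa &
  forall N : nat, exists (delta : R) (Z : set (borel X)),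
    [/\ 0 < delta, measurable Z, ((1 - eps)%:E < mu Z)%E &
    forall x x' : X, Z x -> Z x' -> (forall t, S t x <> x') ->
      mdist x x' < delta ->
      exists M L p : R,
        [/\ N%:R <= M, N%:R <= L, kappa <= L / M, P p &
        1 - eps <
          #|` fset_set [set n : int | M <= n%:~R <= M + L /\
               mdist (S (n%:~R * t0) x) (S (n%:~R * t0 + p) x') < eps]|%:R
          / L]].

End property_R.

Record roof (R : realType) := Roof {
  roof_fun :> R -> R ;
  roof_bounded_away :
    exists2 c : R, 0 < c & forall x, 0 <= x < 1 -> c <= roof_fun x }.

Lemma roof_gt0 (R : realType) (f : roof R) (x : R) : 0 <= x < 1 -> 0 < f x.
Proof.
by case: (roof_bounded_away f) => c c0 fc /fc; exact: lt_le_trans.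
Qed.

Record special_space (R : realType) (f : roof R) := SpecialPoint {
  special_val : R * R ;
  special_valP :
    (0 <= special_val.1 < 1) && (0 <= special_val.2 < f special_val.1) }.

Section special_space.
Context {R : realType} (f : roof R).
Local Notation X := (special_space f).

HB.instance Definition _ := [isSub for @special_val R f].
HB.instance Definition _ := [Choice of X by <:].

Lemma special_point_subproof (z := (0, 0) : R * R) :
  (0 <= z.1 < 1) && (0 <= z.2 < f z.1).
Proof. by rewrite /= !lexx ltr01 roof_gt0 //= lexx ltr01. Qed.

HB.instance Definition _ :=
  isPointed.Build X (SpecialPoint special_point_subproof).

Definition special_dist (u v : X) : R :=
  dist_int ((val u).1 - (val v).1) + `|(val u).2 - (val v).2|.

Lemma special_distxx u : special_dist u u = 0.
Proof. by rewrite /special_dist !subrr dist_int0 normr0 addr0. Qed.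

Lemma special_dist_positivity u v : special_dist u v = 0 -> u = v.
Proof.
move/eqP; rewrite /special_dist paddr_eq0 ?dist_int_ge0//.
case/andP=> /eqP d1 /eqP/normr0_eq0/eqP; rewrite subr_eq0 => /eqP d2.
have /andP[u1 _] := valP u; have /andP[v1 _] := valP v.
have {}d1 := dist_int_eq u1 v1 d1.
apply: val_inj.
by rewrite [LHS]surjective_pairing [RHS]surjective_pairing d1 d2.
Qed.

Lemma special_dist_sym u v : special_dist u v = special_dist v u.
Proof. by rewrite /special_dist -dist_intN opprB distrC. Qed.

Lemma special_dist_triangle v u w :
  special_dist u w <= special_dist u v + special_dist v w.
Proof.
rewrite /special_dist addrACA lerD ?ler_distD//.
by rewrite (le_trans _ (dist_intD _ _))// addrA subrK.
Qed.

HB.instance Definition _ := isMetric.Build R X special_distxx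
  special_dist_positivity special_dist_sym special_dist_triangle.

(* Normalization of the restriction of mu \x lambda; mu is Lebesgue measure
   on [0, 1[. *)
Definition special_measure (A : set X) : \bar R :=
  let m := (@lebesgue_measure R \x @lebesgue_measure R)%E in
  (m (val @` A) * ((fine (m (range (val : X -> R * R))))^-1)%:E)%E.

End special_space.

Section special_flow.
Context {R : realType} (a : R).

(* the i-th iterate of the rotation by a *)
Definition rotation (i : int) (x : R) : R := frac (x + i%:~R * a).

Definition birkhoff_sum (f : R -> R) (m : int) (x : R) : R :=
  match m with
  | Posz n => \sum_(i < n) f (rotation i x)
  | Negz n => - \sum_(i < n.+1) f (rotation (- (i.+1)%:Z) x)
  end.

(* [insubd u] never uses its default value: for the index n chosen by [xget],
   0 <= s + t - f^(n) x < f^(n+1) x - f^(n) x = f (T^n x). *)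
Definition special_flow (f : roof R) (t : R) (u : special_space f) :
    special_space f :=
  let: (x, s) := val u in
  let n := xget 0 [set n : int |
    birkhoff_sum f n x <= s + t < birkhoff_sum f (n + 1) x] in
  insubd u (rotation n x, s + t - birkhoff_sum f n x).

End special_flow.

(* Main.v *)
Require Import Defs.
From HB Require Import structures.
From mathcomp Require Import all_boot all_order all_algebra.
From mathcomp Require Import finmap.
From mathcomp Require Import all_classical all_reals all_analysis.
From mathcomp Require Import measurable_realfun.
From mathcomp Require Import zify ring lra.
Import Defs.
Import Order.TTheory GRing.Theory Num.Theory.
Import numFieldNormedType.Exports.
Local Open Scope classical_set_scope.
Local Open Scope ring_scope.
Set Implicit Arguments.
Unset Strict Implicit.
Unset Printing Implicit Defensive.

(* Off the orbits of the discontinuities, [f] is [G] minus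
   [\sum_j d_j floor (x - beta_j)] up to a constant, where [G] is continuous,
   absolutely continuous on bounded intervals, and [G (x + 1) = G x + S]. For
   [alpha] of bounded type, [G^(n) (x + h) - G^(n) x = n h S + o(1)] uniformly
   for [0 <= h <= O (1 / n)], and an orbit of length [n] meets an interval of
   length [h] at most [1 + (C + 1) n h] times. Hence, while [n h |S|] is close
   to [p], the drift between the orbits of two points at distance [h] is close
   to [sg S * p - d] with [d] in [D], and it is constant along a window of times
   of length of order [1 / h]. There the orbits, one of them shifted by the
   drift, are close except when [f^(m) x] is close to a multiple of [gamma].
   Such [m] are rare: if [x] returns close to the lattice at the times [m] and
   [m + q], then [f^(q) (T^m x)] is close to it too, and for a fixed large [q]
   this confines [T^m x] to few short intervals; so, for a large [Q], the
   translates of the set of these [m] by the first few multiples of [Q] are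
   almost disjoint. *)

(** * Continued fractions *)

(** Property R samples the flow at the times [n * gamma], and a sample taken near an end of a fibre
    may find the two orbits on different floors. The frequency of such samples is bounded by an
    elementary count, uniform over all points whose forward orbit avoids the discontinuities,
    instead of an ergodic theorem for the time-[gamma] map. Hence [Z] is the full-measure set of
    these points for all [eps] and [N]. The increments of [G] must be known up to o(1) without a
    derivative. Slopes over a fine mesh replace it: the lengths of the polygons inscribed in the
    graph are bounded, and once the length has almost stopped growing, the finer increments are, in
    total variation, almost those of the polygon. The polygon is a combination of primitives of
    floor functions, handled by equidistribution; the rest has small variation and is handled by
    counting visits. The condition [p < |S|] lets the drift reach [p] while [n h < 1]. Until then a
    discontinuity is crossed at most [1 + (C + 1)] times, which is at most [2 C + 1] because
    [C >= 1]. *)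

Lemma irrational_mulr {R : realType} (a : R) (m l : int) :
  irrational a -> m != 0 -> m%:~R * a != l%:~R.
Proof.
move=> ia m0; apply/eqP => e; apply: ia.
exists (l%:~R / m%:~R) => //.
rewrite fmorph_div /= !ratr_int -e mulrAC mulfV ?mul1r//.
by rewrite intr_eq0.
Qed.

Section convergents.
Context {R : realType} (a : R).

Definition gauss_iter n := iter n gauss_map a.

(* With initial values (0, 1) resp. (1, 0) these are the denominators resp.
   numerators of two successive convergents. *)
Fixpoint convergent (z0 z1 : int) n : int * int :=
  if n is m.+1 then
    let: (u, v) := convergent z0 z1 m in (v, partial_quotient a m * v + u)
  else (z0, z1).

Hypotheses (a01 : 0 < a < 1) (ia : irrational a).

(** The facts feed one another and need a single induction: the Gauss iterate lies in ]0, 1[, so the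
    digit is at least 1, so the denominators grow. A zero iterate would, by the recursion for the
    errors [q a - p], make [a] rational. *)
Lemma convergent_inv n :
  let: (q', q) := convergent 0 1 n in
  let: (p', p) := convergent 1 0 n in
  [/\ (0 <= q' <= q)%R, (1 <= q)%R, (n%:Z <= q)%R & (0 < n)%N -> (1 <= q')%R] /\
  [/\ (p * q' - p' * q == 1) || (p * q' - p' * q == -1),
     q%:~R * a - p%:~R = - gauss_iter n * (q'%:~R * a - p'%:~R),
     0 < gauss_iter n < 1 & (1 <= partial_quotient a n)%R].
Proof.
have pq1 m : 0 < gauss_iter m < 1 -> (1 <= partial_quotient a m)%R.
  move=> /andP[x0 x1]; rewrite /partial_quotient floor_ge_int -/(gauss_iter m).
  by rewrite -invr1 lef_pV2 ?posrE// ltW.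
elim: n => [|n] /=.
  split; split=> //; rewrite /gauss_iter/=; last exact: pq1.
  lra.
case: (convergent 0 1 n) => q' q; case: (convergent 1 0 n) => p' p.
move=> [[/andP[q'0 q'q] q1 nq n0 [det thE /andP[x0 x1] A1]]].
set A := partial_quotient a n in A1 *.
have AE : gauss_iter n.+1 = (gauss_iter n)^-1 - A%:~R by [].
have X0 : 0 <= gauss_iter n.+1 by rewrite AE subr_ge0 floor_le.
have X1 : gauss_iter n.+1 < 1.
  by rewrite AE ltrBlDl -intrD1 floorD1_gt.
have q1R : 1 <= q%:~R :> R by rewrite ler1z.
have thE' : (A * q + q')%:~R * a - (A * p + p')%:~R =
    - gauss_iter n.+1 * (q%:~R * a - p%:~R).
  rewrite !intrD !intrM AE; move: thE.
  set x := gauss_iter n; set Q := q%:~R; set P := p%:~R => thE.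
  have {thE}: q'%:~R * a - p'%:~R = - x^-1 * (Q * a - P).
    by rewrite thE; field; rewrite gt_eqF.
  move=> e; transitivity (A%:~R * (Q * a - P) + (q'%:~R * a - p'%:~R)); first ring.
  by rewrite e; ring.
have q2 : (1 <= A * q + q')%R by nia.
have X0' : 0 < gauss_iter n.+1.
  rewrite lt_neqAle X0 andbT eq_sym; apply/eqP => e0.
  move: thE'; rewrite e0 oppr0 mul0r => /eqP; rewrite subr_eq0.
  by apply/negP; apply: irrational_mulr => //; lia.
have X01 : 0 < gauss_iter n.+1 < 1 by rewrite X0' X1.
split; split=> //; [nia|case: (n) n0 nq => [|m] n0 nq; nia| |exact: pq1].
by move: det => /orP[] /eqP det; apply/orP; [right|left]; apply/eqP; move: det; lia.
Qed.

(** Written with the errors, the determinant identity becomes [|q a - p| (q' + q / x) = 1], and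
    [x < 1]. *)
Lemma dirichlet_approx (N : nat) : exists q p : int,
  [/\ (0 < q)%R, (N%:Z <= q)%R, coprimez p q & `|q%:~R * a - p%:~R| * q%:~R <= 1].
Proof.
have := convergent_inv N.
case: (convergent 0 1 N) => q' q; case: (convergent 1 0 N) => p' p.
move=> [[/andP[q'0 q'q] q1 nq n0 [det thE /andP[x0 x1] A1]]].
exists q, p; split=> //.
  apply/coprimezP; case/orP: det => /eqP det; [exists (q', - p')|exists (-q', p')] => /=; lia.
set x := gauss_iter N in thE x0 x1.
set Q := q%:~R; set P := p%:~R; set Q' := q'%:~R : R; set P' := p'%:~R : R.
have Q1 : 1 <= Q by rewrite ler1z.
have Q'0 : 0 <= Q' by rewrite ler0z.
have QQ' : Q' <= Q by rewrite ler_int.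
have : (P * Q' - P' * Q == 1) || (P * Q' - P' * Q == -1).
  by move: det; rewrite -(eqr_int R) -(eqr_int R _ (-1)) !intrB !intrM mulrN1z.
have e : (P * Q' - P' * Q) = (Q * a - P) * (- (Q' + Q / x)).
  have -> : P = Q * a - (- x * (Q' * a - P')) by rewrite -thE; ring.
  by field; rewrite gt_eqF.
have xV1 : 1 <= x^-1 by rewrite -invr1 lef_pV2 ?posrE// ltW.
rewrite e => /orP h.
have {e}h1 : `|Q * a - P| * (Q' + Q / x) = 1.
  rewrite -[X in _ * X = _]ger0_norm; last by rewrite addr_ge0 // mulr_ge0; lra.
  by rewrite -normrM -normrN -mulrN; case: h => /eqP ->; rewrite ?normrN normr1.
rewrite -h1; apply: ler_wpM2l => //.
by apply: ler_wpDl => //; rewrite ler_peMr//; lra.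
Qed.

(** Let [q <= m < r] with [q], [r] consecutive denominators. In the unimodular basis formed by the
    two convergents, [(m, l)] has coordinates [u != 0] and [v] with [u v <= 0]. The errors of the
    convergents alternate in sign, so the two contributions to [m a - l] add up and it is at least
    [|q a - p| >= 1 / (q + r)], where [q + r <= (B + 2) q]. *)
Lemma badly_approximable (B : R) :
  (forall n, (partial_quotient a n)%:~R <= B) ->
  forall m l : int, (0 < m)%R -> 1 <= (B + 2) * m%:~R * `|m%:~R * a - l%:~R|.
Proof.
move=> hB m l m0.
have : exists n, (m < (convergent 0 1 n).2)%R.
  exists `|m|.+1%N; have := convergent_inv `|m|.+1%N.
  case: (convergent 0 1 _) => q' q; case: (convergent 1 0 _) => p' p /=.
  by move=> [[_ _ + _ _]]; lia.
case/ex_minnP => -[|n]; first by rewrite /=; lia.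
move=> mq /(_ n); rewrite ltnn => hmin.
have {hmin} qm : ((convergent 0 1 n).2 <= m)%R.
  by rewrite leNgt; apply/negP => /hmin.
have := convergent_inv n; have := convergent_inv n.+1; move: mq qm => /=.
case: (convergent 0 1 n) => q' q; case: (convergent 1 0 n) => p' p /= mq qm.
set A := partial_quotient a n in mq *; have hA := hB n; rewrite -/A in hA.
move=> [[_ _ _ _ [det thE /andP[x0 x1] A1]]].
move=> [[/andP[q'0 q'q] q1 _ _ [_ _ _ A1']]]; rewrite -/A in A1'.
set r := (A * q + q')%R in mq det thE; set s := (A * p + p')%R in det thE.
have Aq : (q <= A * q)%R by nia.
have r_ge0 : (0 <= r)%R by rewrite /r; lia.
have [u [v [um vl]]] : exists u v : int, m = u * q + v * r /\ l = u * p + v * s.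
  case/orP: det => /eqP det.
    by exists (s * m - r * l), (q * l - p * m); split;
      rewrite -[LHS]mulr1 -det; ring.
  have {}det : p * r - s * q = 1 by lia.
  by exists (r * l - s * m), (p * m - q * l); split;
    rewrite -[LHS]mulr1 -det; ring.
have u0 : u != 0.
  by apply/eqP => u0; move: um; rewrite u0 mul0r add0r; case: (ltrP 0 v) => ?; nia.
have uv : (u * v <= 0)%R.
  have r0 : (1 <= r)%R by rewrite /r; nia.
  have [u0'|u0'] := ltrP 0 u.
    have [v0|v0] := lerP v 0; first by nia.
    have : (r <= v * r)%R by nia.
    have : (0 <= u * q)%R by nia.
    lia.
  have [v0|v0] := lerP 0 v; first by nia.
  have : (u * q <= 0)%R by nia.
  have : (v * r <= 0)%R by nia.
  lia.
have rq : (r + q)%R%:~R <= (B + 2) * m%:~R.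
  apply: (@le_trans _ _ ((A%:~R + 2) * q%:~R)).
    by rewrite -[2]/(2%:~R) -intrD -intrM ler_int /r; nia.
  apply: ler_pM; rewrite ?lerD2r// ?ler_int//.
    by rewrite -[2]/(2%:~R) -intrD ler0z; lia.
  by rewrite ler0z; lia.
set x := gauss_map (gauss_iter n) in thE x0 x1.
set Q := q%:~R : R; set P := p%:~R : R.
have e1 : (r + q)%R%:~R * `|Q * a - P| >= 1.
  have e : (r%:~R + x * Q) * (Q * a - P) = (s * q - p * r)%:~R.
    have e2 : s%:~R = r%:~R * a + x * (Q * a - P).
      by rewrite -/Q -/P in thE; move: thE; lra.
    by rewrite intrB !intrM e2 -/Q -/P; ring.
  have h1 : (r%:~R + x * Q) * `|Q * a - P| = 1.
    have Q0 : 0 <= Q by rewrite ler0z; lia.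
    have r0 : 0 <= r%:~R :> R by rewrite ler0z.
    rewrite -[X in X * _]ger0_norm; last by rewrite addr_ge0// mulr_ge0// ltW.
    rewrite -normrM e; case/orP: det => /eqP ->; rewrite ?mulrN1z ?normrN normr1//.
  rewrite -[X in X <= _]h1; apply: ler_wpM2r => //.
  rewrite [leRHS]intrD lerD2l; apply: ler_piMl; last exact: ltW.
  by rewrite ler0z; lia.
suff e3 : `|Q * a - P| <= `|m%:~R * a - l%:~R|.
  apply: le_trans e1 _; apply: ler_pM => //.
  by rewrite ler0z; lia.
have -> : m%:~R * a - l%:~R = (u%:~R - x * v%:~R) * (Q * a - P).
  have e2 : s%:~R = r%:~R * a + x * (Q * a - P).
    by rewrite -/Q -/P in thE; move: thE; lra.
  by rewrite um vl !intrD !intrM e2 -/Q -/P; ring.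
rewrite normrM ler_peMl//.
have [u0'|u0'] := ltrP 0 u.
  have : 1 <= u%:~R :> R by rewrite ler1z; lia.
  have : x * v%:~R <= 0.
    by rewrite pmulr_rle0// lerz0; nia.
  by move=> *; rewrite ger0_norm; lra.
have : u%:~R <= -1 :> R by rewrite -(mulrN1z 1) ler_int; lia.
have : 0 <= x * v%:~R by rewrite pmulr_rge0// ler0z; nia.
by move=> *; rewrite ler0_norm; lra.
Qed.

End convergents.

Lemma floor_itv_le {R : realType} (x : R) :
  (Num.floor x)%:~R <= x /\ x < (Num.floor x)%:~R + 1.
Proof. by rewrite -intrD1 floor_le floorD1_gt. Qed.

Lemma floorDint {R : realType} (x : R) (m : int) :
  Num.floor (x + m%:~R) = (Num.floor x + m)%R.
Proof. by rewrite floorDrz ?intrKfloor ?intr_int. Qed.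

Lemma intr_sum {R : realType} n (F : 'I_n -> int) :
  (\sum_(i < n) F i)%:~R = \sum_(i < n) (F i)%:~R :> R.
Proof. by rewrite raddf_sum. Qed.

Lemma period_int {T : zmodType} {V : Type} (K : T -> V) (p : T) (u : int) x :
  (forall z, K (z + p) = K z) -> K (x + p *~ u) = K x.
Proof.
move=> h; have hn (n : nat) z : K (z + p *+ n) = K z.
  by elim: n z => [|n IH] z; rewrite ?mulr0n ?addr0// mulrS addrA IH h.
by case: u => n; [exact: hn|rewrite NegzE mulrNz -{2}(subrK (p *+ n.+1) x) hn].
Qed.

Lemma sparse_count {R : realType} (A : pred nat) (g : R) (n : nat) : 0 <= g ->
  (forall i j, (i < j < n)%N -> A i -> A j -> g <= j%:R - i%:R) ->
  (\sum_(i < n) A i)%:R * g <= n%:R + g.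
Proof.
move=> g0 hA.
(* For the induction, [n + g] is replaced by any horizon [N] at distance at least [g] from the
   selected indices; at a selected index [m] the horizon moves down to [m]. *)
suff claim m (N : R) : (m <= n)%N -> 0 <= N ->
    (forall i, (i < m)%N -> A i -> g <= N - i%:R) ->
    (\sum_(i < m) A i)%:R * g <= N.
  apply: claim => //; first by rewrite addr_ge0.
  by move=> i im _; rewrite addrAC lerDr subr_ge0 ler_nat ltnW.
elim: m N => [|m IH] N mn N0 h; first by rewrite big_ord0 mul0r.
rewrite big_ord_recr/= natrD mulrDl.
have [Am|nAm] := boolP (A m); rewrite ?mul1r ?mul0r ?addr0.
  have := h m (leqnn _) Am; suff : (\sum_(i < m) A i)%:R * g <= m%:R by lra.
  by apply: IH => //; [exact: ltnW|move=> i im Ai; apply: hA => //; rewrite im].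
by apply: IH => //; [exact: ltnW|move=> i im; apply: h; apply: leqW].
Qed.

(** * Floor sums along a rotation *)

Section floor_sums.
Context {R : realType} (a : R).

(** For [x <= y], [floor_sum n y - floor_sum n x] counts the visits of the first [n] points of an
    orbit to an interval of length [y - x] on the circle. Floors make the count additive in the
    interval and monotone in its ends. *)
Definition floor_sum n (x : R) : int := \sum_(i < n) Num.floor (x + i%:R * a).

Lemma floor_sumD n m x :
  floor_sum (n + m) x = floor_sum n x + floor_sum m (x + n%:R * a).
Proof.
rewrite /floor_sum big_split_ord/=; congr (_ + _); apply: eq_bigr => i _.
by rewrite natrD mulrDl addrA.
Qed.

Lemma le_floor_sum n x y : x <= y -> (floor_sum n x <= floor_sum n y)%R.
Proof. by move=> xy; apply: ler_sum => i _; rewrite le_floor// lerD2r. Qed.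

Lemma floor_sum_trivial n x y :
  `|(floor_sum n y)%:~R - (floor_sum n x)%:~R - n%:R * (y - x)| <= n%:R.
Proof.
rewrite /floor_sum !intr_sum -sumrB -[n in n%:R * _]card_ord -sumr_const.
rewrite mulr_suml -sumrB (le_trans (ler_norm_sum _ _ _))//.
rewrite -[leRHS]mulr1 -[n in leRHS]card_ord -sumr_const mulr_suml.
apply: ler_sum => i _; rewrite mul1r.
have [? ?] := floor_itv_le (x + i%:R * a).
have [? ?] := floor_itv_le (y + i%:R * a).
by rewrite ler_norml; apply/andP; split; lra.
Qed.

End floor_sums.

(* [k y := g y - q y] with [g] the sum below has periods [p / q] and [1], hence
   [1 / q]. *)
Lemma rational_floor_sum {R : realType} (q p : int) (x y : R) : (0 < q)%R ->
  coprimez p q ->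
  `|(floor_sum (p%:~R / q%:~R) `|q|%N y)%:~R -
    (floor_sum (p%:~R / q%:~R) `|q|%N x)%:~R - q%:~R * (y - x)| <= 1.
Proof.
move=> q0 /coprimezP[[u v] /= uv].
set b := p%:~R / q%:~R; set g := floor_sum b `|q|%N.
have q0' : 0 < q%:~R :> R by rewrite ltr0z.
pose k z := (g z)%:~R - q%:~R * z : R.
have qE : `|q|%N%:R = q%:~R :> R by rewrite pmulrn gtz0_abs.
have k1 z : k (z + 1) = k z.
  have -> : k z = (g z + q)%:~R - q%:~R * (z + 1) by rewrite /k intrD; ring.
  congr (_%:~R - _); rewrite /g /floor_sum.
  transitivity (\sum_(i < `|q|%N) (Num.floor (z + i%:R * b) + 1)).
    by apply: eq_bigr => i _; rewrite addrAC -[1]/(1%:~R) floorDint.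
  by rewrite big_split/= sumr_const card_ord -mulr_natr mul1r pmulrn intz gtz0_abs.
have kb z : k (z + b) = k z.
  have -> : k z = (g z + p)%:~R - q%:~R * (z + b).
    by rewrite /k intrD /b; field; rewrite gt_eqF.
  congr (_%:~R - _).
  have h : floor_sum b `|q|.+1%N z = floor_sum b `|q| z + Num.floor (z + `|q|%:R * b).
    by rewrite /floor_sum big_ord_recr.
  have : floor_sum b `|q|.+1%N z = Num.floor z + g (z + b).
    by rewrite -addn1 addnC floor_sumD mul1r /floor_sum big_ord1 mul0r addr0.
  rewrite h.
  have -> : z + `|q|%:R * b = z + p%:~R by rewrite qE /b; field; rewrite gt_eqF.
  by rewrite floorDint -/(g z); lia.
have kq z : k (z + q%:~R^-1) = k z.
  have -> : q%:~R^-1 = b *~ u + 1 *~ v :> R.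
    rewrite -[b *~ u]mulrzl -[1 *~ v]/(v%:~R) /b; apply: (mulIf (lt0r_neq0 q0')).
    rewrite mulVf ?lt0r_neq0// mulrDl -mulrA mulfVK ?lt0r_neq0//.
    by rewrite -!intrM -intrD uv.
  by rewrite addrA !period_int.
(* Over a distance [s / q] the function [g] grows by exactly [s]; monotonicity squeezes [g w]
   between two consecutive such values. *)
have {k1 kb} main z w : z <= w -> `|(g w)%:~R - (g z)%:~R - q%:~R * (w - z)| <= 1.
  move=> zw; set t := Num.floor (q%:~R * (w - z)).
  have [t1 t2] := floor_itv_le (q%:~R * (w - z)); rewrite -/t in t1 t2.
  have kt s : (g (z + s%:~R / q%:~R))%:~R = (g z)%:~R + s%:~R :> R.
    have := period_int s z kq; rewrite -mulrzl /k mulrDr mulrCA mulfV ?lt0r_neq0//.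
    lra.
  have : (g (z + t%:~R / q%:~R) <= g w)%R.
    by apply: le_floor_sum; rewrite -lerBrDl ler_pdivrMr// mulrC.
  have : (g w <= g (z + (t + 1)%:~R / q%:~R))%R.
    apply: le_floor_sum; rewrite -lerBlDl ler_pdivlMr// mulrC intrD; lra.
  rewrite -!(ler_int R) !kt intrD => h1 h2.
  by rewrite ler_norml; apply/andP; split; lra.
have [xy|/ltW xy] := leP x y; first exact: main.
rewrite -normrN; apply: le_trans (main _ _ xy); rewrite le_eqVlt; apply/orP; left.
by apply/eqP; congr `|_|; ring.
Qed.

Section rotation_counting.
Context {R : realType} (a C : R).
Hypothesis badly : forall m l : int, (0 < m)%R ->
  1 <= C * m%:~R * `|m%:~R * a - l%:~R|.
Hypothesis dirichlet : forall N : nat, exists q p : int,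
  [/\ (0 < q)%R, (N%:Z <= q)%R, coprimez p q & `|q%:~R * a - p%:~R| * q%:~R <= 1].

Lemma badly_cst_ge0 : 0 <= C.
Proof.
have := @badly 1 0 isT; rewrite mulr1; have [//|C0] := leP 0 C.
by have := normr_ge0 (1%:~R * a - 0%:~R); nra.
Qed.

(** For [q] steps the orbit under [a] stays within [1 / q] of the orbit under [p / q]. Moving both
    ends by [1 / q] costs 2, and the rational sum has error 1. *)
Lemma block_floor_sum (N : nat) : exists2 q : nat, (0 < q)%N && (N <= q)%N &
  forall x y, `|(floor_sum a q y)%:~R - (floor_sum a q x)%:~R - q%:R * (y - x)| <= 3 :> R.
Proof.
have [q [p [q0 Nq cpq apq]]] := dirichlet N.
exists `|q|%N; first by lia.
have q0' : 0 < q%:~R :> R by rewrite ltr0z.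
have qE : `|q|%N%:R = q%:~R :> R by rewrite pmulrn gtz0_abs.
have dev (i : nat) : (i < `|q|)%N ->
    `|i%:R * a - i%:R * (p%:~R / q%:~R)| <= q%:~R^-1.
  move=> iq; have iq' : i%:R <= q%:~R :> R by rewrite -qE ler_nat ltnW.
  have -> : i%:R * a - i%:R * (p%:~R / q%:~R) =
     (i%:R / q%:~R) * (q%:~R * a - p%:~R) by field; rewrite gt_eqF.
  have iq0 : 0 <= i%:R / q%:~R :> R by rewrite divr_ge0// ltW.
  rewrite normrM (ger0_norm iq0) -[leRHS]mul1r; apply: ler_pM => //.
    by rewrite ler_pdivrMr ?mul1r.
  by rewrite -[leRHS]mul1r ler_pdivlMr.
pose b : R := p%:~R / q%:~R.
have lo z : (floor_sum b `|q| (z - q%:~R^-1) <= floor_sum a `|q| z)%R.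
  apply: ler_sum => i _; apply: le_floor.
  by have := dev i (ltn_ord i); rewrite ler_norml -/b => /andP[]; lra.
have hi z : (floor_sum a `|q| z <= floor_sum b `|q| (z + q%:~R^-1))%R.
  apply: ler_sum => i _; apply: le_floor.
  by have := dev i (ltn_ord i); rewrite ler_norml -/b => /andP[]; lra.
move=> x y; rewrite qE.
have := rational_floor_sum (x - q%:~R^-1) (y + q%:~R^-1) q0 cpq.
have := rational_floor_sum (x + q%:~R^-1) (y - q%:~R^-1) q0 cpq.
have := lo x; have := lo y; have := hi x; have := hi y.
rewrite -!(ler_int R) -/b => h1 h2 h3 h4.
have -> : q%:~R * (y - q%:~R^-1 - (x + q%:~R^-1)) = q%:~R * (y - x) - 2 :> R.
  by field; rewrite gt_eqF.
have -> : q%:~R * (y + q%:~R^-1 - (x - q%:~R^-1)) = q%:~R * (y - x) + 2 :> R.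
  by field; rewrite gt_eqF.
by rewrite !ler_norml => /andP[? ?] /andP[? ?]; apply/andP; split; lra.
Qed.

(** Complete blocks cost 3 each, in all at most [eta n / 2] since [6 <= eta q]; the incomplete block
    costs at most [q <= eta n / 2]. *)
Lemma floor_sum_equidistributed (eta : R) : 0 < eta -> exists n0 : nat,
  forall n x y, (n0 <= n)%N ->
  `|(floor_sum a n y)%:~R - (floor_sum a n x)%:~R - n%:R * (y - x)| <= eta * n%:R.
Proof.
move=> eta0; have [q /andP[q0 Nq] hq] := block_floor_sum (Num.truncn (6 / eta)).+1.
exists (Num.truncn (2 * q%:R / eta)).+1 => n x y hn.
have blocks m z w : `|(floor_sum a (m * q) w)%:~R - (floor_sum a (m * q) z)%:~R
    - (m * q)%:R * (w - z)| <= 3 * m%:R.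
  elim: m z w => [|m IH] z w.
    by rewrite /floor_sum !big_ord0 mul0n mul0r subrr subr0 normr0 mulr0.
  rewrite mulSn !floor_sumD natrD !intrD.
  have := IH (z + q%:R * a) (w + q%:R * a); have := hq z w.
  have -> : w + q%:R * a - (z + q%:R * a) = w - z by ring.
  rewrite -[m.+1%:R]natr1 [3 * (_ + 1)]mulrDr mulr1 !ler_norml => /andP[? ?] /andP[? ?].
  by rewrite mulrDl; apply/andP; split; lra.
rewrite (divn_eq n q) !floor_sumD natrD !intrD.
set m := (n %/ q)%N; set r := (n %% q)%N.
have hr : r%:R <= q%:R :> R by rewrite ler_nat ltnW// ltn_mod.
have := blocks m x y.
have := floor_sum_trivial a r (x + (m * q)%:R * a) (y + (m * q)%:R * a).
have -> : y + (m * q)%:R * a - (x + (m * q)%:R * a) = y - x by ring.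
have q1 : 6 <= eta * q%:R.
  rewrite mulrC -ler_pdivrMr// ltW//; apply: lt_le_trans (truncnS_gt _) _.
  by rewrite ler_nat.
have n1 : 2 * q%:R <= eta * n%:R.
  rewrite mulrC mulrC [leRHS]mulrC -ler_pdivrMr// ltW//.
  by apply: lt_le_trans (truncnS_gt _) _; rewrite ler_nat.
have nE : n%:R = m%:R * q%:R + r%:R :> R by rewrite -natrM -natrD -divn_eq.
have m6 : 6 * m%:R <= eta * (m%:R * q%:R).
  by rewrite mulrCA mulrC ler_wpM2l.
have mqr : eta * (m%:R * q%:R) <= eta * n%:R.
  by rewrite ler_pM2l// nE lerDl.
move: n1 mqr; rewrite nE natrM !ler_norml => n1 mqr /andP[? ?] /andP[? ?].
by apply/andP; split; lra.
Qed.

(** As [h < 1], each floor increases by 0 or 1. If it increases at times [i < j], then [(j - i) a]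
    is within [h] of an integer, so that [j - i >= 1 / (C h)]. *)
Lemma floor_sum_gap n x h : 0 <= h < 1 ->
  (floor_sum a n (x + h))%:~R - (floor_sum a n x)%:~R <= 1 + C * n%:R * h.
Proof.
move=> /andP[h0 h1].
pose A i := (Num.floor (x + i%:R * a) < Num.floor (x + h + i%:R * a))%R.
have AE i : Num.floor (x + h + i%:R * a) = Num.floor (x + i%:R * a) + A i.
  rewrite /A; case: ltP => hA /=.
    apply/eqP; rewrite eq_le; apply/andP; split; last by rewrite lezD1.
    have [? ?] := floor_itv_le (x + i%:R * a).
    have [? ?] := floor_itv_le (x + h + i%:R * a).
    by rewrite -ltzD1 -(ltr_int R) !intrD; lra.
  rewrite addr0; apply/eqP; rewrite eq_le hA le_floor//; lra.
have -> : (floor_sum a n (x + h))%:~R - (floor_sum a n x)%:~R = (\sum_(i < n) A i)%:R :> R.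
  rewrite -intrB /floor_sum -sumrB natr_sum intr_sum.
  by apply: eq_bigr => i _; rewrite AE addrAC subrr add0r -pmulrn.
have := badly_cst_ge0; rewrite le_eqVlt => /orP[/eqP C0|C0].
  by have := @badly 1 0 isT; rewrite -C0 !mul0r ler10.
move: h0; rewrite le_eqVlt => /orP[/eqP h0|h0].
  rewrite big1 -?h0 ?mulr0 ?addr0//.
  by move=> i _; rewrite /A -h0 addr0 ltxx.
have Ch : 0 < C * h by rewrite mulr_gt0.
have hA i j : (i < j < n)%N -> A i -> A j -> (C * h)^-1 <= j%:R - i%:R.
  move=> /andP[/[dup] ij ? _] Ai Aj; rewrite -[leLHS]mul1r ler_pdivrMr//.
  have ji : j%:R - i%:R = (j%:Z - i%:Z)%:~R :> R by rewrite intrB -!pmulrn.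
  apply: le_trans (@badly (j%:Z - i%:Z)
    (Num.floor (x + h + j%:R * a) - Num.floor (x + h + i%:R * a)) _) _; first lia.
  rewrite ji [leRHS]mulrA [X in _ <= X * _]mulrC.
  apply: ler_wpM2l.
    by rewrite mulr_ge0 ?ltW// ltr0z; move: (ij); lia.
  rewrite -ji intrB; move: Ai Aj; rewrite /A => Ai Aj.
  have [? ?] := floor_itv_le (x + i%:R * a).
  have [? ?] := floor_itv_le (x + h + i%:R * a).
  have [? ?] := floor_itv_le (x + j%:R * a).
  have [? ?] := floor_itv_le (x + h + j%:R * a).
  move: Ai Aj; rewrite -!lezD1 -!(ler_int R) !intrD => Ai Aj.
  by rewrite ler_norml; apply/andP; split; lra.
have := @sparse_count R A (C * h)^-1 n; rewrite invr_ge0 ltW// => /(_ isT hA).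
rewrite -(ler_pM2r Ch) mulrDl mulfVK ?lt0r_neq0// mulVf ?lt0r_neq0//.
by rewrite addrC mulrA [n%:R * _]mulrC.
Qed.
End rotation_counting.

(* An antiderivative of [floor]. *)
Definition floor_prim {R : realType} (z : R) : R :=
  let m := (Num.floor z)%:~R in m * (m - 1) / 2 + m * (z - m).

Section floor_prim.
Context {R : realType}.
Implicit Types x y z u v : R.

Lemma floor_prim_incr x y : x <= y ->
  (y - x) * (Num.floor x)%:~R <= floor_prim y - floor_prim x <=
  (y - x) * (Num.floor y)%:~R.
Proof.
move=> xy; rewrite /floor_prim.
have [x1 x2] := floor_itv_le x; have [y1 y2] := floor_itv_le y.
have mM : (Num.floor x <= Num.floor y)%R by exact: le_floor.
(* Integrality of the floors enters here: a product of consecutive integers is non-negative. *)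
have : 0 <= ((Num.floor y - Num.floor x) * (Num.floor y - Num.floor x - 1))%:~R :> R.
  rewrite ler0z; move: mM; rewrite -subr_ge0.
  by case: (_ - _)%R => // -[|d] _ //; rewrite mulr_ge0.
move: mM; rewrite -(ler_int R) !(intrM, intrB).
move: x1 x2 y1 y2; set m := (Num.floor x)%:~R; set M := (Num.floor y)%:~R.
move=> x1 x2 y1 y2 mM h.
have h1 : 0 <= (M - m) * (y - M) by rewrite mulr_ge0 ?subr_ge0.
have h2 : 0 <= (M - m) * (m + 1 - x) by apply: mulr_ge0; lra.
by apply/andP; split; nra.
Qed.

Lemma floor_prim01 z : -1 <= z <= 1 -> floor_prim z = Num.max 0 (- z).
Proof.
move=> /andP[z1 z2]; rewrite /floor_prim.
have [z0|z0] := ltP z 0.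
  have -> : Num.floor z = -1.
    by apply: floor_def; rewrite mulrN1z addNr; apply/andP; split; lra.
  by rewrite mulrN1z; rewrite max_r; lra.
rewrite max_l; last lra.
move: z2; rewrite le_eqVlt => /orP[/eqP ->|z2]; first by rewrite floor1; lra.
have -> : Num.floor z = 0 by apply: floor_def; rewrite z0 add0r.
by rewrite !mul0r addr0.
Qed.

Lemma floor_primD1 z : floor_prim (z + 1) = floor_prim z + z.
Proof.
by rewrite /floor_prim (floorDint z 1) intrD mulr1z; field.
Qed.

(** For [u <= v <= u + 1], this has slope 1 on [[u, v[] modulo 1 and slope 0 elsewhere; piecewise
    linear functions with prescribed mesh slopes are combinations of such ramps. *)
Definition ramp u v z := floor_prim (z - u) - floor_prim (z - v).

Lemma rampD1 u v z : ramp u v (z + 1) = ramp u v z + (v - u).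
Proof.
have e w : z + 1 - w = z - w + 1 by ring.
by rewrite /ramp !e !floor_primD1; ring.
Qed.

Lemma floor_prim_left_cont z e : 0 < e ->
  exists2 d, 0 < d & forall w, z - d < w <= z -> `|floor_prim w - floor_prim z| < e.
Proof.
move=> e0; pose B := `|(Num.floor z)%:~R| + 1 : R.
have B0 : 0 < B by rewrite ltr_wpDl.
exists (Num.min 1 (e / B)); first by rewrite lt_min ltr01 divr_gt0.
move=> w /andP[dw wz].
have dw1 : z - w < 1.
  by rewrite ltrBlDl -ltrBlDr (le_lt_trans _ dw)// lerD2l lerN2 ge_min lexx.
have dw2 : z - w < e / B.
  by rewrite ltrBlDl -ltrBlDr (le_lt_trans _ dw)// lerD2l lerN2 ge_min lexx orbT.
have h : (z - w) * B < e by rewrite -ltr_pdivlMr.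
have [w1 w2] := floor_itv_le w; have [z1 z2] := floor_itv_le z.
have fw : (Num.floor z)%:~R - 1 <= (Num.floor w)%:~R :> R.
  rewrite -[1]/(1%:~R) -intrB ler_int.
  by rewrite -ltzD1 -(ltr_int R) intrB intrD; lra.
have := floor_prim_incr wz => /andP[i1 i2].
have b1 := ler_norm ((Num.floor z)%:~R : R).
have b2 := ler_norm (- (Num.floor z)%:~R : R); rewrite normrN in b2.
have l1 : - ((z - w) * B) <= (z - w) * (Num.floor w)%:~R.
  by rewrite -mulrN ler_wpM2l ?subr_ge0// /B; lra.
have l2 : (z - w) * (Num.floor z)%:~R <= (z - w) * B.
  by rewrite ler_wpM2l ?subr_ge0// /B; lra.
by rewrite distrC ltr_norml; apply/andP; split; lra.
Qed.

End floor_prim.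

Section ramp_increments.
Context {R : realType} (a C : R).
Hypothesis badly : forall m l : int, (0 < m)%R ->
  1 <= C * m%:~R * `|m%:~R * a - l%:~R|.
Hypothesis dirichlet : forall N : nat, exists q p : int,
  [/\ (0 < q)%R, (N%:Z <= q)%R, coprimez p q & `|q%:~R * a - p%:~R| * q%:~R <= 1].

Definition increments (G : R -> R) n x h :=
  \sum_(i < n) (G (x + h + i%:R * a) - G (x + i%:R * a)).

(** Each increment of [floor_prim] lies between [h] times the floors at its two ends. The factor [h]
    turns the o(n) error of equidistribution into o(1), because [n h <= 1]. *)
Lemma ramp_increments u v eta : 0 < eta -> exists n0 : nat,
  forall n x h, (n0 <= n)%N -> 0 <= h -> n%:R * h <= 1 ->
  `|increments (ramp u v) n x h - n%:R * h * (v - u)| <= eta.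
Proof.
move=> eta0; have e2 : 0 < eta / 2 by lra.
have [n1 hn1] := floor_sum_equidistributed dirichlet e2.
exists (maxn n1 (Num.truncn (2 / eta)).+1) => n x h; rewrite geq_max => /andP[nn1 nn2] h0 nh.
have hE : h <= eta / 2.
  have : 2 / eta <= n%:R.
    by rewrite ltW// (lt_le_trans (truncnS_gt _))// ler_nat.
  rewrite ler_pdivrMr// => h2; have n0 : 0 < n%:R :> R by rewrite ltr0n; case: (n) nn2.
  by nra.
have sum_le (y : R) : h * (floor_sum a n y)%:~R <=
      \sum_(i < n) (floor_prim (y + h + i%:R * a) - floor_prim (y + i%:R * a)) <=
      h * (floor_sum a n (y + h))%:~R.
  rewrite /floor_sum !intr_sum !mulr_sumr; apply/andP; split; apply: ler_sum => i _.
    have := @floor_prim_incr _ (y + i%:R * a) (y + h + i%:R * a); rewrite lerD2r lerDl.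
    by move=> /(_ h0) /andP[+ _]; congr (_ * _ <= _); ring.
  have := @floor_prim_incr _ (y + i%:R * a) (y + h + i%:R * a); rewrite lerD2r lerDl.
  by move=> /(_ h0) /andP[_]; congr (_ <= _ * _); ring.
have -> : increments (ramp u v) n x h =
  \sum_(i < n) (floor_prim (x - u + h + i%:R * a) - floor_prim (x - u + i%:R * a)) -
  \sum_(i < n) (floor_prim (x - v + h + i%:R * a) - floor_prim (x - v + i%:R * a)).
  rewrite -sumrB; apply: eq_bigr => i _; rewrite /ramp.
  have s w z : w + i%:R * a - z = w - z + i%:R * a by ring.
  have s' z : x + h - z = x - z + h by ring.
  by rewrite !s !s'; ring.
have /andP[u1 u2] := sum_le (x - u); have /andP[v1 v2] := sum_le (x - v).
have := hn1 n (x - v) (x - u + h) nn1; have := hn1 n (x - v + h) (x - u) nn1.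
rewrite !ler_norml => /andP[w1 w2] /andP[w3 w4].
set A := \sum_(i < n) _ in u1 u2 *; set B := \sum_(i < n) _ in v1 v2 *.
have nh' : n%:R * h * h <= eta / 2 by nra.
have nh0 : 0 <= n%:R * h by rewrite mulr_ge0.
have k1 : h * ((floor_sum a n (x - u + h))%:~R - (floor_sum a n (x - v))%:~R) <=
   h * (n%:R * (v - u + h) + eta / 2 * n%:R) by apply: ler_wpM2l => //; lra.
have k2 : h * (n%:R * (v - u - h) - eta / 2 * n%:R) <=
   h * ((floor_sum a n (x - u))%:~R - (floor_sum a n (x - v + h))%:~R).
  by apply: ler_wpM2l => //; lra.
have k3 : n%:R * h * eta <= eta by nra.
by apply/andP; split; nra.
Qed.

End ramp_increments.

Lemma big_ord_mul {V : nmodType} (m j : nat) (F : nat -> V) :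
  \sum_(i < m * j) F i = \sum_(r < m) \sum_(q < j) F (r * j + q)%N.
Proof.
elim: m => [|m IH]; first by rewrite mul0n !big_ord0.
by rewrite big_ord_recr -IH mulSn addnC big_split_ord.
Qed.

(** * Increments of absolutely continuous functions along a rotation *)

(* With [w] the length of the vector [(U, D)] and [c] that of [(1, s)],
   [(D - s U)^2 = (w c)^2 - (U + s D)^2]. *)
Lemma chord_defect {R : realType} (U s D mu : R) : 0 < mu -> 0 <= U ->
  let w := Num.sqrt (U ^+ 2 + D ^+ 2) in let c := Num.sqrt (1 + s ^+ 2) in
  0 <= w - (U + s * D) / c /\
  `|D - s * U| <= (w - (U + s * D) / c) / (2 * mu) + mu * (1 + s ^+ 2) * w.
Proof.
move=> mu0 U0 w c.
have w0 : 0 <= w by exact: sqrtr_ge0.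
have c2 : c ^+ 2 = 1 + s ^+ 2 by rewrite sqr_sqrtr// addr_ge0// sqr_ge0.
have w2 : w ^+ 2 = U ^+ 2 + D ^+ 2 by rewrite sqr_sqrtr// addr_ge0// sqr_ge0.
have c0 : 0 < c by rewrite sqrtr_gt0 ltr_wpDr// sqr_ge0.
have E : (D - s * U) ^+ 2 = (w * c) ^+ 2 - (U + s * D) ^+ 2.
  by rewrite exprMn c2 w2; ring.
have cs : U + s * D <= w * c.
  have wc : 0 <= w * c by rewrite mulr_ge0// ltW.
  have := sqr_ge0 (D - s * U); rewrite E subr_ge0 => h.
  have [h0|h0] := leP (U + s * D) 0; first exact: le_trans h0 wc.
  by rewrite -(@ler_pXn2r _ 2) // nnegrE// ltW.
set g := w - (U + s * D) / c.
have gE : U + s * D = (w - g) * c by rewrite /g; field; rewrite gt_eqF.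
have g0 : 0 <= g by rewrite subr_ge0 ler_pdivrMr.
split=> //.
have rhs0 : 0 <= g / (2 * mu) + mu * (1 + s ^+ 2) * w.
  by rewrite -c2; apply: addr_ge0; [apply: divr_ge0 => //; lra|
    apply: mulr_ge0 => //; apply: mulr_ge0; rewrite ?sqr_ge0// ltW].
rewrite -(@ler_pXn2r _ 2) ?nnegrE// real_normK ?num_real// E gE -c2.
have -> : (w * c) ^+ 2 - ((w - g) * c) ^+ 2 = 2 * g * w * c ^+ 2 - g ^+ 2 * c ^+ 2 by ring.
have -> : (g / (2 * mu) + mu * c ^+ 2 * w) ^+ 2 =
    (g / (2 * mu) - mu * c ^+ 2 * w) ^+ 2 + 2 * g * w * c ^+ 2.
  by field; rewrite gt_eqF.
have := sqr_ge0 (g / (2 * mu) - mu * c ^+ 2 * w).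
have : 0 <= g ^+ 2 * c ^+ 2 by rewrite mulr_ge0 ?sqr_ge0.
lra.
Qed.

Section mesh.
Context {R : realType} (G : R -> R).
Hypothesis acG : absolutely_continuous_on `[0, 1]%classic G.

Definition mesh_incr (m i : nat) : R := G (i.+1%:R / m%:R) - G (i%:R / m%:R).

Lemma mesh_incr_sum m j r : (0 < j)%N -> (0 < m)%N ->
  \sum_(q < j) mesh_incr (m * j) (r * j + q) = mesh_incr m r.
Proof.
move=> j0 m0; rewrite -(big_mkord xpredT (fun q => mesh_incr (m * j) (r * j + q))).
rewrite (@telescope_sumr_eq _ 0 j (fun q => G ((r * j + q)%:R / (m * j)%:R)))//; last first.
  by move=> q _; rewrite /mesh_incr addnS.
have jn0 : j%:R != 0 :> R by rewrite pnatr_eq0 -lt0n.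
have mn0 : m%:R != 0 :> R by rewrite pnatr_eq0 -lt0n.
rewrite /mesh_incr addn0 -[(r * j + j)%N]addnC -mulSn !natrM.
by rewrite -!mulf_div !divff ?mulr1.
Qed.

Lemma mesh_incr_small (e : R) : 0 < e -> exists2 d : R, 0 < d &
  forall (m : nat) (A : pred nat), (0 < m)%N ->
    (\sum_(i < m | A i) 1%N)%:R < d * m%:R ->
    \sum_(i < m | A i) `|mesh_incr m i| < e.
Proof.
move=> /acG[d d0 hd]; exists d => // m A m0 hA.
have mR : 0 < m%:R :> R by rewrite ltr0n.
(* A cell outside [A] is replaced by a degenerate interval, so that the family stays indexed by all
   of ['I_m]. *)
have := hd m (fun i => i%:R / m%:R) (fun i => (if A i then i.+1 else i)%:R / m%:R).
have -> : \sum_(i < m | A i) `|mesh_incr m i| =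
    \sum_(i < m) `|G ((if A i then i.+1 else i)%:R / m%:R) - G (i%:R / m%:R)|.
  rewrite big_mkcond/=; apply: eq_bigr => i _.
  by case: ifP; rewrite ?subrr ?normr0.
apply.
- move=> i; have il := ltn_ord i; split.
  + by rewrite ler_pM2r ?invr_gt0// ler_nat; case: ifP.
  + by rewrite /= in_itv/= divr_ge0 ?ler0n// ler_pdivrMr// mul1r ler_nat ltnW.
  + rewrite /= in_itv/= divr_ge0 ?ler0n// ler_pdivrMr// mul1r ler_nat.
    by case: ifP => _ //; rewrite ltnW.
- move=> i j _ _ [x [/=]]; rewrite !in_itv/= => /andP[x1 x2] /andP[x3 x4].
  have h1 := lt_trans x1 x4; have h2 := lt_trans x3 x2.
  move: h1 h2; rewrite !ltr_pM2r ?invr_gt0// !ltr_nat => h1 h2.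
  apply: ord_inj; apply/eqP; rewrite eqn_leq.
  by move: h1 h2; clear; case: (A i); case: (A j); lia.
- rewrite (eq_bigr (fun i : 'I_m => (if A i then 1%N else 0%N)%:R / m%:R)); last first.
    by move=> i _; rewrite -mulrBl; case: ifP; rewrite ?subrr// -natr1 addrAC subrr add0r.
  by rewrite -mulr_suml -natr_sum -big_mkcond ltr_pdivrMr.
Qed.

(** Length of the polygon inscribed in the graph of [G] over the mesh. Its boundedness under
    refinement takes the place of differentiation almost everywhere. *)
Definition polygon_length m : R :=
  \sum_(i < m) Num.sqrt (m%:R^-1 ^+ 2 + mesh_incr m i ^+ 2).

(** With [1 / N < d], where [d] answers [e = 1] in absolute continuity, each of the [N] coarse cells
    carries variation less than 1. *)
Lemma mesh_variation_bounded : exists2 N : nat, (0 < N)%N &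
  forall k, (0 < k)%N -> \sum_(i < N * k) `|mesh_incr (N * k) i| <= N%:R.
Proof.
have [d d0 hd] := mesh_incr_small ltr01.
exists (Num.truncn d^-1).+1 => // k k0; set N := (Num.truncn _).+1.
rewrite (big_ord_mul N k (fun i => `|mesh_incr (N * k) i|)).
rewrite -[leRHS]mulr1 -[N in leRHS]card_ord -sumr_const mulr_suml.
apply: ler_sum => r _; rewrite mul1r ltW//.
have Nk : (0 < N * k)%N by rewrite muln_gt0.
have := hd (N * k)%N (fun i => i %/ k == r)%N Nk.
have sumA (V : nmodType) (F : nat -> V) : \sum_(i < N * k | (i %/ k == r)%N) F i =
    \sum_(q < k) F (r * k + q)%N.
  rewrite big_mkcond/= (big_ord_mul N k (fun i => if (i %/ k == r)%N then F i else 0)).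
  rewrite (bigD1 r)//= [X in _ + X]big1 ?addr0.
    by apply: eq_bigr => q _; rewrite divnMDl// divn_small// addn0 eqxx.
  move=> s sr; rewrite big1// => q _.
  by rewrite divnMDl// divn_small// addn0 ifN.
rewrite (sumA _ (fun i => `|mesh_incr (N * k) i|)); apply.
rewrite (sumA _ (fun=> 1%N)) sum_nat_const card_ord muln1 natrM mulrA.
rewrite -[ltLHS]mul1r ltr_pM2r ?ltr0n// -ltr_pdivrMl// mulr1.
exact: truncnS_gt.
Qed.

(** Take [m] with almost maximal polygon length. Refinements then gain little length, and
    [chord_defect] converts the gain over a cell into a bound on the deviation from constant slope,
    as long as the slope is bounded. Steep cells are few by bounded variation, and absolute
    continuity makes their share small. *)
Lemma mesh_slopes (eta : R) : 0 < eta -> exists2 m : nat, (0 < m)%N &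
  forall j, (0 < j)%N -> \sum_(i < m * j)
    `|mesh_incr (m * j) i - mesh_incr m (i %/ j) / j%:R| <= eta.
Proof.
move=> eta0; have e4 : 0 < eta / 4 by lra.
have [N N0 hN] := mesh_variation_bounded.
have [d d0 hd] := mesh_incr_small e4.
have NR : 1 <= N%:R :> R by rewrite ler1n.
(* At most [N m / K < d m] cells are steeper than [K], so [mesh_incr_small] applies to them. The
   choice of [mu] makes the second term of [chord_defect], summed over a polygon of length at most
   [1 + N], at most [eta / 4]. *)
pose K : R := N%:R / d + 1.
have K0 : 0 < K by rewrite ltr_wpDl// divr_ge0// ltW.
pose mu : R := eta / 4 / ((1 + K ^+ 2) * (1 + N%:R)).
have KN : 0 < (1 + K ^+ 2) * (1 + N%:R) by rewrite mulr_gt0// ltr_wpDr// sqr_ge0.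
have mu0 : 0 < mu by rewrite divr_gt0.
have len_ub k : (0 < k)%N -> polygon_length (N * k) <= 1 + N%:R.
  move=> k0; apply: le_trans (lerD (lexx 1) (hN k k0)); rewrite /polygon_length.
  have Nk : (0 < N * k)%N by rewrite muln_gt0 N0.
  have e1 : 1 = \sum_(i < N * k) (N * k)%:R^-1 :> R.
    by rewrite sumr_const card_ord -[RHS]mulr_natr mulVf// pnatr_eq0 -lt0n.
  rewrite [X in _ <= X + _]e1 -big_split/=; apply: ler_sum => i _.
  set u := (_)%:R^-1; set D := mesh_incr _ _.
  have u0 : 0 <= u by rewrite invr_ge0.
  rewrite -(@ler_pXn2r _ 2) ?nnegrE ?sqrtr_ge0 ?addr_ge0//.
  have -> : (u + `|D|) ^+ 2 = u ^+ 2 + D ^+ 2 + 2 * (u * `|D|).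
    by rewrite -[D ^+ 2]real_normK ?num_real//; ring.
  have uD : 0 <= u ^+ 2 + D ^+ 2 by rewrite addr_ge0// sqr_ge0.
  by rewrite sqr_sqrtr// lerDl mulr_ge0// mulr_ge0.
(* Only multiples of [N] compete, since these are the meshes with bounded variation; refinements of
   such meshes remain among them. *)
pose L := [set polygon_length (N * k) | k in [set k | (0 < k)%N]].
have supL : has_sup L.
  split; first by exists (polygon_length (N * 1)), 1%N.
  by exists (1 + N%:R) => _ [k /= k0 <-]; exact: len_ub.
have e20 : 0 < 2 * mu * (eta / 4) by rewrite mulr_gt0// mulr_gt0.
have [_ [k /= k0 <-] hk] := sup_adherent e20 supL.
have m0 : (0 < N * k)%N by rewrite muln_gt0 N0.
have hNk := hN k k0; have hub := len_ub k k0.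
exists (N * k)%N => // j j0.
have : (N * k * j = N * (k * j))%N by rewrite mulnA.
move: m0 hk hNk hub; move: (N * k)%N => m m0 hk hNk hub mj.
have mR : 0 < m%:R :> R by rewrite ltr0n.
have jR : 0 < j%:R :> R by rewrite ltr0n.
have len_mj : polygon_length (m * j) - polygon_length m <= 2 * mu * (eta / 4).
  have : polygon_length (m * j) <= sup L.
    by apply: sup_upper_bound => //; exists (k * j)%N; rewrite ?mj//= muln_gt0 k0.
  lra.
have ub_mj : polygon_length (m * j) <= 1 + N%:R.
  by rewrite mj; apply: len_ub; rewrite muln_gt0 k0.
pose bad r := K < `|mesh_incr m r * m%:R|.
have bad_small : (\sum_(r < m | bad r) 1%N)%:R < d * m%:R.
  have : K * (\sum_(r < m | bad r) 1%N)%:R <= N%:R * m%:R.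
    rewrite natr_sum mulr_sumr.
    apply: (@le_trans _ _ (\sum_(r < m | bad r) `|mesh_incr m r| * m%:R)).
      apply: ler_sum => r br; rewrite mulr1 ltW//.
      by move: br; rewrite /bad normrM (@ger0_norm _ m%:R).
    rewrite -mulr_suml ler_pM2r//; apply: le_trans hNk.
    by rewrite [leRHS](bigID (fun r : 'I_m => bad r))/= lerDl sumr_ge0.
  have -> : N%:R = (K - 1) * d by rewrite /K; field; rewrite gt_eqF.
  move=> h; rewrite -(ltr_pM2l K0); apply: le_lt_trans h _.
  have : 0 < d * m%:R by rewrite mulr_gt0.
  lra.
have bad1 : \sum_(r < m | bad r) `|mesh_incr m r| <= eta / 4.
  exact/ltW/hd.
have bad2 : \sum_(r < m | bad r) \sum_(q < j) `|mesh_incr (m * j) (r * j + q)| <= eta / 4.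
  have mj0 : (0 < m * j)%N by rewrite muln_gt0 m0.
  have sumb (V : nmodType) (F : nat -> V) : \sum_(i < m * j | bad (i %/ j)%N) F i =
      \sum_(r < m | bad r) \sum_(q < j) F (r * j + q)%N.
    rewrite big_mkcond/= (big_ord_mul m j (fun i => if bad (i %/ j)%N then F i else 0)).
    rewrite [RHS]big_mkcond/=; apply: eq_bigr => r _; case: ifPn => br.
      by apply: eq_bigr => q _; rewrite divnMDl// divn_small// addn0 br.
    by rewrite big1// => q _; rewrite divnMDl// divn_small// addn0 (negbTE br).
  have := hd (m * j)%N (fun i => bad (i %/ j)%N) mj0.
  rewrite (sumb _ (fun=> 1%N)) (sumb _ (fun i => `|mesh_incr (m * j) i|)) => h.
  apply/ltW/h; rewrite (eq_bigr (fun=> (1 * j)%N)); last first.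
    by move=> r _; rewrite sum_nat_const card_ord mul1n muln1.
  have -> : (\sum_(r < m | bad r) (1 * j) = (\sum_(r < m | bad r) 1) * j)%N.
    by rewrite big_distrl.
  by rewrite !natrM mulrA ltr_pM2r.
pose w r q := Num.sqrt ((m * j)%:R^-1 ^+ 2 + mesh_incr (m * j) (r * j + q) ^+ 2).
pose W r := Num.sqrt (m%:R^-1 ^+ 2 + mesh_incr m r ^+ 2).
have parent r : (r < m)%N ->
    \sum_(q < j) `|mesh_incr (m * j) (r * j + q) - mesh_incr m r / j%:R| <=
    (\sum_(q < j) w r q - W r) / (2 * mu) + mu * (1 + K ^+ 2) * \sum_(q < j) w r q +
    (if bad r then \sum_(q < j) `|mesh_incr (m * j) (r * j + q)| + `|mesh_incr m r| else 0).
  move=> rm; pose s := mesh_incr m r * m%:R; pose U : R := (m * j)%:R^-1.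
  have U0 : 0 <= U by rewrite invr_ge0.
  have UE : U = m%:R^-1 * j%:R^-1 by rewrite /U natrM invfM.
  have sU : mesh_incr m r / j%:R = s * U by rewrite UE /s; field; rewrite !gt_eqF.
  have chord q := @chord_defect _ U s (mesh_incr (m * j) (r * j + q)) mu mu0 U0.
  have c0 : 0 < Num.sqrt (1 + s ^+ 2) by rewrite sqrtr_gt0 ltr_wpDr// sqr_ge0.
  (* The small vectors add up to the chord of the cell, whose projection on its own direction is its
     length [W r]; the defects therefore add up to the gain in length. *)
  have sumg : \sum_(q < j) (w r q - (U + s * mesh_incr (m * j) (r * j + q)) / Num.sqrt (1 + s ^+ 2))
      = \sum_(q < j) w r q - W r.
    rewrite sumrB; congr (_ - _); rewrite -mulr_suml big_split/= -mulr_sumr mesh_incr_sum//.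
    rewrite sumr_const card_ord -mulr_natr UE mulfVK ?gt_eqF//.
    have -> : mesh_incr m r = s / m%:R by rewrite /s mulfK// gt_eqF.
    have -> : W r = m%:R^-1 * Num.sqrt (1 + s ^+ 2).
      rewrite /W -[X in _ = X * _]gtr0_norm ?invr_gt0// -sqrtr_sqr -sqrtrM ?sqr_ge0//.
      by congr Num.sqrt; rewrite /s; field; rewrite gt_eqF.
    have -> : m%:R^-1 + s * (s / m%:R) = m%:R^-1 * (Num.sqrt (1 + s ^+ 2)) ^+ 2.
      by rewrite sqr_sqrtr ?addr_ge0 ?sqr_ge0//; ring.
    by field; rewrite !gt_eqF.
  have g0 : 0 <= \sum_(q < j) w r q - W r.
    by rewrite -sumg; apply: sumr_ge0 => q _; exact: (chord q).1.
  have w0 : 0 <= \sum_(q < j) w r q by apply: sumr_ge0 => q _; exact: sqrtr_ge0.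
  have muK : 0 <= mu * (1 + K ^+ 2) by rewrite mulr_ge0 ?ltW// ltr_wpDr// sqr_ge0.
  have gm : 0 <= (\sum_(q < j) w r q - W r) / (2 * mu) by rewrite divr_ge0//; lra.
  case: ifPn => [br|].
    apply: ler_wpDl; first by rewrite addr_ge0// mulr_ge0.
    apply: (@le_trans _ _
      (\sum_(q < j) (`|mesh_incr (m * j) (r * j + q)| + `|mesh_incr m r| / j%:R))).
      apply: ler_sum => q _; apply: le_trans (ler_normB _ _) _.
      by rewrite lerD2l normrM normfV (@gtr0_norm _ j%:R).
    by rewrite big_split/= lerD2l sumr_const card_ord -[leLHS]mulr_natr mulfVK ?gt_eqF.
  rewrite /bad -leNgt -/s => sK; rewrite addr0.
  rewrite -sumg mulr_suml mulr_sumr -big_split/=; apply: ler_sum => q _; rewrite sU.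
  apply: le_trans (chord q).2 _; rewrite lerD2l; apply: ler_wpM2r; first exact: sqrtr_ge0.
  apply: ler_wpM2l; first exact: ltW.
  by rewrite lerD2l -[s ^+ 2]real_normK ?num_real// ler_pXn2r ?nnegrE// ltW.
rewrite (big_ord_mul m j
  (fun i => `|mesh_incr (m * j) i - mesh_incr m (i %/ j) / j%:R|)).
have := ler_sum (index_enum _) (fun (r : 'I_m) (_ : true) => parent r (ltn_ord r)).
rewrite !big_split/= -mulr_suml -mulr_sumr sumrB -big_mkcond big_split/=.
have -> : \sum_(r < m) W r = polygon_length m by [].
have -> : \sum_(r < m) \sum_(q < j) w r q = polygon_length (m * j).
  by rewrite /polygon_length (big_ord_mul m j
    (fun i => Num.sqrt ((m * j)%:R^-1 ^+ 2 + mesh_incr (m * j) i ^+ 2))).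
move=> h; have -> : \sum_(r < m) \sum_(q < j)
    `|mesh_incr (m * j) (r * j + q) - mesh_incr m ((r * j + q) %/ j) / j%:R| =
  \sum_(r < m) \sum_(q < j)
    `|mesh_incr (m * j) (r * j + q) - mesh_incr m r / j%:R|.
  apply: eq_bigr => r _; apply: eq_bigr => q _.
  by rewrite divnMDl// divn_small// addn0.
apply: le_trans h _.
have h1 : (polygon_length (m * j) - polygon_length m) / (2 * mu) <= eta / 4.
  by rewrite ler_pdivrMr; [rewrite mulrC|lra].
have h2 : mu * (1 + K ^+ 2) * polygon_length (m * j) <= eta / 4.
  apply: (@le_trans _ _ (mu * ((1 + K ^+ 2) * (1 + N%:R)))); last first.
    by rewrite /mu mulfVK// gt_eqF.
  rewrite mulrA ler_wpM2l// mulr_ge0 ?ltW// ltr_wpDr// sqr_ge0//.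
lra.
Qed.

End mesh.

(** Rounding [z] down to the grid does not change which grid points are at most [z]. *)
Lemma floor_floor {R : realType} (M : nat) (z : R) (k : int) : (0 < M)%N ->
  Num.floor ((Num.floor (M%:R * z))%:~R / M%:R - k%:~R / M%:R : R) =
  Num.floor (z - k%:~R / M%:R).
Proof.
move=> M0; have MR : 0 < M%:R :> R by rewrite ltr0n.
suff h (n : int) : (n <= Num.floor ((Num.floor (M%:R * z))%:~R / M%:R - k%:~R / M%:R : R))%R =
    (n <= Num.floor (z - k%:~R / M%:R))%R.
  by apply/eqP; rewrite eq_le -h lexx h lexx.
rewrite !floor_ge_int -mulrBl ler_pdivlMr// lerBrDr.
rewrite [in RHS]lerBrDr -[in RHS](ler_pM2r MR) mulrDl mulfVK ?gt_eqF//.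
rewrite [z * _]mulrC.
have -> : n%:~R * M%:R + k%:~R = (n * M + k)%:~R :> R by rewrite intrD intrM pmulrn.
by rewrite ler_int floor_ge_int.
Qed.

Section mesh_shadow.
Context {R : realType} (E : R -> R) (M : nat).
Hypotheses (M0 : (0 < M)%N) (perE : forall z, E (z + 1) = E z).

(** A step function that jumps, at the right end of each cell modulo 1, by the variation of [E] over
    that cell. It dominates [E] sampled at the grid point below, and its increments along an orbit
    are visit counts. *)
Definition step_variation (z : R) : R := \sum_(i < M) `|mesh_incr E M i| *
   (Num.floor (z - i.+1%:R / M%:R))%:~R.

Let MR : 0 < M%:R :> R. Proof. by rewrite ltr0n. Qed.

Lemma step_variation_step (l : int) :
  `|E ((l + 1)%:~R / M%:R) - E (l%:~R / M%:R)| <=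
  step_variation ((l + 1)%:~R / M%:R) - step_variation (l%:~R / M%:R).
Proof.
have M0z : M%:Z != 0 by rewrite eqz_nat -lt0n.
have [r [d [lE r0 rM]]] : exists r d : int, [/\ l = d * M + r, (0 <= r)%R & (r < M)%R].
  exists (l %% M)%Z, (l %/ M)%Z; split; [exact: divz_eq|exact: modz_ge0|].
  by have := ltz_pmod l (_ : (0 < M%:Z)%R); apply.
have rM' : (`|r| < M)%N by lia.
pose i0 := Ordinal rM'.
have rE : r%:~R = `|r|%N%:R :> R by rewrite [RHS]pmulrn gez0_abs.
have shift (s : int) : (d * M + s)%:~R / M%:R = s%:~R / M%:R + 1 *~ d :> R.
  by rewrite intrD intrM -pmulrn; field; rewrite gt_eqF.
have -> : `|E ((l + 1)%:~R / M%:R) - E (l%:~R / M%:R)| = `|mesh_incr E M i0|.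
  rewrite lE -addrA !shift !(period_int d _ perE) /mesh_incr /=.
  by rewrite intrD rE -natr1.
rewrite /step_variation -sumrB (bigD1 i0)//= -mulrBr.
have fl (i : nat) (s : int) :
    Num.floor (s%:~R / M%:R - i.+1%:R / M%:R : R) =
    Num.floor ((s - i.+1%:Z)%:~R / M%:R : R).
  by rewrite intrB -pmulrn mulrBl.
have flM (s : int) : Num.floor ((s * M)%:~R / M%:R : R) = s.
  by rewrite intrM -pmulrn mulfK ?gt_eqF// intrKfloor.
have -> : (Num.floor ((l + 1)%:~R / M%:R - `|r|.+1%:R / M%:R : R))%:~R -
    (Num.floor (l%:~R / M%:R - `|r|.+1%:R / M%:R : R))%:~R = 1 :> R.
  rewrite !fl.
  have -> : l + 1 - (`|r|.+1)%N%:Z = d * M by rewrite {1}lE; lia.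
  have -> : l - (`|r|.+1)%N%:Z = d * M - 1 by rewrite {1}lE; lia.
  rewrite flM; have -> : Num.floor ((d * M - 1)%:~R / M%:R : R) = d - 1.
    have e : (d * M - 1)%:~R / M%:R = d%:~R - M%:R^-1 :> R.
      by rewrite intrB intrM -[M%:~R]pmulrn; field; rewrite gt_eqF.
    apply: floor_def; rewrite subrK e intrB lerD2l lerN2 invf_le1// ler1n M0/=.
    by rewrite ltrBlDr ltrDl invr_gt0.
  by rewrite intrB; ring.
rewrite mulr1 lerDl; apply: sumr_ge0 => i _; rewrite -mulrBr mulr_ge0// subr_ge0 ler_int.
by apply: le_floor; rewrite lerD2r ler_pM2r ?invr_gt0// ler_int; lia.
Qed.

Lemma step_variation_le (z w : R) : z <= w ->
  `|E ((Num.floor (M%:R * w))%:~R / M%:R) - E ((Num.floor (M%:R * z))%:~R / M%:R)| <=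
  step_variation w - step_variation z.
Proof.
move=> zw.
have sv (x : R) : step_variation ((Num.floor (M%:R * x))%:~R / M%:R) = step_variation x.
  by apply: eq_bigr => i _; rewrite [i.+1%:R]pmulrn floor_floor.
rewrite -(sv w) -(sv z).
have : (Num.floor (M%:R * z) <= Num.floor (M%:R * w))%R.
  by apply: le_floor; rewrite ler_pM2l.
move: (Num.floor (M%:R * z)) (Num.floor (M%:R * w)) => l l' ll'.
have -> : l' = l + `|l' - l|%N by move: ll'; clear; lia.
elim: `|_|%N => [|n IH]; first by rewrite addr0 !subrr normr0.
have := step_variation_step (l + n); rewrite -addrA.
have -> : n%:Z + 1 = n.+1%:Z by lia.
move=> h; apply: le_trans (ler_distD (E ((l + n)%:~R / M%:R)) _ _) _.
by apply: le_trans (lerD h IH) _; rewrite addrA subrK.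
Qed.

End mesh_shadow.

Lemma ramp_mesh {R : realType} (m j i r : nat) :
  (0 < m)%N -> (0 < j)%N -> (i < m * j)%N -> (r < m)%N ->
  mesh_incr (ramp (r%:R / m%:R) (r.+1%:R / m%:R)) (m * j) i =
  (i %/ j == r)%N%:R / (m * j)%:R :> R.
Proof.
move=> m0 j0 imj rm; have mR : 0 < m%:R :> R by rewrite ltr0n.
have jR : 0 < j%:R :> R by rewrite ltr0n.
have mjR : 0 < (m * j)%:R :> R by rewrite ltr0n muln_gt0 m0.
have scale (s : nat) : s%:R / m%:R = (s * j)%:R / (m * j)%:R :> R.
  by rewrite !natrM; field; rewrite !gt_eqF.
(* On [-1, 1] [floor_prim] is the negative part, which truncated subtraction of naturals
   expresses. *)
have fp (x y : nat) : (x <= m * j)%N -> (y <= m * j)%N ->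
    floor_prim (x%:R / (m * j)%:R - y%:R / (m * j)%:R) =
    (y - x)%N%:R / (m * j)%:R :> R.
  move=> xm ym; rewrite -mulrBl floor_prim01; last first.
    rewrite ler_pdivlMr// ler_pdivrMr// mulN1r mul1r.
    have := ler0n R x; have := ler0n R y; move: xm ym; rewrite -!(ler_nat R) => *.
    by apply/andP; split; lra.
  have [xy|yx] := leqP x y.
    by rewrite natrB// max_r -mulNr opprB// mulr_ge0 ?invr_ge0 ?subr_ge0 ?ler_nat// ltW.
  have /eqP -> : (y - x == 0)%N by rewrite subn_eq0 ltnW.
  rewrite mul0r max_l// oppr_le0; apply: mulr_ge0; last by rewrite invr_ge0 ltW.
  by rewrite subr_ge0 ler_nat ltnW.
rewrite /mesh_incr /ramp !scale.
have rj : (r.+1 * j <= m * j)%N by rewrite leq_mul2r rm orbT.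
have rj' : (r * j <= m * j)%N by rewrite leq_mul2r ltnW// orbT.
rewrite !fp//; try exact: ltnW.
rewrite -!mulrBl; congr (_ / _); rewrite mulSn.
have := divn_eq i j; have := ltn_pmod i j0; set d := (i %/ j)%N; set e := (i %% j)%N.
move=> ej iE; have [dr|dr|dr] := ltngtP d r.
- have h : (d * j + j <= r * j)%N by rewrite addnC -mulSn leq_mul2r dr orbT.
  by rewrite !natrB; [rewrite natrD -natr1 mulr0n; ring|lia..].
- have h : (r * j + j <= d * j)%N by rewrite addnC -mulSn leq_mul2r dr orbT.
  have -> : (r * j - i.+1 = 0)%N by lia.
  have -> : (j + r * j - i.+1 = 0)%N by lia.
  have -> : (r * j - i = 0)%N by lia.
  have -> : (j + r * j - i = 0)%N by lia.
  by rewrite /= !subrr.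
- rewrite -dr; have -> : (d * j - i.+1 = 0)%N by lia.
  have -> : (d * j - i = 0)%N by lia.
  by rewrite !natrB; [rewrite -natr1 /= mulr1n; ring|lia..].
Qed.

Section lift_increments.
Context {R : realType} (a C : R).
Hypothesis badly : forall m l : int, (0 < m)%R ->
  1 <= C * m%:~R * `|m%:~R * a - l%:~R|.
Hypothesis dirichlet : forall N : nat, exists q p : int,
  [/\ (0 < q)%R, (N%:Z <= q)%R, coprimez p q & `|q%:~R * a - p%:~R| * q%:~R <= 1].

(* For a 1-periodic [E], [E (x_i + h) - E x_i] is compared with the mesh
   increments of [E] in between; a mesh point is met by at most [1 + C n h] of
   the intervals [[x_i, x_i + h]]. *)
Lemma periodic_increments (E : R -> R) (m : nat) (eta : R) : (0 < m)%N ->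
  (forall z, E (z + 1) = E z) ->
  (forall z e, 0 < e -> exists2 d, 0 < d & forall w, z - d < w <= z -> `|E w - E z| < e) ->
  (forall j, (0 < j)%N -> \sum_(i < m * j) `|mesh_incr E (m * j) i| <= eta) ->
  forall n x h, 0 <= h < 1 ->
  `|increments a E n x h| <= (1 + C * n%:R * h) * eta.
Proof.
move=> m0 perE contE hE n x h /andP[h0 h1].
(* [2 n] values of [E] are replaced by values at grid points, at a cost [e'] each; the added 1 keeps
   the denominator positive for [n = 0]. *)
apply/ler_addgt0Pr => e e0; pose e' := e / (2 * n%:R + 1).
have n2 : 0 < 2 * n%:R + 1 :> R by rewrite ltr_wpDl// mulr_ge0.
have e'0 : 0 < e' by rewrite divr_gt0.
pose pt (j : nat) (z : R) := (Num.floor ((m * j)%:R * z))%:~R / (m * j)%:R : R.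
have near_pt z : \forall j \near \oo, `|E (pt j z) - E z| < e'.
  have [d d0 hd] := contE z e' e'0.
  exists (Num.truncn d^-1).+1 => // j /= hj; apply: hd.
  have j0 : (0 < j)%N by case: j hj.
  have mj0 : 0 < (m * j)%:R :> R by rewrite ltr0n muln_gt0 m0.
  have [f1 f2] := floor_itv_le ((m * j)%:R * z).
  rewrite /pt; apply/andP; split; last by rewrite ler_pdivrMr// [z * _]mulrC.
  rewrite ltr_pdivlMr// mulrBl [z * _]mulrC.
  suff : 1 < d * (m * j)%:R by lra.
  rewrite -ltr_pdivrMl// mulr1; apply: lt_le_trans (truncnS_gt _) _.
  by rewrite ler_nat (leq_trans hj)// leq_pmull.
have : \forall j \near \oo, forall i : 'I_n,
    `|E (pt j (x + h + i%:R * a)) - E (x + h + i%:R * a)| < e' /\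
    `|E (pt j (x + i%:R * a)) - E (x + i%:R * a)| < e'.
  by apply: filter_forall => i; near=> j; split; near: j; exact: near_pt.
case=> J _ hJ; have := hJ J.+1 (leqnSn J); set j := J.+1 => {hJ} hj.
have mj0 : (0 < m * j)%N by rewrite muln_gt0 m0.
apply: le_trans (ler_norm_sum _ _ _) _.
apply: (@le_trans _ _ (\sum_(i < n) (step_variation E (m * j) (x + h + i%:R * a) -
    step_variation E (m * j) (x + i%:R * a) + 2 * e'))).
  apply: ler_sum => i _; have [k1 k2] := hj i.
  have := @step_variation_le _ E (m * j) mj0 perE (x + i%:R * a) (x + h + i%:R * a).
  rewrite lerD2r lerDl => /(_ h0); rewrite -!/(pt _ _) => k3.
  have -> : E (x + h + i%:R * a) - E (x + i%:R * a) =
    - (E (pt j (x + h + i%:R * a)) - E (x + h + i%:R * a)) +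
    (E (pt j (x + h + i%:R * a)) - E (pt j (x + i%:R * a))) +
    (E (pt j (x + i%:R * a)) - E (x + i%:R * a)) by ring.
  apply: le_trans (ler_normD _ _) _; apply: (@le_trans _ _ (_ + _)).
    by apply: lerD; [exact: ler_normD|exact: lexx].
  by rewrite normrN; move: k1 k2 k3 => /ltW k1 /ltW k2 k3; lra.
rewrite big_split/= sumr_const card_ord; apply: lerD; last first.
  have eE : e = e' * (2 * n%:R + 1) by rewrite /e' mulfVK// gt_eqF.
  rewrite -[leLHS]mulr_natr [leRHS]eE; lra.
rewrite (eq_bigr (fun i : 'I_n => \sum_(l < m * j) `|mesh_incr E (m * j) l| *
  ((Num.floor (x + h + i%:R * a - l.+1%:R / (m * j)%:R))%:~R -
   (Num.floor (x + i%:R * a - l.+1%:R / (m * j)%:R))%:~R))); last first.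
  by move=> i _; rewrite -sumrB; apply: eq_bigr => l _; rewrite mulrBr.
rewrite exchange_big/= mulrC; apply: (@le_trans _ _
  ((\sum_(l < m * j) `|mesh_incr E (m * j) l|) * (1 + C * n%:R * h))); last first.
  apply: ler_wpM2r; last exact: hE.
  by rewrite addr_ge0// !mulr_ge0// (badly_cst_ge0 badly).
rewrite mulr_suml; apply: ler_sum => l _; rewrite -mulr_sumr; apply: ler_wpM2l => //.
set y := l.+1%:R / _.
apply: le_trans (floor_sum_gap badly n (x - y) (h := h) _); last by rewrite h0.
rewrite sumrB /floor_sum !intr_sum le_eqVlt; apply/orP; left; apply/eqP.
by congr (_ - _); apply: eq_bigr => i _; congr (Num.floor _)%:~R; ring.
Unshelve. all: end_near. Qed.

(** [G] is split into ramps with its mesh slopes, to which equidistribution applies, and a remainder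
    [E]. The ramps absorb the whole gain [S] per period, so [E] is periodic; its variation on every
    refinement is at most [eta1], and a point is crossed at most [1 + C] times. *)
Lemma lift_increments (G : R -> R) (S eta : R) : 0 < eta ->
  (forall z, G (z + 1) = G z + S) -> continuous G ->
  absolutely_continuous_on `[0, 1]%classic G ->
  exists n0 : nat, forall n x h, (n0 <= n)%N -> 0 <= h -> n%:R * h <= 1 ->
  `|increments a G n x h - n%:R * h * S| <= eta.
Proof.
move=> eta0 GS cG acG; have C0 := badly_cst_ge0 badly.
pose eta1 := eta / (2 * (1 + C)).
have C1 : 0 < 1 + C by lra.
have eta10 : 0 < eta1 by rewrite divr_gt0// mulr_gt0.
have [m m0 hm] := mesh_slopes acG eta10.
have mR : 0 < m%:R :> R by rewrite ltr0n.
pose c (r : nat) := mesh_incr G m r * m%:R.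
pose rp (r : nat) : R -> R := ramp (r%:R / m%:R) (r.+1%:R / m%:R).
pose E z := G z - \sum_(r < m) c r * rp r z.
have len (r : nat) : r.+1%:R / m%:R - r%:R / m%:R = m%:R^-1 :> R.
  by rewrite -mulrBl -natr1 addrAC subrr add0r mul1r.
have cS : \sum_(r < m) c r * m%:R^-1 = S.
  rewrite (eq_bigr (fun r : 'I_m => mesh_incr G m r)); last first.
    by move=> r _; rewrite /c mulfK// gt_eqF.
  rewrite -(big_mkord xpredT (mesh_incr G m)).
  rewrite (@telescope_sumr_eq _ 0 m (fun r => G (r%:R / m%:R)))//.
  by rewrite mul0r divff ?gt_eqF// -[1]add0r GS addrAC subrr add0r.
have perE z : E (z + 1) = E z.
  have e : \sum_(r < m) c r * rp r (z + 1) = \sum_(r < m) c r * rp r z + S.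
    rewrite -cS -big_split/=; apply: eq_bigr => r _.
    by rewrite /rp rampD1 len mulrDr.
  by rewrite /E GS e; ring.
have e3 : 0 < eta / (2 * (1 + \sum_(r < m) `|c r|)).
  by rewrite divr_gt0// mulr_gt0// ltr_wpDr// sumr_ge0.
have : \forall n \near \oo, forall r : 'I_m, forall x h, 0 <= h -> n%:R * h <= 1 ->
    `|increments a (rp r) n x h - n%:R * h * m%:R^-1| <=
    eta / (2 * (1 + \sum_(r < m) `|c r|)).
  apply: filter_forall => r.
  have [n0 hn0] := ramp_increments dirichlet (r%:R / m%:R) (r.+1%:R / m%:R) e3.
  by exists n0 => // n /= nn0 x h h0 nh; have := hn0 n x h nn0 h0 nh; rewrite len.
case=> n0 _ hn0; exists (maxn n0 2) => n x h; rewrite geq_max => /andP[nn0 n2] h0 nh.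
have h1 : 0 <= h < 1.
  rewrite h0/=; have : 2 <= n%:R :> R by rewrite ler_nat.
  nra.
have -> : increments a G n x h = increments a E n x h +
    \sum_(r < m) c r * increments a (rp r) n x h.
  rewrite /increments (eq_bigr (fun r : 'I_m => \sum_(i < n) c r *
    (rp r (x + h + i%:R * a) - rp r (x + i%:R * a)))); last first.
    by move=> r _; rewrite mulr_sumr.
  rewrite exchange_big -big_split/=; apply: eq_bigr => i _; rewrite /E.
  rewrite [X in _ = _ + X](eq_bigr (fun r : 'I_m => c r * rp r (x + h + i%:R * a) -
    c r * rp r (x + i%:R * a))); last by move=> r _; rewrite mulrBr.
  by rewrite sumrB; ring.
have -> : increments a E n x h + \sum_(r < m) c r * increments a (rp r) n x h -
    n%:R * h * S = increments a E n x h +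
    \sum_(r < m) c r * (increments a (rp r) n x h - n%:R * h * m%:R^-1).
  rewrite -cS mulr_sumr -addrA -sumrB; congr (_ + _); apply: eq_bigr => r _; ring.
apply: le_trans (ler_normD _ _) _.
have -> : eta = eta / 2 + eta / 2 by lra.
apply: lerD.
  have contE z e : 0 < e -> exists2 d, 0 < d &
      forall w, z - d < w <= z -> `|E w - E z| < e.
    move=> e0; pose e' := e / (2 + \sum_(r < m) `|c r| * 2).
    have den0 : 0 < 2 + \sum_(r < m) `|c r| * 2.
      by rewrite ltr_wpDr// sumr_ge0// => r _; rewrite mulr_ge0.
    have e'0 : 0 < e' by rewrite divr_gt0.
    have lc (K : R -> R) : (exists2 d, 0 < d & forall w, z - d < w <= z -> `|K w - K z| < e') ->
        \forall d \near 0^'+, forall w, z - d < w <= z -> `|K w - K z| < e'.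
      move=> [d d0 hd]; near=> d' => w /andP[w1 w2]; apply: hd; rewrite w2 andbT.
      by apply: le_lt_trans w1; rewrite lerD2l lerN2; near: d'; exact: nbhs_right_le.
    have cGz : \forall d \near 0^'+, forall w, z - d < w <= z -> `|G w - G z| < e'.
      apply: lc; have /cvgrPdist_lt /(_ _ e'0) := cG z.
      case=> d /= d0 hd; exists d => // w /andP[w1 w2]; rewrite distrC; apply: hd.
      by rewrite /ball_/= ger0_norm; lra.
    have cR : \forall d \near 0^'+, forall (r : 'I_m) w, z - d < w <= z ->
        `|rp r w - rp r z| < e' * 2.
      apply: filter_forall => r.
      have [d1 d10 hd1] := floor_prim_left_cont (z - r%:R / m%:R) e'0.
      have [d2 d20 hd2] := floor_prim_left_cont (z - r.+1%:R / m%:R) e'0.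
      near=> d => w /andP[w1 w2]; rewrite /rp /ramp.
      have b1 : d <= d1 by near: d; exact: nbhs_right_le.
      have b2 : d <= d2 by near: d; exact: nbhs_right_le.
      have := hd1 (w - r%:R / m%:R); have := hd2 (w - r.+1%:R / m%:R).
      rewrite !lerD2r w2 !andbT => /(_ ltac:(lra)) + /(_ ltac:(lra)).
      by rewrite !ltr_norml => /andP[? ?] /andP[? ?]; apply/andP; split; lra.
    near (0 : R)^'+ => d; exists d => // w hw.
    have k1 : `|G w - G z| < e' by move: w hw; near: d.
    have k2 (r : 'I_m) : `|rp r w - rp r z| < e' * 2 by move: r w hw {k1}; near: d.
    rewrite /E.
    have -> : G w - \sum_(r < m) c r * rp r w - (G z - \sum_(r < m) c r * rp r z) =
       (G w - G z) - \sum_(r < m) c r * (rp r w - rp r z).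
      rewrite [X in _ = _ - X](eq_bigr (fun r : 'I_m => c r * rp r w - c r * rp r z)).
        by rewrite sumrB; ring.
      by move=> r _; rewrite mulrBr.
    apply: le_lt_trans (ler_normB _ _) _.
    apply: (@lt_le_trans _ _ (e' + e' * \sum_(r < m) `|c r| * 2)).
      apply: ltr_leD => //; apply: le_trans (ler_norm_sum _ _ _) _.
      rewrite mulr_sumr; apply: ler_sum => r _; rewrite normrM.
      by rewrite [leRHS]mulrCA; apply: ler_wpM2l => //; exact: ltW.
    have : e = e' * (2 + \sum_(r < m) `|c r| * 2) by rewrite /e' mulfVK// gt_eqF.
    by move=> eE; rewrite [leRHS]eE mulrDr lerD2r; lra.
  have meshE j : (0 < j)%N -> \sum_(i < m * j) `|mesh_incr E (m * j) i| <= eta1.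
    move=> j0; apply: le_trans (hm j j0); apply: ler_sum => i _.
    have il := ltn_ord i.
    have jR : 0 < j%:R :> R by rewrite ltr0n.
    have im : (i %/ j < m)%N by rewrite ltn_divLR.
    rewrite le_eqVlt; apply/orP; left; apply/eqP; congr `|_|.
    have -> : mesh_incr E (m * j) i = mesh_incr G (m * j) i -
        \sum_(r < m) c r * mesh_incr (rp r) (m * j) i.
      rewrite /mesh_incr /E [X in _ = _ - X](eq_bigr (fun r : 'I_m =>
        c r * rp r (i.+1%:R / (m * j)%:R) - c r * rp r (i%:R / (m * j)%:R))).
        by rewrite sumrB; ring.
      by move=> r _; rewrite mulrBr.
    congr (_ - _); rewrite (bigD1 (Ordinal im))//= big1 ?addr0.
      rewrite ramp_mesh// eqxx /c mulr1n natrM /=; field; rewrite !gt_eqF//.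
    move=> r rm; rewrite ramp_mesh//; case: eqP => [e|_]; last by rewrite mul0r mulr0.
    by case/eqP: rm; apply: val_inj; rewrite /= e.
  apply: le_trans (periodic_increments m0 perE contE meshE n x h1) _.
  have -> : eta / 2 = (1 + C) * eta1 by rewrite /eta1; field; rewrite gt_eqF.
  apply: ler_wpM2r; first exact: ltW.
  by rewrite lerD2l -mulrA ler_piMr.
apply: le_trans (ler_norm_sum _ _ _) _.
apply: (@le_trans _ _ (\sum_(r < m) `|c r| * (eta / (2 * (1 + \sum_(r < m) `|c r|))))).
  by apply: ler_sum => r _; rewrite normrM ler_wpM2l//; exact: hn0.
rewrite -mulr_suml; set c1 := \sum_(r < m) `|c r|.
have c10 : 0 <= c1 by exact: sumr_ge0.
rewrite mulrA ler_pdivrMr ?mulr_gt0//; [|lra].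
rewrite mulrA mulfVK//; nra.
Unshelve. all: end_near. Qed.

End lift_increments.

(** * Removing the jumps of the roof *)

Section frac_theory.
Context {R : realType}.
Implicit Types x y : R.

Lemma frac_itv x : 0 <= frac x < 1.
Proof. by rewrite /frac; have [? ?] := floor_itv_le x; apply/andP; split; lra. Qed.

Lemma fracDint x (n : int) : frac (x + n%:~R) = frac x.
Proof. by rewrite /frac floorDint intrD; ring. Qed.

Lemma fracD1 x : frac (x + 1) = frac x.
Proof. exact: (fracDint x 1). Qed.

Lemma frac_id x : 0 <= x < 1 -> frac x = x.
Proof.
move=> /andP[x0 x1]; rewrite /frac (_ : Num.floor x = 0) ?subr0//.
by apply: floor_def; rewrite x0 add0r.
Qed.

Lemma fracK x y : frac (frac x + y) = frac (x + y).
Proof.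
by rewrite {2}/frac (_ : _ + y = x + y + (- Num.floor x)%:~R) ?fracDint// intrN; ring.
Qed.

End frac_theory.

Section one_sided_limits.
Context {R : realType} (g : R -> R).
Implicit Types x l : R.

Lemma cvg_at_leftP_dist x l : g y @[y --> x^'-] --> l <->
  forall e, 0 < e -> exists2 d, 0 < d & forall y, x - d < y < x -> `|g y - l| < e.
Proof.
split=> [/cvgrPdist_lt h e e0|h].
  have [d /= d0 hd] := h e e0; exists d => // y /andP[y1 y2].
  by rewrite distrC; apply: hd => //; rewrite /ball_/= ger0_norm; lra.
apply/cvgrPdist_lt => e e0; have [d d0 hd] := h e e0; exists d => //= y xy yx.
rewrite distrC; apply: hd; rewrite yx andbT.
by move: xy; rewrite /ball_/= ltr_norml => /andP[]; lra.
Qed.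

Lemma cvg_at_rightP_dist x l : g y @[y --> x^'+] --> l <->
  forall e, 0 < e -> exists2 d, 0 < d & forall y, x < y < x + d -> `|g y - l| < e.
Proof.
split=> [/cvgrPdist_lt h e e0|h].
  have [d /= d0 hd] := h e e0; exists d => // y /andP[y1 y2].
  by rewrite distrC; apply: hd => //; rewrite /ball_/= ler0_norm; lra.
apply/cvgrPdist_lt => e e0; have [d d0 hd] := h e e0; exists d => //= y xy yx.
rewrite distrC; apply: hd; rewrite yx/=.
by move: xy; rewrite /ball_/= ltr_norml => /andP[]; lra.
Qed.

End one_sided_limits.

Section absolute_continuity.
Context {R : realType}.
Implicit Types (g h : R -> R) (u v w : R) (I : set R).

Lemma ac_uniform I g (e : R) : absolutely_continuous_on I g -> 0 < e ->
  exists2 d : R, 0 < d & forall x y, I x -> I y -> `|y - x| < d -> `|g y - g x| < e.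
Proof.
move=> acg /acg[d d0 hd]; exists d => // x y.
wlog xy : x y / x <= y.
  move=> H Ix Iy xyd; have [xy|/ltW xy] := leP x y; first exact: H.
  by rewrite distrC; apply: H => //; rewrite distrC.
move=> Ix Iy; rewrite ger0_norm ?subr_ge0// => xyd.
have := hd 1%N (fun=> x) (fun=> y); rewrite !big_ord1; apply => //.
by move=> i j _ _ _; rewrite [i]ord1 [j]ord1.
Qed.

Lemma ac_eq I g h : {in I, g =1 h} -> absolutely_continuous_on I g ->
  absolutely_continuous_on I h.
Proof.
move=> gh acg e /acg[d d0 hd]; exists d => // n u v Iuv tI s.
rewrite (eq_bigr (fun i => `|g (v i) - g (u i)|)) ?hd// => i _.
by have [_ Iu Iv] := Iuv i; rewrite !gh// inE.
Qed.

Lemma ac_addc I g (c : R) : absolutely_continuous_on I g ->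
  absolutely_continuous_on I (fun x => g x + c).
Proof.
move=> acg e /acg[d d0 hd]; exists d => // n u v Iuv tI s.
rewrite (eq_bigr (fun i => `|g (v i) - g (u i)|)) ?hd// => i _.
by congr `|_|; ring.
Qed.

Lemma ac_shift g u v (c : R) : absolutely_continuous_on `[u, v]%classic g ->
  absolutely_continuous_on `[u - c, v - c]%classic (fun x => g (x + c)).
Proof.
move=> acg e /acg[d d0 hd]; exists d => // n x y Ixy tI s.
apply: (hd n (fun i => x i + c) (fun i => y i + c)).
- move=> i; have [xy] := Ixy i; rewrite /= !in_itv/= => /andP[? ?] /andP[? ?].
  by split; [lra| |]; apply/andP; split; lra.
- move=> i j _ _ [z [/=]]; rewrite !in_itv/= => /andP[? ?] /andP[? ?].
  by apply: tI => //; exists (z - c); split; rewrite /= in_itv/=; apply/andP; split; lra.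
- by rewrite (eq_bigr (fun i => y i - x i))// => i _; ring.
Qed.

Lemma minr_incr (x y v : R) : x <= y ->
  Num.min x v <= Num.min y v /\ Num.min y v - Num.min x v <= y - x.
Proof. by move=> xy; have [?|?] := leP x v; have [?|?] := leP y v; split; lra. Qed.

Lemma maxr_incr (x y v : R) : x <= y ->
  Num.max x v <= Num.max y v /\ Num.max y v - Num.max x v <= y - x.
Proof. by move=> xy; have [?|?] := leP x v; have [?|?] := leP y v; split; lra. Qed.

(** Truncation at [v] by [Num.min] and [Num.max] cuts every interval in two; the truncated families
    stay disjoint and do not get longer. *)
Lemma ac_glue g u v w : u <= v -> v <= w ->
  absolutely_continuous_on `[u, v]%classic g ->
  absolutely_continuous_on `[v, w]%classic g ->
  absolutely_continuous_on `[u, w]%classic g.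
Proof.
move=> uv vw ac1 ac2 e e0; have e2 : 0 < e / 2 by lra.
have [d1 d10 h1] := ac1 _ e2; have [d2 d20 h2] := ac2 _ e2.
exists (Num.min d1 d2); first by rewrite lt_min d10.
move=> n x y Ixy tI s.
have split_incr i : g (y i) - g (x i) =
    (g (Num.min (y i) v) - g (Num.min (x i) v)) + (g (Num.max (y i) v) - g (Num.max (x i) v)).
  by have [_|_] := leP (x i) v; have [_|_] := leP (y i) v; ring.
have len i : [/\ x i <= y i, u <= x i & y i <= w].
  by have [xy] := Ixy i; rewrite /= !in_itv/= => /andP[? ?] /andP[? ?].
apply: (@le_lt_trans _ _ (\sum_(i < n) `|g (Num.min (y i) v) - g (Num.min (x i) v)| +
    \sum_(i < n) `|g (Num.max (y i) v) - g (Num.max (x i) v)|)).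
  by rewrite -big_split; apply: ler_sum => i _; rewrite split_incr ler_normD.
have -> : e = e / 2 + e / 2 by lra.
apply: ltrD.
  apply: (h1 n (fun i => Num.min (x i) v) (fun i => Num.min (y i) v)).
  - move=> i; have [xy ux yw] := len i; split; first exact: (minr_incr v xy).1.
      by rewrite /= in_itv/= le_min ge_min lexx orbT ux uv.
    by rewrite /= in_itv/= le_min ge_min lexx orbT (le_trans ux xy) uv.
  - move=> i j _ _ [z [/=]]; rewrite !in_itv/= !lt_min !gt_min.
    move=> /andP[/orP xi /andP[yi zv]] /andP[/orP xj /andP[yj _]].
    apply: tI => //; exists z; split; rewrite /= in_itv/= ?yi ?yj andbT.
      by case: xi => // /(lt_trans zv); rewrite ltxx.
    by case: xj => // /(lt_trans zv); rewrite ltxx.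
  - apply: (@le_lt_trans _ _ (\sum_(i < n) (y i - x i))).
      by apply: ler_sum => i _; have [xy _ _] := len i; exact: (minr_incr v xy).2.
    by apply: lt_le_trans s _; rewrite ge_min lexx.
apply: (h2 n (fun i => Num.max (x i) v) (fun i => Num.max (y i) v)).
- move=> i; have [xy ux yw] := len i; split; first exact: (maxr_incr v xy).1.
    by rewrite /= in_itv/= le_max ge_max lexx orbT (le_trans xy yw) vw.
  by rewrite /= in_itv/= le_max ge_max lexx orbT yw vw.
- move=> i j _ _ [z [/=]]; rewrite !in_itv/= !gt_max !lt_max.
  move=> /andP[/andP[xi vz] /orP yi] /andP[/andP[xj _] /orP yj].
  apply: tI => //; exists z; split; rewrite /= in_itv/= ?xi ?xj/=.
    by case: yi => // /(lt_trans vz); rewrite ltxx.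
  by case: yj => // /(lt_trans vz); rewrite ltxx.
- apply: (@le_lt_trans _ _ (\sum_(i < n) (y i - x i))).
    by apply: ler_sum => i _; have [xy _ _] := len i; exact: (maxr_incr v xy).2.
  by apply: lt_le_trans s _; rewrite ge_min lexx orbT.
Qed.

Lemma ac_itv_continuous u v g x : absolutely_continuous_on `]u, v[%classic g ->
  u < x < v -> g y @[y --> x] --> g x.
Proof.
move=> acg /andP[ux xv]; apply/cvgrPdist_lt => e e0.
have [d d0 hd] := ac_uniform acg e0.
near=> y; rewrite distrC; apply: hd.
- by rewrite /= in_itv/= ux.
- by near: y; apply: near_in_itvoo; rewrite in_itv/= ux.
- by near: y; exists d => //= z; rewrite /ball_/= distrC.
Unshelve. all: end_near. Qed.

Lemma ac_cvg_left u v g : u < v -> absolutely_continuous_on `]u, v[%classic g ->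
  cvg (g y @[y --> v^'-]).
Proof.
move=> uv acg; apply: cauchy_cvg; apply: cauchy_exP => e e0.
have [d d0 hd] := ac_uniform acg e0.
pose m := Num.max ((u + v) / 2) (v - d / 2).
have mm : [/\ (u + v) / 2 <= m, v - d / 2 <= m & m < v].
  by rewrite /m !le_max !lexx orbT gt_max; split => //; apply/andP; split; lra.
have [m1 m2 m3] := mm.
exists (g m); suff : \forall y \near v^'-, `|g m - g y| < e by [].
near=> y; rewrite distrC.
have ym : m < y by near: y; exact: nbhs_left_gt.
have yv : y < v by near: y; exact: nbhs_left_lt.
by apply: hd; rewrite /= ?in_itv/=; try (apply/andP; split); rewrite ?ger0_norm; lra.
Unshelve. all: end_near. Qed.

Lemma ac_cvg_right u v g : u < v -> absolutely_continuous_on `]u, v[%classic g ->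
  cvg (g y @[y --> u^'+]).
Proof.
move=> uv acg; apply: cauchy_cvg; apply: cauchy_exP => e e0.
have [d d0 hd] := ac_uniform acg e0.
pose m := Num.min ((u + v) / 2) (u + d / 2).
have mm : [/\ m <= (u + v) / 2, m <= u + d / 2 & u < m].
  by rewrite /m !ge_min !lexx orbT lt_min; split => //; apply/andP; split; lra.
have [m1 m2 m3] := mm.
exists (g m); suff : \forall y \near u^'+, `|g m - g y| < e by [].
near=> y; rewrite distrC.
have ym : y < m by near: y; exact: nbhs_right_lt.
have yv : u < y by near: y; exact: nbhs_right_gt.
by apply: hd; rewrite /= ?in_itv/=; try (apply/andP; split); rewrite ?ler0_norm; lra.
Unshelve. all: end_near. Qed.

(* The contractions [x + t (c - x)] towards the midpoint map [u, v] into the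
   open interval, and [t] tends to 0. *)
Lemma ac_closure u v g : u < v -> absolutely_continuous_on `]u, v[%classic g ->
  g y @[y --> u^'+] --> g u -> g y @[y --> v^'-] --> g v ->
  absolutely_continuous_on `[u, v]%classic g.
Proof.
move=> uv acg gu gv e e0; have e2 : 0 < e / 2 by lra.
have [d d0 hd] := acg _ e2; exists d => // n x y Ixy tI s.
pose c := (u + v) / 2; pose phi t z := z + t * (c - z).
have phiD t z w : phi t w - phi t z = (1 - t) * (w - z) by rewrite /phi; ring.
have phi_itv t z : 0 < t < 1 -> u <= z <= v -> u < phi t z < v.
  by move=> /andP[t0 t1] /andP[uz zv]; rewrite /phi /c; apply/andP; split; nra.
have phi_cvg z : u <= z <= v -> forall e', 0 < e' ->
    \forall t \near 0^'+, `|g (phi t z) - g z| < e'.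
  move=> /andP[uz zv] e' e'0.
  have lim_phi d' : 0 < d' -> \forall t \near (0 : R)^'+, `|phi t z - z| < d'.
    move=> d'0; have l0 : 0 < v - u by lra.
    near=> t; have t0 : 0 < t by near: t; exact: nbhs_right_gt.
    have : t < d' / (v - u) by near: t; apply: nbhs_right_lt; exact: divr_gt0.
    rewrite ltr_pdivlMr// => ht; rewrite /phi addrAC subrr add0r normrM gtr0_norm//.
    apply: le_lt_trans ht; rewrite ler_pM2l// ler_norml /c; apply/andP; split; lra.
  have in01 : \forall t \near (0 : R)^'+, 0 < t < 1.
    near=> t; apply/andP; split; near: t; [exact: nbhs_right_gt|exact: nbhs_right_lt].
  move: uz; rewrite le_eqVlt => /orP[/eqP uz|uz].
    have [d' d'0 hd'] := (cvg_at_rightP_dist _ _ _).1 gu _ e'0.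
    near=> t; rewrite -uz; apply: hd'.
    have t01 : 0 < t < 1 by near: t.
    have uu : u <= u <= v by rewrite lexx ltW.
    have /andP[ut _] := phi_itv _ _ t01 uu; rewrite ut/=.
    have : `|phi t z - z| < d' by near: t; exact: lim_phi.
    by rewrite -uz ltr_norml => /andP[]; lra.
  move: zv; rewrite le_eqVlt => /orP[/eqP zv|zv].
    have [d' d'0 hd'] := (cvg_at_leftP_dist _ _ _).1 gv _ e'0.
    near=> t; rewrite zv; apply: hd'.
    have t01 : 0 < t < 1 by near: t.
    have vv : u <= v <= v by rewrite lexx ltW.
    have /andP[_ vt] := phi_itv _ _ t01 vv; rewrite vt andbT.
    have : `|phi t z - z| < d' by near: t; exact: lim_phi.
    by rewrite zv ltr_norml => /andP[]; lra.
  have [d' d'0 hd'] := ac_uniform acg e'0.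
  near=> t; have t01 : 0 < t < 1 by near: t.
  apply: hd'; rewrite /= ?in_itv/= ?uz ?zv//.
    by apply: phi_itv => //; rewrite !ltW.
  by near: t; exact: lim_phi.
have xyI i : u <= x i <= v /\ u <= y i <= v.
  by have [_] := Ixy i; rewrite /= !in_itv.
pose e' := e / 2 / (2 * n%:R + 1).
have n2 : 0 < 2 * n%:R + 1 :> R by rewrite ltr_wpDl// mulr_ge0.
have e'0 : 0 < e' by rewrite divr_gt0.
near (0 : R)^'+ => t.
have t01 : 0 < t < 1.
  by apply/andP; split; near: t; [exact: nbhs_right_gt|exact: nbhs_right_lt].
have /andP[t0 t1] := t01.
have hx : forall i, `|g (phi t (x i)) - g (x i)| < e'.
  by near: t; apply: filter_forall => i; apply: phi_cvg => //; have [] := xyI i.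
have hy : forall i, `|g (phi t (y i)) - g (y i)| < e'.
  by near: t; apply: filter_forall => i; apply: phi_cvg => //; have [] := xyI i.
have main : \sum_(i < n) `|g (phi t (y i)) - g (phi t (x i))| < e / 2.
  apply: (hd n (fun i => phi t (x i)) (fun i => phi t (y i))).
  - move=> i; have [xy _ _] := Ixy i; have [xi yi] := xyI i.
    split; rewrite /= ?in_itv/=; [|exact: phi_itv|exact: phi_itv].
    by rewrite -subr_ge0 phiD mulr_ge0 ?subr_ge0// ltW.
  - move=> i j _ _ [z [/=]]; rewrite !in_itv/= => /andP[z1 z2] /andP[z3 z4].
    have t1' : 0 < 1 - t by lra.
    apply: tI => //; exists ((z - t * c) / (1 - t)); rewrite /= !in_itv/=.
    by split; rewrite ltr_pdivlMr// ltr_pdivrMr//; move: z1 z2 z3 z4; rewrite /phi;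
      move=> *; apply/andP; split; lra.
  - apply: le_lt_trans s; apply: ler_sum => i _; rewrite phiD.
    by have [xy _ _] := Ixy i; rewrite ler_piMl ?subr_ge0//; lra.
apply: (@le_lt_trans _ _ (\sum_(i < n) (`|g (phi t (y i)) - g (phi t (x i))| + 2 * e'))).
  apply: ler_sum => i _; have := hx i; have := hy i => /ltW h1 /ltW h2.
  have -> : g (y i) - g (x i) = (g (phi t (y i)) - g (phi t (x i))) +
     (- (g (phi t (y i)) - g (y i)) + (g (phi t (x i)) - g (x i))) by ring.
  apply: le_trans (ler_normD _ _) _; rewrite lerD2l.
  by apply: le_trans (ler_normD _ _) _; rewrite normrN; lra.
rewrite big_split/= sumr_const card_ord -[X in _ + X < _]mulr_natr.
have eE : e / 2 = e' * (2 * n%:R + 1) by rewrite /e' mulfVK// gt_eqF.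
have : e = e / 2 + e' * (2 * n%:R + 1) by rewrite -eE; lra.
lra.
Unshelve. all: end_near. Qed.

End absolute_continuity.

Section piecewise_lift.
Context {R : realType} (f : R -> R) (k : nat) (b : nat -> R).
Hypothesis pac : piecewise_ac f k b.

Let F : R -> R := f \o frac.
Let Fr x := lim (F y @[y --> x^'+]).
Let Fl x := lim (F y @[y --> x^'-]).
Let rep x := b 0%N + frac (x - b 0%N).

(* [f] on the circle with its jumps removed; it gains [sum_of_jumps f k b] on
   each period. *)
Definition continuous_lift x : R :=
  Fr (rep x) + \sum_(i < k) jump f (b i) * (Num.floor (x - b i))%:~R.
Let G := continuous_lift.

Let k0 : (0 < k)%N. Proof. by case: pac. Qed.
Let bk : b k = b 0%N + 1. Proof. by case: pac. Qed.
Let b_lt j : (j < k)%N -> b j < b j.+1. Proof. by case: pac => _ _ + _; exact. Qed.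
Let acF j : (j < k)%N -> absolutely_continuous_on `]b j, b j.+1[%classic F.
Proof. by case: pac => _ _ _; exact. Qed.

Lemma breakpoints_le i j : (i <= j <= k)%N -> b i <= b j.
Proof.
elim: j => [|j IH] /andP[ij jk]; first by move: ij; rewrite leqn0 => /eqP ->.
move: ij; rewrite leq_eqVlt => /orP[/eqP ->//|ij].
by rewrite (le_trans (IH _)) ?ltW ?b_lt// -ltnS ij ltnW.
Qed.

Lemma breakpoint_locate x : b 0%N <= x < b 0%N + 1 ->
  exists2 j, (j < k)%N & b j <= x < b j.+1.
Proof.
move=> /andP[x0]; rewrite -bk.
elim: {-2}k (leqnn k) => [_|n IH nk xn]; first by rewrite ltNge x0.
have [xbn|bx] := ltP x (b n).
  by have [j jn jx] := IH (ltnW nk) xbn; exists j => //; exact: ltnW.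
by exists n => //; rewrite bx.
Qed.

Let FrE j x : (j < k)%N -> b j < x < b j.+1 -> Fr x = F x.
Proof.
move=> jk jx; apply: cvg_lim => //.
exact: cvg_at_right_filter (ac_itv_continuous (acF jk) jx).
Qed.

(** The jump part on the [j]-th arc of the base period, where [floor (x - b i)] is 0 for [i <= j]
    and -1 for [i > j]. *)
Let cst j : R := \sum_(i < k) jump f (b i) * (if (i <= j)%N then 0 else -1).

Let GE j x : (j < k)%N -> b j <= x < b j.+1 -> G x = Fr x + cst j.
Proof.
move=> jk /andP[jx xj].
have x0 : b 0%N <= x by rewrite (le_trans _ jx)// breakpoints_le//= ltnW.
have x1 : x < b 0%N + 1 by rewrite -bk (lt_le_trans xj)// breakpoints_le//= jk leqnn.
rewrite /G /continuous_lift /rep frac_id; last by apply/andP; split; lra.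
have -> : b 0%N + (x - b 0%N) = x by ring.
congr (_ + _); apply: eq_bigr => i _; congr (_ * _).
have ib : b 0%N <= b i by rewrite breakpoints_le//= ltnW.
have ib1 : b i < b 0%N + 1.
  by rewrite -bk (lt_le_trans (b_lt (ltn_ord i)))// breakpoints_le//= ltn_ord leqnn.
case: leqP => ij.
  have bij : b i <= b j by rewrite breakpoints_le// ij ltnW.
  by rewrite (_ : Num.floor _ = 0)//; apply: floor_def; rewrite add0r; apply/andP; split; lra.
have bij : b j.+1 <= b i by rewrite breakpoints_le// ij ltnW.
rewrite (_ : Num.floor _ = -1) ?mulrN1z//; apply: floor_def.
by rewrite mulrN1z addNr; apply/andP; split; lra.
Qed.

Lemma continuous_liftD1 x : G (x + 1) = G x + sum_of_jumps f k b.
Proof.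
rewrite /G /continuous_lift /rep addrAC fracD1 -addrA; congr (_ + _).
rewrite -big_split/=; apply: eq_bigr => i _.
by rewrite addrAC (floorDint _ 1) intrD mulrDr mulr1.
Qed.

Let F1 x : F (x + 1) = F x. Proof. by rewrite /F/= fracD1. Qed.

Let Fl_shift x : cvg (F y @[y --> (x + 1)^'-]) -> Fl x = Fl (x + 1).
Proof.
move=> cF; apply: cvg_lim => //; apply/cvg_at_leftP_dist => e e0.
have [d d0 hd] := (cvg_at_leftP_dist _ _ _).1 cF _ e0.
by exists d => // y /andP[y1 y2]; rewrite -F1; apply: hd; apply/andP; split; lra.
Qed.

Let cvg_Fl j : (j < k)%N -> cvg (F y @[y --> (b j.+1)^'-]).
Proof. by move=> jk; exact: ac_cvg_left (b_lt jk) (acF jk). Qed.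

(** Passing an inner breakpoint changes [cst] by the jump there, which compensates the difference of
    the one-sided limits. At the last breakpoint the gain over a period closes the circle. *)
Let G_breakpoint j : (j < k)%N -> G (b j.+1) = Fl (b j.+1) + cst j.
Proof.
move=> jk; have [jk1|] := ltnP j.+1 k.
  rewrite (GE jk1) ?lexx ?b_lt//.
  have -> : cst j.+1 = cst j + jump f (b j.+1).
    rewrite /cst (bigD1 (Ordinal jk1))//= [in RHS](bigD1 (Ordinal jk1))//=.
    rewrite leqnn ltnn mulr0 add0r mulrN1 addrAC addNr add0r; apply: eq_bigr => i ij.
    have ij' : (i != j.+1 :> nat) by apply: contraNneq ij => ij; apply/eqP/val_inj.
    by rewrite [(i <= j.+1)%N]leq_eqVlt (negbTE ij') ltnS.
  by rewrite /jump /Fr /Fl; ring.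
rewrite leq_eqVlt ltnNge jk orbF => /eqP jE.
have bj : b j.+1 = b 0%N + 1 by rewrite -bk jE.
rewrite bj.
rewrite [G (b 0%N + 1)]continuous_liftD1.
rewrite (GE k0) ?lexx ?b_lt// -Fl_shift; last by rewrite -bj; exact: cvg_Fl.
have -> : cst j = 0.
  by rewrite /cst big1// => i _; rewrite -ltnS -jE ltn_ord mulr0.
have : cst 0 + sum_of_jumps f k b = jump f (b 0%N).
  rewrite /cst /sum_of_jumps -big_split/= (bigD1 (Ordinal k0))//= mulr0 add0r.
  rewrite big1 ?addr0// => i i0; rewrite ifN; first by rewrite mulrN1 addNr.
  by rewrite -ltnNge lt0n; apply: contraNneq i0 => i0; apply/eqP/val_inj.
by rewrite /jump -/(Fl _) -/(Fr _) => h; rewrite -addrA h; ring.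
Qed.

Let G_open j x : (j < k)%N -> b j < x < b j.+1 -> G x = F x + cst j.
Proof.
move=> jk /[dup] jx /andP[/ltW jx1 jx2].
by rewrite (GE jk) ?jx1// (FrE jk).
Qed.

Let ac_piece j : (j < k)%N -> absolutely_continuous_on `[b j, b j.+1]%classic G.
Proof.
move=> jk; apply: ac_closure (b_lt jk) _ _ _.
- apply: (ac_eq _ (ac_addc (cst j) (acF jk))) => x.
  by rewrite inE/= in_itv/= => jx; rewrite (G_open jk).
- have /cvg_at_rightP_dist cF : cvg (F y @[y --> (b j)^'+]).
    exact: ac_cvg_right (b_lt jk) (acF jk).
  apply/cvg_at_rightP_dist => e e0; have [d d0 hd] := cF e e0.
  exists (Num.min d (b j.+1 - b j)); first by rewrite lt_min d0 subr_gt0 b_lt.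
  move=> y /andP[jy]; rewrite -ltrBlDl lt_min => /andP[y1 y2].
  rewrite (G_open jk); last by apply/andP; split; lra.
  rewrite (GE jk) ?lexx ?b_lt//.
  have -> : F y + cst j - (Fr (b j) + cst j) = F y - Fr (b j) by ring.
  by apply: hd; apply/andP; split; lra.
- have /cvg_at_leftP_dist cF := cvg_Fl jk.
  apply/cvg_at_leftP_dist => e e0; have [d d0 hd] := cF e e0.
  exists (Num.min d (b j.+1 - b j)); first by rewrite lt_min d0 subr_gt0 b_lt.
  move=> y /andP[]; rewrite ltrBlDr -ltrBlDl lt_min => /andP[y1 y2] jy.
  rewrite (G_open jk); last by apply/andP; split; lra.
  rewrite G_breakpoint//.
  have -> : F y + cst j - (Fl (b j.+1) + cst j) = F y - Fl (b j.+1) by ring.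
  by apply: hd; apply/andP; split; lra.
Qed.

Let ac_period : absolutely_continuous_on `[b 0%N, b 0%N + 1]%classic G.
Proof.
rewrite -bk; elim: {-2}k (leqnn k) k0 => // n IH nk _.
have [n0|n0] := posnP n; first by move: nk; rewrite n0; exact: ac_piece.
apply: ac_glue (IH (ltnW nk) n0) (ac_piece nk); last exact/ltW/b_lt.
by rewrite breakpoints_le//= ltnW.
Qed.

Lemma continuous_lift_ac :
  absolutely_continuous_on `[0, 1]%classic (fun x => G (x + b 0%N)).
Proof.
have := ac_shift (b 0%N) ac_period.
by rewrite subrr addrAC subrr add0r.
Qed.

(** Three consecutive periods are glued, so that every point is, after an integer translation,
    interior to an interval of absolute continuity. *)
Lemma continuous_lift_continuous : continuous G.
Proof.
have ac1 : absolutely_continuous_on `[b 0%N - 1, b 0%N]%classic G.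
  have := ac_shift 1 ac_period; rewrite addrK => /(ac_addc (- sum_of_jumps f k b)).
  by apply: ac_eq => x _; rewrite continuous_liftD1 addrK.
have ac2 : absolutely_continuous_on `[b 0%N + 1, b 0%N + 2]%classic G.
  have := ac_shift (-1) ac_period; rewrite !opprK -addrA => /(ac_addc (sum_of_jumps f k b)).
  by apply: ac_eq => x _; rewrite -continuous_liftD1 subrK.
have ac3 : absolutely_continuous_on `]b 0%N - 1, b 0%N + 2[%classic G.
  have : absolutely_continuous_on `[b 0%N - 1, b 0%N + 2]%classic G.
    by apply: ac_glue ac1 (ac_glue _ _ ac_period ac2); lra.
  move=> ac e /ac[d d0 hd]; exists d => // n u v Iuv; apply: hd => i.
  have [? ] := Iuv i; rewrite /= !in_itv/= => /andP[/ltW -> /ltW ->] /andP[/ltW -> /ltW ->].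
  by [].
move=> x; pose m := Num.floor (x - b 0%N).
have [m1 m2] := floor_itv_le (x - b 0%N); rewrite -/m in m1 m2.
have GN z (n : int) : G (z + n%:~R) = G z + n%:~R * sum_of_jumps f k b.
  pose H z := G z - z * sum_of_jumps f k b.
  have H1 y : H (y + 1) = H y by rewrite /H continuous_liftD1; ring.
  by have := period_int n z H1; rewrite /H; lra.
have GE' : G = fun z => G (z - m%:~R) + m%:~R * sum_of_jumps f k b.
  by apply/funext => z; rewrite -GN subrK.
suff : (fun z => G (z - m%:~R) + m%:~R * sum_of_jumps f k b) @ x -->
    G (x - m%:~R) + m%:~R * sum_of_jumps f k b by rewrite -GE' -GN subrK.
apply: cvgD; last exact: cvg_cst.
apply: (@cvg_comp _ _ _ (fun z => z - m%:~R) G _ (nbhs (x - m%:~R))).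
  by apply: cvgB; [exact: cvg_id|exact: cvg_cst].
by apply: ac_itv_continuous ac3 _; apply/andP; split; lra.
Qed.

Lemma continuous_liftE x : (forall j (m : int), (j < k)%N -> x != b j + m%:~R) ->
  f (frac x) =
  G x - \sum_(j < k) jump f (b j) * (Num.floor (x - b j))%:~R.
Proof.
move=> hx; rewrite /G /continuous_lift addrK.
have frx : frac (rep x) = frac x.
  by rewrite /rep addrC fracK subrK.
have rep_in : b 0%N <= rep x < b 0%N + 1.
  have /andP[? ?] := frac_itv (x - b 0%N).
  by rewrite /rep; apply/andP; split; lra.
have [j jk /andP[j1 j2]] := breakpoint_locate rep_in.
rewrite (FrE jk) /F/= ?frx// j2 andbT lt_neqAle j1 andbT.
have := hx j (Num.floor (x - b 0%N)) jk; apply: contraNneq => ->.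
by rewrite /rep /frac; apply/eqP; ring.
Qed.

End piecewise_lift.

(** * Birkhoff sums near a lattice *)

Lemma sum_bool_card (n : nat) (P : pred 'I_n) :
  (\sum_(i < n) P i)%N = #|[set i : 'I_n | P i]%SET|.
Proof.
rewrite -sum1_card big_mkcond/= [RHS]big_mkcond/=.
by apply: eq_bigr => i _; rewrite inE; case: (P i).
Qed.

Section birkhoff.
Context {R : realType} (a C : R) (k : nat) (b d : nat -> R) (F G : R -> R).
Let S := \sum_(j < k) d j.
Hypothesis badly : forall m l : int, (0 < m)%R ->
  1 <= C * m%:~R * `|m%:~R * a - l%:~R|.
Hypothesis GS : forall z, G (z + 1) = G z + S.
Hypothesis incrG : forall eta : R, 0 < eta ->
  exists n0 : nat, forall n x h, (n0 <= n)%N -> 0 <= h -> n%:R * h <= 1 ->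
  `|increments a G n x h - n%:R * h * S| <= eta.
Hypothesis FE : forall x, (forall j (m : int), (j < k)%N -> x != b j + m%:~R) ->
  F x = G x - \sum_(j < k) d j * (Num.floor (x - b j))%:~R.
Hypothesis S0 : S != 0.

(** Forward times suffice, since all windows of times lie in the future. *)
Definition regular (x : R) := forall (i : nat) (j : nat) (m : int), (j < k)%N ->
  x + i%:R * a != b j + m%:~R.

Definition birkhoff n (x : R) := \sum_(i < n) F (x + i%:R * a).

(** The number of times that the moving segment from [x] to [x + h] sweeps over the discontinuity
    [b j] during [n] steps. *)
Definition jump_count j n (x h : R) : int :=
  floor_sum a n (x + h - b j) - floor_sum a n (x - b j).

Lemma regularD x n : regular x -> regular (x + n%:R * a).
Proof. by move=> rx i j m jk; rewrite -addrA -mulrDl -natrD; exact: rx. Qed.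

Lemma birkhoffD n m x : birkhoff (n + m) x = birkhoff n x + birkhoff m (x + n%:R * a).
Proof.
rewrite /birkhoff big_split_ord/=; congr (_ + _); apply: eq_bigr => i _.
by rewrite natrD mulrDl addrA.
Qed.

(** It agrees with [birkhoff] at regular points and keeps the exact increment formula at every
    point, in particular at the cell ends used in [near_lattice_rare], which need not be regular. *)
Definition smooth_birkhoff n (x : R) := \sum_(i < n) G (x + i%:R * a) -
  \sum_(j < k) d j * (floor_sum a n (x - b j))%:~R.

Lemma birkhoffE n x : regular x -> birkhoff n x = smooth_birkhoff n x.
Proof.
move=> rx; rewrite /birkhoff /smooth_birkhoff.
rewrite (eq_bigr (fun i : 'I_n => G (x + i%:R * a) -
  \sum_(j < k) d j * (Num.floor (x + i%:R * a - b j))%:~R)); last first.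
  by move=> i _; apply: FE => j m; exact: rx.
rewrite sumrB exchange_big/=; congr (_ - _); apply: eq_bigr => j _.
rewrite /floor_sum intr_sum mulr_sumr; apply: eq_bigr => i _.
by congr (_ * (Num.floor _)%:~R); ring.
Qed.

Lemma smooth_birkhoff_diff n x h :
  smooth_birkhoff n (x + h) - smooth_birkhoff n x =
  increments a G n x h - \sum_(j < k) d j * (jump_count j n x h)%:~R.
Proof.
rewrite /smooth_birkhoff /increments sumrB.
have -> : \sum_(j < k) d j * (jump_count j n x h)%:~R =
    \sum_(j < k) d j * (floor_sum a n (x + h - b j))%:~R -
    \sum_(j < k) d j * (floor_sum a n (x - b j))%:~R.
  by rewrite -sumrB; apply: eq_bigr => j _; rewrite /jump_count intrB mulrBr.
by ring.
Qed.

Lemma smooth_birkhoffD1 n x : smooth_birkhoff n (x + 1) = smooth_birkhoff n x.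
Proof.
rewrite /smooth_birkhoff.
rewrite (eq_bigr (fun i : 'I_n => G (x + i%:R * a) + S)); last first.
  by move=> i _; rewrite addrAC GS.
rewrite [X in _ - X](eq_bigr (fun j : 'I_k =>
  d j * (floor_sum a n (x - b j))%:~R + d j * n%:R)); last first.
  move=> j _; rewrite -mulrDr; congr (_ * _).
  rewrite /floor_sum (eq_bigr (fun i : 'I_n => Num.floor (x - b j + i%:R * a) + 1)); last first.
    by move=> i _; rewrite -(floorDint _ 1); congr Num.floor; ring.
  by rewrite big_split/= sumr_const card_ord intrD natz -pmulrn.
by rewrite !big_split/= sumr_const card_ord -mulr_suml -/S -mulr_natr; ring.
Qed.

Lemma jump_count_ge0 j n x h : 0 <= h -> (0 <= jump_count j n x h)%R.
Proof. by move=> h0; rewrite subr_ge0 le_floor_sum// lerD2r lerDl. Qed.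

Lemma jump_count_le j n x h : 0 <= h < 1 ->
  (jump_count j n x h)%:~R <= 1 + C * n%:R * h.
Proof.
by move=> h01; rewrite /jump_count intrB addrAC; exact: floor_sum_gap.
Qed.

Lemma jump_countD j n m x h :
  jump_count j (n + m) x h = jump_count j n x h + jump_count j m (x + n%:R * a) h.
Proof.
rewrite /jump_count !floor_sumD.
have -> : x + h - b j + n%:R * a = x + n%:R * a + h - b j by ring.
have -> : x - b j + n%:R * a = x + n%:R * a - b j by ring.
lia.
Qed.

Lemma jump_count_homo j n m x h : 0 <= h -> (n <= m)%N ->
  (jump_count j n x h <= jump_count j m x h)%R.
Proof. by move=> h0 nm; rewrite -(subnKC nm) jump_countD lerDl jump_count_ge0. Qed.

Let C0 : 0 <= C. Proof. exact: badly_cst_ge0 badly. Qed.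
Let d1 := \sum_(j < k) `|d j|.

(* The points [m < l] where [f^(q) (T^m x)] is close to [gamma Z] are labelled by
   the cell of length [1 / q] that contains [T^m x], the numbers of
   discontinuities of [f^(q)] between the left end of the cell and [T^m x], and
   the nearby multiple of [gamma]; points with the same label lie within
   [O (e / q)] of one another, so that they are rare by bad approximability. *)
Lemma near_lattice_rare (gamma : R) : 0 < gamma -> exists2 C1 : R, 0 <= C1 &
  forall e, 0 < e <= 1 / 2 -> exists n0 : nat, forall q, (n0 <= q)%N ->
  exists C2 : R, forall x l, regular x ->
    #|[set m : 'I_l | `[< exists z : int,
        `|birkhoff q (x + m%:R * a) - gamma * z%:~R| < 2 * e >]]%SET|%:R <=
    C1 * e * l%:R + C2.
Proof.
move=> gamma0.
(* [K] bounds the change of the Birkhoff sum within a cell: at most [e + |S|] from [G], and at most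
   [1 + C] crossings of each jump. Hence [Z] bounds the offsets of the relevant multiples of
   [gamma], and [A * q] bounds the number of labels. *)
pose K : R := 1 + `|S| + d1 * (1 + C).
have d10 : 0 <= d1 by apply: sumr_ge0.
have K0 : 0 < K by rewrite /K -addrA ltr_wpDr// addr_ge0// mulr_ge0// addr_ge0.
pose Z : nat := (Num.truncn (2 * (K + 1) / gamma)).+2.
pose cm : nat := Num.truncn (1 + C).
pose A : nat := (2 * #|{ffun 'I_k -> 'I_cm.+1}| * Z.+1)%N.
have S0' : 0 < `|S| by rewrite normr_gt0.
exists (A%:R * (C * (6 / `|S|))).
  by rewrite mulr_ge0// mulr_ge0// divr_ge0.
move=> e /andP[e0 e12]; have [n0 hn0] := incrG e0.
exists (maxn n0 1) => q; rewrite geq_max => /andP[nq q0].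
have qR : 0 < q%:R :> R by rewrite ltr0n.
exists (A%:R * q%:R) => x l rx.
pose y (m : nat) := x + m%:R * a.
pose u (m : nat) := Num.floor (q%:R * frac (y m)).
pose y0 (m : nat) : R := (Num.floor (y m))%:~R + (u m)%:~R / q%:R.
pose h m := y m - y0 m.
have u_itv m : (0 <= u m < q)%R.
  have /andP[f0 f1] := frac_itv (y m); rewrite /u floor_ge0 mulr_ge0//=.
  by rewrite floor_lt_int -[ltRHS]pmulrn -[ltRHS]mulr1 ltr_pM2l.
have h_itv m : 0 <= h m /\ q%:R * h m <= 1.
  have [f1 f2] := floor_itv_le (q%:R * frac (y m)); rewrite -/(u m) in f1 f2.
  have e1 : q%:R * h m = q%:R * frac (y m) - (u m)%:~R.
    by rewrite /h /y0 /frac; field; rewrite gt_eqF.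
  rewrite e1; split; last by lra.
  by rewrite -(pmulr_rge0 _ qR) e1 subr_ge0.
have h_lt1 m : 0 <= h m < 1.
  have /andP[f0 f1] := frac_itv (y m); have [-> _] := h_itv m; apply: le_lt_trans f1.
  rewrite /h /y0 /frac opprD addrA lerBlDr lerDl divr_ge0// ler0z.
  by have /andP[] := u_itv m.
pose V m := smooth_birkhoff q ((u m)%:~R / q%:R).
have VE m : smooth_birkhoff q (y0 m) = V m.
  rewrite /V /y0 addrC -[(Num.floor _)%:~R]/(1 *~ _).
  by apply: period_int => z; exact: smooth_birkhoffD1.
have BE m : birkhoff q (y m) = V m + (increments a G q (y0 m) (h m) -
    \sum_(j < k) d j * (jump_count j q (y0 m) (h m))%:~R).
  rewrite birkhoffE; last exact: regularD.
  by rewrite -smooth_birkhoff_diff VE subrKC /h subrKC.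
have incr_q m : `|increments a G q (y0 m) (h m) - q%:R * h m * S| <= e.
  by have [h0 h1] := h_itv m; exact: hn0.
have cnt_le j m : (jump_count j q (y0 m) (h m))%:~R <= 1 + C.
  apply: le_trans (jump_count_le _ _ _ (h_lt1 m)) _; rewrite lerD2l -mulrA.
  by rewrite ler_piMr// (h_itv m).2.
have BK m : `|birkhoff q (y m) - V m| <= K.
  rewrite BE addrC addKr.
  apply: le_trans (ler_normB _ _) _; rewrite /K; apply: lerD.
    have -> : increments a G q (y0 m) (h m) = (increments a G q (y0 m) (h m) -
      q%:R * h m * S) + q%:R * h m * S by ring.
    apply: le_trans (ler_normD _ _) _; apply: lerD.
      by apply: le_trans (incr_q m) _; lra.
    have [h0 h1] := h_itv m.
    by rewrite normrM ler_piMl// ger0_norm// mulr_ge0.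
  apply: le_trans (ler_norm_sum _ _ _) _; rewrite mulr_suml; apply: ler_sum => j _.
  rewrite normrM ler_wpM2l// ger0_norm//.
  by rewrite ler0z jump_count_ge0// (h_itv m).1.
pose near m (z : int) := `|birkhoff q (y m) - gamma * z%:~R| < 2 * e.
pose z m : int := xget 0 [set z | near m z].
pose zb m := Num.floor ((V m - K - 1) / gamma).
have z_itv m : near m (z m) -> (0 <= z m - zb m <= Z)%R.
  rewrite /near; move: (z m) => zm; rewrite ltr_norml => /andP[n1 n2].
  have := BK m; rewrite ler_norml => /andP[k1 k2].
  have [f1 f2] := floor_itv_le ((V m - K - 1) / gamma); rewrite -/(zb m) in f1 f2.
  have v1 : (V m - K - 1) / gamma < zm%:~R by rewrite ltr_pdivrMr// mulrC; lra.
  have v2 : zm%:~R < (V m + K + 1) / gamma by rewrite ltr_pdivlMr// mulrC; lra.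
  rewrite subr_ge0 -ltzD1 -(ltr_int R) intrD (le_lt_trans f1) ?(lt_trans v1) ?ltrDl//=.
  rewrite -(ler_int R) intrB -[leRHS]pmulrn /Z.
  apply: (@le_trans _ _ (2 * (K + 1) / gamma + 1)); last first.
    by rewrite -[leRHS]natr1 lerD2r; apply: ltW; exact: truncnS_gt.
  have -> : 2 * (K + 1) / gamma = (V m + K + 1) / gamma - (V m - K - 1) / gamma.
    by rewrite -mulrBl; congr (_ / _); ring.
  lra.
pose lab (m : 'I_l) := (inord `|u m|%N : 'I_q.+1,
  [ffun j : 'I_k => inord `|jump_count j q (y0 m) (h m)|%N : 'I_cm.+1],
  inord `|z m - zb m|%N : 'I_Z.+1).
set E := [set m : 'I_l | _]%SET.
have nearE m : m \in E -> near m (z m).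
  by rewrite inE => /asboolP[w nw]; rewrite /z; case: xgetP => [w' _ //|/(_ w)].
(* For equal labels the Birkhoff sums differ by [q S (h j - h i)] up to [2 e], and they lie within
   [2 e] of the same multiple of [gamma]; hence the [6 e]. Bad approximability turns this closeness
   into a time gap of at least [g / C]. *)
pose g : R := q%:R * `|S| / (6 * e).
have g0 : 0 < g by rewrite divr_gt0// ?mulr_gt0//; lra.
have fiber t : #|[set m in E | lab m == t]%SET|%:R <= C * (6 / `|S|) * e / q%:R * l%:R + 1.
  have := C0; rewrite le_eqVlt => /orP[/eqP C00|C00].
    by have := @badly 1 0 isT; rewrite -C00 !mul0r ler10.
  have Cg : 0 < C^-1 * g by rewrite mulr_gt0// invr_gt0.
  pose P (m : nat) :=
    [exists m' : 'I_l, (m' == m :> nat) && (m' \in [set m in E | lab m == t]%SET)].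
  have PE (m : 'I_l) : P m = (m \in [set m in E | lab m == t]%SET).
    apply/existsP/idP => [[m' /andP[/eqP/val_inj ->]]//|mt].
    by exists m; rewrite eqxx.
  have := @sparse_count R P (C^-1 * g) l (ltW Cg).
  have -> : (\sum_(i < l) P i)%N = #|[set m in E | lab m == t]%SET|.
    by rewrite sum_bool_card; apply: eq_card => m; rewrite inE PE.
  move=> H; have {H} : #|[set m in E | lab m == t]%SET|%:R * (C^-1 * g) <= l%:R + C^-1 * g.
    apply: H => i j /andP[ij jl].
    rewrite (PE (Ordinal (ltn_trans ij jl))) (PE (Ordinal jl)) inE => /andP[/nearE ni /eqP <-].
    rewrite inE => /andP[/nearE nj /eqP]; rewrite /lab /= => -[].
    have uq (m : nat) : (`|u m| < q.+1)%N by move: (u m) (u_itv m) => w; clear -q; lia.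
    move/(congr1 val); rewrite /= !inordK// => uij.
    have {uij} uE : u i = u j.
      by move: uij (u_itv i) (u_itv j); move: (u i) (u j) => w w'; clear; lia.
    move=> /ffunP cE.
    have {}cE (j' : 'I_k) : jump_count j' q (y0 i) (h i) = jump_count j' q (y0 j) (h j).
      have := cE j'; rewrite !ffunE => /(congr1 val).
      have cl (m : nat) : (`|jump_count j' q (y0 m) (h m)| < cm.+1)%N.
        rewrite ltnS /cm truncn_ge_nat; last by rewrite addr_ge0.
        rewrite pmulrn gez0_abs; first exact: cnt_le.
        by rewrite jump_count_ge0// (h_itv m).1.
      rewrite /= !inordK//.
      move: (jump_count_ge0 j' q (y0 i) (h_itv i).1) (jump_count_ge0 j' q (y0 j) (h_itv j).1).
      by move: (jump_count _ _ _ _) (jump_count _ _ _ _) => w w'; clear; lia.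
    have zl (m : nat) : near m (z m) -> (`|z m - zb m| < Z.+1)%N.
      by move/z_itv; move: (z m - zb m)%R => w; clear; lia.
    move/(congr1 val); rewrite /= !inordK ?zl//.
    have VEij : V i = V j by rewrite /V uE.
    have zbE : zb i = zb j by rewrite /zb VEij.
    have := z_itv _ ni; have := z_itv _ nj; rewrite zbE => zj zi zij.
    have {zj zi zij} zE : z i = z j.
      by move: zi zj zij; move: (z i) (z j) (zb j) => w w' w''; clear; lia.
    have hij : q%:R * `|S| * `|h j - h i| <= 6 * e.
      rewrite -{1}[q%:R]gtr0_norm// -!normrM.
      have : q%:R * S * (h j - h i) = - (increments a G q (y0 j) (h j) - q%:R * h j * S) +
         (increments a G q (y0 i) (h i) - q%:R * h i * S) +
         ((birkhoff q (y j) - gamma * (z j)%:~R) - (birkhoff q (y i) - gamma * (z i)%:~R)).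
        rewrite !BE VEij zE [X in _ = _ + (_ + (_ - X) - _ - _)](eq_bigr
          (fun j' : 'I_k => d j' * (jump_count j' q (y0 i) (h i))%:~R)).
          by ring.
        by move=> j' _; rewrite cE.
      move=> ->; move: (incr_q i) (incr_q j) ni nj; rewrite /near !ler_norml !ltr_norml.
      move=> /andP[? ?] /andP[? ?] /andP[? ?] /andP[? ?].
      by apply/andP; split; lra.
    have jiR : j%:R - i%:R = (j%:Z - i%:Z)%:~R :> R by rewrite intrB -!pmulrn.
    rewrite ler_pdivrMl// jiR.
    have ji0 : (0 < j%:Z - i%:Z)%R by rewrite subr_gt0 ltz_nat.
    have := badly (Num.floor (y j) - Num.floor (y i)) ji0.
    have -> : (j%:Z - i%:Z)%:~R * a - (Num.floor (y j) - Num.floor (y i))%:~R = h j - h i.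
      by rewrite -jiR /h /y0 uE intrB /y; ring.
    move=> bad1; rewrite /g ler_pdivrMr; last lra.
    rewrite -[leLHS]mulr1.
    apply: (@le_trans _ _ (q%:R * `|S| * (C * (j%:Z - i%:Z)%:~R * `|h j - h i|))).
      by rewrite ler_pM2l// mulr_gt0.
    have -> : q%:R * `|S| * (C * (j%:Z - i%:Z)%:~R * `|h j - h i|) =
      C * (j%:Z - i%:Z)%:~R * (q%:R * `|S| * `|h j - h i|) by ring.
    by rewrite ler_wpM2l// mulr_ge0// ler0z ltW.
  rewrite -(ler_pM2r (_ : 0 < (C^-1 * g)^-1)) ?invr_gt0//.
  rewrite mulfK ?gt_eqF// mulrDl mulfV ?gt_eqF// => /le_trans; apply.
  rewrite lerD2r le_eqVlt; apply/orP; left; apply/eqP; rewrite /g.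
  by field; rewrite !gt_eqF//; lra.
rewrite -sum1_card (partition_big lab xpredT)//=.
have -> : \sum_t \sum_(i in E | lab i == t) 1%N = \sum_t #|[set m in E | lab m == t]%SET|.
  by apply: eq_bigr => t _; rewrite -sum1_card; apply: eq_bigl => m; rewrite inE.
rewrite natr_sum.
apply: (@le_trans _ _ (\sum_(t : 'I_q.+1 * {ffun 'I_k -> 'I_cm.+1} * 'I_Z.+1)
   (C * (6 / `|S|) * e / q%:R * l%:R + 1))).
  by apply: ler_sum => t _; exact: fiber.
rewrite sumr_const -[leLHS]mulr_natr !card_prod !card_ord.
have cq : (q.+1 * #|{ffun 'I_k -> 'I_cm.+1}| * Z.+1)%:R <= A%:R * q%:R :> R.
  rewrite -natrM ler_nat /A; set c := #|_|.
  have -> : (2 * c * Z.+1 * q = 2 * q * c * Z.+1)%N by ring.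
  have q2 : (q.+1 <= 2 * q)%N by rewrite mul2n -addnn -addn1 leq_add2l.
  by rewrite !leq_mul2r q2 !orbT.
apply: (@le_trans _ _ ((C * (6 / `|S|) * e / q%:R * l%:R + 1) * (A%:R * q%:R))).
  by rewrite ler_wpM2l// addr_ge0// !mulr_ge0 ?invr_ge0// ltW.
rewrite le_eqVlt; apply/orP; left; apply/eqP.
by field; rewrite !gt_eqF.
Qed.


(** The order of choices matters: [r] depends on [eps] only, then [e] makes [r C1 e] small, which is
    possible because [C1] does not depend on [q], and then comes [Q]. Indices that recur after [t Q]
    with [0 < t < r] are rare, since subtracting two near-lattice sums leaves an error below [2 e];
    those that do not recur have [r] disjoint translates. *)
Lemma near_lattice_density (gamma eps : R) : 0 < gamma -> 0 < eps ->
  exists2 e : R, 0 < e & exists L0 : nat, forall x tau l, regular x -> (L0 <= l)%N ->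
    #|[set m : 'I_l | `[< exists z : int,
        `|tau + birkhoff m x - gamma * z%:~R| < e >]]%SET|%:R <= eps * l%:R.
Proof.
move=> gamma0 eps0; have [C1 C10 hC1] := near_lattice_rare gamma0.
pose r : nat := (Num.truncn (4 / eps)).+1.
have r0 : 0 < r%:R :> R by rewrite ltr0n.
have r4 : 4 < eps * r%:R by rewrite mulrC -ltr_pdivrMr// truncnS_gt.
have rC0 : 0 < r%:R * C1 + 1 by rewrite ltr_wpDl// mulr_ge0// ltW.
pose e := Num.min (1 / 2) (eps / (4 * (r%:R * C1 + 1))).
have e0 : 0 < e by rewrite lt_min divr_gt0//= divr_gt0// mulr_gt0.
have e12 : 0 < e <= 1 / 2 by rewrite e0 ge_min lexx.
have rCe : r%:R * (C1 * e) <= eps / 4.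
  have : e <= eps / (4 * (r%:R * C1 + 1)) by rewrite ge_min lexx orbT.
  rewrite ler_pdivlMr ?mulr_gt0// => h.
  have : 0 <= e by exact: ltW.
  have : 0 <= r%:R * C1 by rewrite mulr_ge0// ltW.
  nra.
have [n0 hn0] := hC1 e e12.
pose Q := maxn n0 1.
have /choice[C2 hC2] : forall t : nat, exists C2 : R, (0 < t)%N -> forall x l, regular x ->
    #|[set m : 'I_l | `[< exists z : int,
        `|birkhoff (t * Q) (x + m%:R * a) - gamma * z%:~R| < 2 * e >]]%SET|%:R <=
    C1 * e * l%:R + C2.
  move=> t; have [t0|t0] := posnP t; first by exists 0; rewrite t0.
  have [|C2 h] := hn0 (t * Q)%N; last by exists C2.
  by rewrite (leq_trans (leq_maxl n0 1))// leq_pmull.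
pose C2s := \sum_(t < r | (0 < t)%N) `|C2 t|.
exists e => //; exists (Num.truncn (2 * (Q%:R + C2s) / eps)).+1 => x tau l rx Ll.
have lL : 2 * (Q%:R + C2s) <= eps * l%:R.
  rewrite mulrC [leRHS]mulrC -ler_pdivrMr// [_ * 2]mulrC ltW//.
  by apply: lt_le_trans (truncnS_gt _) _; rewrite ler_nat.
pose near (m : nat) := `[< exists z : int, `|tau + birkhoff m x - gamma * z%:~R| < e >].
pose E t : {set 'I_l} := [set m : 'I_l | `[< exists z : int,
   `|birkhoff (t * Q) (x + m%:R * a) - gamma * z%:~R| < 2 * e >]]%SET.
pose recur (m : nat) := [exists t : 'I_r, (0 < t)%N && near (m + t * Q)%N].
set Gs := [set m : 'I_l | _]%SET.
pose G1 := [set m in Gs | recur m]%SET; pose G2 := [set m in Gs | ~~ recur m]%SET.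
have cardG : #|Gs| = (#|G1| + #|G2|)%N.
  rewrite -(cardsID [set m : 'I_l | recur m]%SET Gs); congr (_ + _)%N.
    by apply: eq_card => m; rewrite !inE.
  by apply: eq_card => m; rewrite !inE andbC.
have GE (m : 'I_l) : (m \in Gs) = near m by rewrite inE.
have card1 : #|G1|%:R <= r%:R * (C1 * e) * l%:R + C2s.
  have sub : G1 \subset \bigcup_(t < r | (0 < t)%N) E t.
    apply/fintype.subsetP => m; rewrite inE GE.
    move=> /andP[/asboolP[z nz] /existsP[t /andP[t0 /asboolP[w nw]]]].
    apply/bigcupP; exists t => //; rewrite inE; apply/asboolP; exists (w - z).
    move: nw; rewrite birkhoffD; set B := birkhoff _ (_ + _) => nw.
    rewrite intrB; move: nz nw; rewrite !ltr_norml => /andP[? ?] /andP[? ?].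
    by apply/andP; split; lra.
  apply: (@le_trans _ _ (\sum_(t < r | (0 < t)%N) #|E t|)%:R).
    rewrite ler_nat (leq_trans (subset_leq_card sub))//.
    elim/big_rec2 : _ => [|t n A _ IH]; first by rewrite cards0.
    by rewrite (leq_trans (leq_card_setU _ _))// leq_add2l.
  rewrite natr_sum; apply: (@le_trans _ _ (\sum_(t < r | (0 < t)%N) (C1 * e * l%:R + `|C2 t|))).
    apply: ler_sum => t t0; apply: le_trans (hC2 t t0 x l rx) _.
    by rewrite lerD2l ler_norm.
  rewrite big_split/= lerD2r big_mkcond/=.
  apply: (@le_trans _ _ (\sum_(t < r) C1 * e * l%:R)).
    apply: ler_sum => t _; case: ifP => // _.
    by rewrite mulr_ge0// mulr_ge0// ltW.
  by rewrite sumr_const card_ord -[leLHS]mulr_natr le_eqVlt; apply/orP; left; apply/eqP; ring.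
have card2 : (#|G2| * r <= l + r * Q)%N.
  have lt_mt (u : 'I_l * 'I_r) : (u.1 + u.2 * Q < l + r * Q)%N.
    by rewrite -addSn leq_add// leq_mul2r ltnW// orbT.
  pose phi u := Ordinal (lt_mt u).
  have noret (m m' : 'I_l) (t t' : 'I_r) : m \in G2 -> m' \in G2 ->
      (m + t * Q = m' + t' * Q)%N -> ~~ (t < t')%N.
    rewrite !inE -/(near m) -/(near m') => /andP[nm _] /andP[_ rm'] e1; apply: contra rm' => tt'.
    apply/existsP; have lr : (t' - t < r)%N by rewrite (leq_ltn_trans (leq_subr _ _)).
    exists (Ordinal lr); rewrite /= subn_gt0 tt'/=.
    suff -> : (m' + (t' - t) * Q)%N = m by [].
    rewrite mulnBl addnBA; last by rewrite leq_mul2r ltnW// orbT.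
    by rewrite -e1 addnK.
  have inj : {in finset.setX G2 [set: 'I_r]%SET &, injective phi}.
    move=> [m t] [m' t']; rewrite !inE /= => /andP[mG _] /andP[m'G _] /(congr1 val) /= e1.
    have mG' : m \in G2 by rewrite !inE.
    have m'G' : m' \in G2 by rewrite !inE.
    have t1 := noret _ _ _ _ mG' m'G' e1; have t2 := noret _ _ _ _ m'G' mG' (esym e1).
    have tE : t = t' by apply/val_inj/eqP; rewrite eqn_leq leqNgt t2 leqNgt t1.
    by move: e1; rewrite tE => /addIn /val_inj ->.
  have := card_in_imset inj; rewrite cardsX cardsT card_ord => <-.
  by rewrite (leq_trans (max_card _))// card_ord.
have {}card2 : #|G2|%:R <= eps / 4 * l%:R + Q%:R.
  have : (#|G2| * r)%:R <= (l + r * Q)%:R :> R by rewrite ler_nat.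
  rewrite natrM natrD natrM => h; rewrite -(ler_pM2r r0) mulrDl.
  apply: le_trans h _; rewrite [Q%:R * _]mulrC lerD2r.
  have -> : eps / 4 * l%:R * r%:R = l%:R * (eps * r%:R / 4) by ring.
  by rewrite ler_peMr//; lra.
rewrite cardG natrD.
have : r%:R * (C1 * e) * l%:R <= eps / 4 * l%:R by rewrite ler_wpM2r.
lra.
Qed.

(* The drift [n h S] is near [sg S * p] on a window of length of order [1 / h];
   each jump count increases at most once there, so that all of them are constant
   on one of [k.+1] blocks. *)
Lemma constant_window (p eps : R) : 0 < p < `|S| -> 0 < eps ->
  exists2 kappa : R, 0 < kappa & forall N : nat, exists2 delta : R, 0 < delta &
  forall x h, regular x -> regular (x + h) -> 0 < h < delta ->
  exists (n1 n2 : nat) (c : nat -> int),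
  [/\ (N <= n1)%N, (n1 + N <= n2)%N, kappa * n2%:R <= n2%:R - n1%:R,
      forall j, (0 <= c j)%R /\ (c j)%:~R <= 1 + C &
      forall m, (n1 <= m <= n2)%N ->
        `|birkhoff m (x + h) - birkhoff m x -
          (Num.sg S * p - \sum_(j < k) d j * (c j)%:~R)| <= eps].
Proof.
move=> /andP[p0 pS] eps0; have S0' : 0 < `|S| by rewrite normr_gt0.
have pS1 : p / `|S| < 1 by rewrite ltr_pdivrMr// mul1r.
(* The window has length about [rho / h]. The three bounds keep [n h <= 1], keep the drift within
   [eps / 2] of [sg S * p], and keep the growth of each count over the window at most
   [1 + C rho < 2]. *)
pose rho := Num.min ((1 - p / `|S|) / 2) (Num.min (eps / (4 * `|S|)) (1 / (2 * (C + 1)))).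
have C1 : 0 < C + 1 by rewrite ltr_wpDl.
have rho0 : 0 < rho.
  rewrite !lt_min; apply/and3P; split; [lra|rewrite divr_gt0// mulr_gt0//|].
  by rewrite divr_gt0// mulr_gt0.
have rho1 : p / `|S| + 2 * rho <= 1.
  have : rho <= (1 - p / `|S|) / 2 by rewrite ge_min lexx.
  lra.
have rho2 : rho * `|S| <= eps / 4.
  have : rho <= eps / (4 * `|S|) by rewrite !ge_min lexx orbT.
  rewrite ler_pdivlMr ?mulr_gt0//; lra.
have rho3 : C * rho < 1.
  have : rho <= 1 / (2 * (C + 1)) by rewrite !ge_min lexx !orbT.
  rewrite ler_pdivlMr ?mulr_gt0//; have := C0; nra.
have k1 : 0 < k.+1%:R :> R by rewrite ltr0n.
exists (rho / (2 * k.+1%:R)); first by rewrite divr_gt0// mulr_gt0.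
move=> N; have e4 : 0 < eps / 4 by lra.
have [n0 hn0] := incrG e4.
(* [del1] pushes the start of the window beyond [n0] and [N]; [del2] makes each of the [k.+1] blocks
   longer than [N]. *)
pose del1 := Num.min rho (p / `|S| / (maxn n0 N).+1%:R).
pose del2 := rho / (k.+1%:R * (4 * N.+1%:R)).
exists (Num.min del1 del2).
  rewrite lt_min /del1 lt_min rho0/=; apply/andP; split.
    by rewrite !divr_gt0// ltr0n.
  by rewrite divr_gt0// mulr_gt0// mulr_gt0.
move=> x h rx rxh; rewrite lt_min /del1 lt_min => /andP[h0 /andP[/andP[hrho hN] hk]].
rewrite ltr_pdivlMr ?ltr0n// in hN.
rewrite /del2 ltr_pdivlMr ?mulr_gt0 ?ltr0n// in hk.
pose na := (Num.truncn (p / (`|S| * h))).+1.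
have Sh : 0 < `|S| * h by rewrite mulr_gt0.
have na1 : p < na%:R * (`|S| * h) by rewrite -ltr_pdivrMr// truncnS_gt.
have na2 : na%:R * (`|S| * h) <= p + `|S| * h.
  rewrite -[na%:R]natr1 mulrDl mul1r lerD2r -ler_pdivlMr// truncn_le.
  by rewrite divr_ge0// ltW.
pose L := Num.truncn (rho / h).
have L1 : L%:R * h <= rho by rewrite -ler_pdivlMr// truncn_le divr_ge0// ltW.
have L2 : rho < (L%:R + 1) * h by rewrite natr1 -ltr_pdivrMr// truncnS_gt.
pose L' := (L %/ k.+1)%N.
have LE : (L < L'.+1 * k.+1)%N by rewrite /L' ltn_ceil.
have L'L : (k.+1 * L' <= L)%N by rewrite mulnC leq_divM.
have L'1 : rho < (L'%:R + 1) * k.+1%:R * h.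
  apply: lt_le_trans L2 _; rewrite ler_pM2r// natr1 natr1 -natrM ler_nat.
  exact: LE.
have NL' : 2 * N.+1%:R <= L'%:R :> R.
  have h1 : 4 * N.+1%:R < L'%:R + 1 :> R.
    have kh : 0 < k.+1%:R * h by rewrite mulr_gt0.
    rewrite -(ltr_pM2r kh) [ltRHS]mulrA; apply: lt_trans L'1; lra.
  have : 1 <= N.+1%:R :> R by rewrite ler1n.
  lra.
have nah : na%:R * h <= p / `|S| + h.
  rewrite -(ler_pM2l S0') mulrDr mulrCA mulrC -mulrA [h * _]mulrC.
  by rewrite mulrCA [X in _ <= X + _]mulrC mulfVK ?gt_eqF.
have big_na : (maxn n0 N < na)%N.
  rewrite -(ltr_nat R); apply: (@lt_trans _ _ (p / (`|S| * h))); last exact: truncnS_gt.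
  rewrite ltr_pdivlMr// mulrA [_ * `|S|]mulrC -mulrA -ltr_pdivlMl// [_^-1 * _]mulrC.
  apply: le_lt_trans hN; rewrite mulrC ler_pM2l// ler_nat//.
(* Otherwise each of the [k.+1] blocks sees one of the [k] counts grow; two blocks share a count,
   which then grows by at least 2 over the window. *)
have [i hi] : exists i : 'I_k.+1, forall j : 'I_k,
    jump_count j (na + i.+1 * L') x h = jump_count j (na + i * L') x h.
  apply: contrapT => none.
  have {}none (i : 'I_k.+1) : exists j : 'I_k,
      (jump_count j (na + i * L') x h < jump_count j (na + i.+1 * L') x h)%R.
    apply: contrapT => hj; apply: none; exists i => j; apply/eqP.
    have ii : (na + i * L' <= na + i.+1 * L')%N by rewrite leq_add2l leq_mul2r leqnSn orbT.
    rewrite eq_le (jump_count_homo j x (ltW h0) ii).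
    by rewrite andbT leNgt; apply/negP => lt; apply: hj; exists j.
  have [J hJ] := choice none.
  have : ~~ injectiveb J.
    apply/negP => /injectiveP /leq_card; rewrite !card_ord ltnn//.
  move=> /injectivePn[i0 [i1 i01 JE]].
  have [i [i' [ii' {}JE]]] : exists i i' : 'I_k.+1, (i < i')%N /\ J i = J i'.
    have [?|?|e] := ltngtP i0 i1; [by exists i0, i1|by exists i1, i0|].
    by case/eqP: i01; exact: val_inj.
  have h1 := hJ i; have h2 := hJ i'; rewrite -JE in h2.
  have mono (s t : nat) : (s <= t)%N ->
      (jump_count (J i) (na + s * L') x h <= jump_count (J i) (na + t * L') x h)%R.
    by move=> st; apply: jump_count_homo; [exact: ltW|rewrite leq_add2l leq_mul2r st orbT].
  have h3 := mono _ _ ii'; have h4 := mono 0 i (leq0n _); have h5 := mono _ _ (ltn_ord i').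
  have : (jump_count (J i) (na + 0 * L') x h + 2 <= jump_count (J i) (na + k.+1 * L') x h)%R.
    move: h1 h2 h3 h4 h5 => /=.
    move: (jump_count _ (na + 0 * L') _ _) (jump_count _ (na + i * L') _ _)
      (jump_count _ (na + i.+1 * L') _ _) (jump_count _ (na + i' * L') _ _)
      (jump_count _ (na + i'.+1 * L') _ _) (jump_count _ (na + k.+1 * L') _ _).
    by clear; lia.
  rewrite mul0n addn0 jump_countD lerD2l -(ler_int R) leNgt => /negP; apply.
  have h01 : 0 <= h < 1 by rewrite ltW//=; have := divr_gt0 p0 S0'; lra.
  apply: le_lt_trans (jump_count_le _ _ _ h01) _.
  have : C * (k.+1 * L')%:R * h <= C * rho.
    rewrite -mulrA ler_wpM2l//; apply: le_trans L1; rewrite ler_pM2r// ler_nat//.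
  rewrite -[2%R%:~R]/(2%:R : R); lra.
exists (na + i * L')%N, (na + i.+1 * L')%N, (fun j => jump_count j (na + i * L') x h).
set n1 := (na + i * L')%N; set n2 := (na + i.+1 * L')%N.
have n12 : n2 = (n1 + L')%N by rewrite /n2 mulSn addnCA addnC.
have n2_le : n2%:R <= na%:R + L%:R :> R.
  rewrite -natrD ler_nat leq_add2l (leq_trans _ L'L)// leq_mul2r ltn_ord orbT//.
have n2h : n2%:R * h <= 1.
  have : n2%:R * h <= (na%:R + L%:R) * h by rewrite ler_pM2r.
  rewrite mulrDl; lra.
have C_1 (j m : nat) : (m <= n2)%N -> (jump_count j m x h)%:~R <= 1 + C.
  move=> mn2; have h01 : 0 <= h < 1 by rewrite ltW//=; have := divr_gt0 p0 S0'; lra.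
  apply: le_trans (jump_count_le _ _ _ h01) _; rewrite lerD2l -mulrA ler_piMr//.
  by apply: le_trans n2h; rewrite ler_pM2r// ler_nat.
split.
- by rewrite (leq_trans (leq_maxr n0 N))// (leq_trans (ltnW big_na))// leq_addr.
- rewrite n12 leq_add2l -(ler_nat R); have := ler0n R N.
  rewrite -(natr1 N) in NL'; lra.
- rewrite [in leRHS]n12 natrD addrAC subrr add0r -(ler_pM2r h0) -mulrA.
  apply: (@le_trans _ _ (rho / (2 * k.+1%:R))).
    by rewrite ler_piMr// divr_ge0 ?ltW// mulr_gt0.
  rewrite ler_pdivrMr ?mulr_gt0//.
  have L'2 : L'%:R + 1 <= 2 * L'%:R :> R.
    have : 1 <= N.+1%:R :> R by rewrite ler1n.
    lra.
  apply/ltW/(lt_le_trans L'1).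
  have -> : L'%:R * h * (2 * k.+1%:R) = (2 * L'%:R) * (k.+1%:R * h) by ring.
  by rewrite -mulrA ler_pM2r// mulr_gt0.
- move=> j; split; first by apply: jump_count_ge0; exact: ltW.
  by apply: C_1; rewrite n12 leq_addr.
- move=> m /andP[n1m mn2].
  have cm (j : 'I_k) : jump_count j m x h = jump_count j n1 x h.
    apply/eqP; rewrite eq_le (jump_count_homo j x (ltW h0) n1m) andbT.
    by rewrite -/n1 -/n2 in hi; rewrite -(hi j) jump_count_homo// ltW.
  rewrite !birkhoffE// smooth_birkhoff_diff.
  rewrite (eq_bigr (fun j : 'I_k => d j * (jump_count j n1 x h)%:~R)); last first.
    by move=> j _; rewrite cm.
  have na_m : (na <= m)%N by rewrite (leq_trans _ n1m)// leq_addr.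
  have mh : m%:R * h <= 1 by apply: le_trans n2h; rewrite ler_pM2r// ler_nat.
  have n0m : (n0 <= m)%N by rewrite (leq_trans (leq_maxl n0 N))// (leq_trans (ltnW big_na)).
  have := hn0 m x h n0m (ltW h0) mh.
  have mS : `|m%:R * h * S - Num.sg S * p| <= eps / 2.
    have -> : m%:R * h * S - Num.sg S * p = Num.sg S * (m%:R * h * `|S| - p).
      by rewrite {1}[S]numEsg; ring.
    rewrite normrM normr_sg S0 mul1r.
    have m_ge : na%:R * (`|S| * h) <= m%:R * (`|S| * h) by rewrite ler_pM2r// ler_nat.
    have m_le : m%:R * (`|S| * h) <= (na%:R + L%:R) * (`|S| * h).
      by rewrite ler_pM2r//; apply: le_trans n2_le; rewrite ler_nat.
    have LS : L%:R * h * `|S| <= rho * `|S| by rewrite ler_pM2r.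
    have hS : h * `|S| <= rho * `|S| by rewrite ler_pM2r// ltW.
    by rewrite ler_norml; apply/andP; split; nra.
  rewrite !ler_norml in mS *; move: mS => /andP[? ?] /andP[? ?].
  by apply/andP; split; lra.
Qed.

End birkhoff.

(** * The special flow *)

Section flow_algebra.
Context {R : realType} (a : R) (f : roof R).
Notation bs := (birkhoff_sum a f).
Notation rot := (rotation a).
Implicit Types (x s t : R) (m n : int).

Lemma rotation_itv m x : 0 <= rot m x < 1.
Proof. exact: frac_itv. Qed.

Lemma rotation0 x : 0 <= x < 1 -> rot 0 x = x.
Proof. by move=> x01; rewrite /rotation mul0r addr0 frac_id. Qed.

Lemma rotationD m n x : rot m (rot n x) = rot (n + m) x.
Proof. by rewrite /rotation fracK intrD mulrDl addrA. Qed.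

Lemma birkhoff_sum0 x : bs 0 x = 0.
Proof. by rewrite /= big_ord0. Qed.

Lemma birkhoff_sumD1 m x : bs (m + 1) x = bs m x + f (rot m x).
Proof.
case: m => n; first by rewrite -PoszD addn1 /= big_ord_recr.
rewrite NegzE; case: n => [|n].
  by rewrite addNr birkhoff_sum0 -[- 1%Z]/(Negz 0) /= big_ord1 addNr.
have -> : - (n.+2)%:Z + 1 = Negz n by rewrite NegzE; lia.
rewrite -NegzE /= [in RHS]big_ord_recr/=.
by rewrite opprD -addrA NegzE addNr addr0.
Qed.

Lemma birkhoff_sumDn m (n : nat) x : bs (m + n) x = bs m x + bs n (rot m x).
Proof.
elim: n => [|n IH]; first by rewrite birkhoff_sum0 !addr0.
rewrite -addn1 PoszD addrA !birkhoff_sumD1 IH -addrA; congr (_ + (_ + f _)).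
by rewrite rotationD.
Qed.

Lemma birkhoff_sumD m n x : bs (m + n) x = bs m x + bs n (rot m x).
Proof.
case: n => n; first exact: birkhoff_sumDn.
rewrite NegzE; set N := n.+1; have := birkhoff_sumDn (m - N%:Z) N x.
have := birkhoff_sumDn (- N%:Z) N (rot m x).
rewrite subrK addNr birkhoff_sum0 rotationD.
lra.
Qed.

Lemma birkhoff_sum_lt m n x : (m < n)%R -> bs m x < bs n x.
Proof.
move=> mn; have -> : n = m + (`|(n - m)%R|.-1.+1)%N by lia.
elim: `|_|.-1 => [|l IH].
  by rewrite birkhoff_sumD1 ltrDl roof_gt0// rotation_itv.
rewrite -addn1 PoszD addrA birkhoff_sumD1 (lt_trans IH)// ltrDl.
by rewrite roof_gt0// rotation_itv.
Qed.

Lemma birkhoff_sum_le m n x : (m <= n)%R -> bs m x <= bs n x.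
Proof. by rewrite le_eqVlt => /orP[/eqP ->//|/birkhoff_sum_lt/ltW]. Qed.

Lemma birkhoff_sum_ge : exists2 c, 0 < c &
  forall x (n : nat), c * n%:R <= bs n x.
Proof.
case: (roof_bounded_away f) => c c0 fc; exists c => // x.
elim=> [|n IH]; first by rewrite birkhoff_sum0 mulr0.
rewrite -addn1 PoszD birkhoff_sumD1 natrD mulrDr mulr1 lerD//.
by rewrite fc// rotation_itv.
Qed.

(** The cocycle identity transfers the linear growth of forward sums to backward ones, so that the
    search ends in both directions. *)
Lemma birkhoff_index x t : exists n, bs n x <= t < bs (n + 1) x.
Proof.
have [c c0 hc] := birkhoff_sum_ge.
have unbounded s y : exists n : nat, s < bs n y.
  exists (Num.truncn (s / c)).+1; apply: lt_le_trans (hc _ _).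
  by rewrite mulrC -ltr_pdivrMr// truncnS_gt.
have [t0|t0] := leP 0 t.
  have [|n tn nmin] := @ex_minnP (fun n : nat => t < bs n x); first exact: unbounded.
  case: n tn nmin => [|n] tn nmin; first by move: tn; rewrite birkhoff_sum0 ltNge t0.
  exists n; rewrite -PoszD addn1 tn andbT leNgt; apply/negP => /nmin.
  by rewrite ltnn.
have [|n tn nmin] := @ex_minnP (fun n : nat => bs (- n%:Z) x <= t).
  exists (Num.truncn (- t / c)).+1; set n := _.+1.
  have := birkhoff_sumD (- n%:Z) n x; rewrite addNr birkhoff_sum0.
  have := hc (rot (- n%:Z) x) n.
  have : - t < n%:R * c by rewrite -ltr_pdivrMr// truncnS_gt.
  rewrite [c * _]mulrC; lra.
case: n tn nmin => [|n] tn nmin.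
  by move: tn; rewrite oppr0 birkhoff_sum0 leNgt t0.
exists (- n.+1%:Z); rewrite tn/=.
have -> : - n.+1%:Z + 1 = - n%:Z by lia.
by rewrite ltNge; apply/negP => /nmin; rewrite ltnn.
Qed.

Lemma birkhoff_index_uniq x t m n : bs m x <= t < bs (m + 1) x ->
  bs n x <= t < bs (n + 1) x -> m = n.
Proof.
move=> /andP[m1 m2] /andP[n1 n2].
have key i j : bs i x <= t -> t < bs (j + 1) x -> (i <= j)%R.
  move=> ti tj; rewrite leNgt; apply/negP; rewrite -lezD1 => /(birkhoff_sum_le x) h.
  by have := le_lt_trans (le_trans h ti) tj; rewrite ltxx.
by apply/eqP; rewrite eq_le (key _ _ m1 n2) (key _ _ n1 m2).
Qed.

Lemma special_flowE t (u : special_space f) n :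
  bs n (val u).1 <= (val u).2 + t < bs (n + 1) (val u).1 ->
  val (special_flow a t u) =
  (rot n (val u).1, (val u).2 + t - bs n (val u).1).
Proof.
rewrite /special_flow; case: (val u) => x s /= hn.
case: xgetP => [m -> hm|/(_ n)//].
rewrite (birkhoff_index_uniq hm hn) insubdK//.
rewrite unfold_in /= rotation_itv/= subr_ge0; move: hn => /andP[-> hn].
by rewrite ltrBlDl -birkhoff_sumD1.
Qed.

Lemma special_point_itv (u : special_space f) :
  0 <= (val u).1 < 1 /\ 0 <= (val u).2 < f (val u).1.
Proof. by have /andP[] := valP u. Qed.

Lemma special_flow0 (u : special_space f) : special_flow a 0 u = u.
Proof.
have [x01 s0f] := special_point_itv u.
apply: val_inj; rewrite (@special_flowE _ _ 0).
  by rewrite rotation0// birkhoff_sum0 subr0 addr0 -surjective_pairing.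
by rewrite birkhoff_sumD1 birkhoff_sum0 add0r addr0 rotation0.
Qed.

Lemma special_flowD s t (u : special_space f) :
  special_flow a (s + t) u = special_flow a s (special_flow a t u).
Proof.
have [n hn] := birkhoff_index (val u).1 ((val u).2 + t).
have e := special_flowE hn.
set v := special_flow a t u in e *.
have [m hm] := birkhoff_index (val v).1 ((val v).2 + s).
apply: val_inj; rewrite (special_flowE hm) (@special_flowE _ _ (n + m)); last first.
  have nm1 : n + m + 1 = n + (m + 1) :> int by rewrite addrA.
  move: hm; rewrite e nm1 (birkhoff_sumD n m) (birkhoff_sumD n (m + 1)) => /andP[/= h1 h2].
  by apply/andP; split; lra.
rewrite e /= rotationD; congr (_, _); rewrite birkhoff_sumD; ring.
Qed.

End flow_algebra.

(** The heights differ by less than [e / 4] and the shifted return times by at most [e / 2]; the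
    margin [e] at both ends of the fibre absorbs the sum. *)
Lemma same_floor {R : realType} (e s s' t q x1 x2 y1 y2 : R) : 0 < e ->
  `|s - s'| < e / 4 -> `|y1 - x1 - q| <= e / 2 -> `|y2 - x2 - q| <= e / 2 ->
  e <= t - (x1 - s) -> e <= x2 - s - t ->
  y1 <= s' + (t + q) < y2 /\
  `|s + t - x1 - (s' + (t + q) - y1)| <= 3 * e / 4.
Proof.
move=> e0; rewrite ltr_norml !ler_norml => /andP[? ?] /andP[? ?] /andP[? ?] ? ?.
by split; apply/andP; split; lra.
Qed.

(** * Shadowing along sampled times *)

Section shadowing.
Context {R : realType} (a : R) (f : roof R).
Notation bs := (birkhoff_sum a f).
Notation flow := (@special_flow R a f).

Lemma dist_int_rotation (m : int) (x y : R) :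
  dist_int (rotation a m x - rotation a m y) <= dist_int (x - y).
Proof.
have [n ->] := dist_int_attained (x - y); rewrite /rotation /frac.
set i := Num.floor _; set j := Num.floor _.
apply: le_trans (dist_int_le _ (n - i + j)) _.
rewrite le_eqVlt; apply/orP; left; apply/eqP; congr `|_|.
by rewrite intrD intrB; ring.
Qed.

(* At a time at distance at least [e] from all the return times of [u], the
   orbits of [u] and of [v], shifted by [q], are on the same floor. *)
Lemma shadow_close (e q t : R) (u v : special_space f) (n1 n2 : nat) :
  0 < e ->
  (forall m : nat, (n1 <= m <= n2)%N ->
     `|bs m (val v).1 - bs m (val u).1 - q| <= e / 2) ->
  special_dist u v < e / 4 ->
  bs n1 (val u).1 - (val u).2 <= t <= bs n2 (val u).1 - (val u).2 ->
  (forall m : nat, (n1 <= m <= n2)%N -> e <= `|bs m (val u).1 - (val u).2 - t|) ->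
  special_dist (flow t u) (flow (t + q) v) < 4 * e.
Proof.
move=> e0 hq duv /andP[t1 t2] far.
have [n hn] := birkhoff_index a f (val u).1 ((val u).2 + t).
have /andP[hn1 hn2] := hn.
have n1n : (n1%:Z <= n)%R.
  rewrite -ltzD1 ltNge; apply/negP => /(birkhoff_sum_le a f (val u).1); lra.
have nn2 : (n + 1 <= n2%:Z)%R.
  rewrite lezD1 ltNge; apply/negP => n2n.
  have := birkhoff_sum_le a f (val u).1 n2n => h.
  have le_n12 : (n1 <= n2)%N.
    rewrite leqNgt; apply/negP => n21.
    have := @birkhoff_sum_lt _ a f n2 n1 (val u).1; rewrite ltz_nat => /(_ n21); lra.
  have := far n2; rewrite le_n12 leqnn => /(_ isT).
  have -> : bs n2 (val u).1 - (val u).2 - t = 0 by clear -t2 h hn1; lra.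
  by rewrite normr0 leNgt e0.
have [m nE] : exists m : nat, n = m by exists `|n|%N; lia.
move: hn hn1 hn2 n1n nn2; rewrite nE => hn hn1 hn2 n1m mn2.
have far1 := far m; have far2 := far m.+1; have hq1 := hq m; have hq2 := hq m.+1.
have r1 : (n1 <= m <= n2)%N by move: n1m mn2; clear; lia.
have r2 : (n1 <= m.+1 <= n2)%N by move: n1m mn2; clear; lia.
move: (far1 r1) (far2 r2) (hq1 r1) (hq2 r2) => {far1 far2 hq1 hq2}.
rewrite -addn1 PoszD distrC ger0_norm; last by rewrite subr_ge0 lerBlDl.
rewrite ger0_norm; last by rewrite subr_ge0 lerBrDl ltW.
move=> far1 far2 hq1 hq2.
have ds : `|(val u).2 - (val v).2| < e / 4.
  by apply: le_lt_trans duv; rewrite /special_dist lerDr dist_int_ge0.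
have [hv close] := same_floor e0 ds hq1 hq2 far1 far2.
rewrite /special_dist (special_flowE hn) (special_flowE hv).
apply: (@le_lt_trans _ _ (e / 4 + 3 * e / 4)); last by clear -e0; lra.
apply: lerD close.
apply: le_trans (dist_int_rotation _ _ _) _; apply: le_trans (ltW duv).
by rewrite /special_dist lerDl.
Qed.

(** A bad sample is within [e] of some return time of [u]. As [2 e <= gamma], a return time is that
    close to at most one multiple of [gamma], so bad samples inject into near-lattice indices. *)
Lemma shadow_count (gamma e eps q : R) (u v : special_space f) (n1 n2 : nat) :
  0 < gamma -> 0 < e -> 2 * e <= gamma -> 4 * e <= eps -> (n1 <= n2)%N ->
  (forall m : nat, (n1 <= m <= n2)%N ->
     `|bs m (val v).1 - bs m (val u).1 - q| <= e / 2) ->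
  special_dist u v < e / 4 ->
  let T (m : nat) := bs m (val u).1 - (val u).2 in
  let M := T n1 / gamma in let L := (T n2 - T n1) / gamma in
  is_true (L - 1 - #|[set j : 'I_(n2 - n1).+1 | `[< exists z : int,
     `|T (n1 + j)%N - gamma * z%:~R| < e >]]%SET|%:R <=
  #|` fset_set [set n : int | M <= n%:~R <= M + L /\
      mdist (flow (n%:~R * gamma) u) (flow (n%:~R * gamma + q) v) < eps]|%:R).
Proof.
move=> gamma0 e0 eg e4 n12 hq duv T M L.
have T12 : T n1 <= T n2 by rewrite lerD2r birkhoff_sum_le// lez_nat.
have L0 : 0 <= L by rewrite divr_ge0 ?subr_ge0// ltW.
pose K := `|(Num.floor (M + L) - Num.floor M)%R|%N.
have KE : K%:Z = (Num.floor (M + L) - Num.floor M)%R.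
  by rewrite gez0_abs// subr_ge0 le_floor// lerDl.
have [M1 M2] := floor_itv_le M; have [ML1 ML2] := floor_itv_le (M + L).
have KR : K%:R = (Num.floor (M + L))%:~R - (Num.floor M)%:~R :> R.
  by rewrite pmulrn KE intrB.
have KL : L - 1 <= K%:R by rewrite KR; lra.
(* These integers start strictly above [floor M], so [M] itself is left out when it is an integer;
   this is within the lost [1]. *)
pose pt (i : nat) : int := (Num.floor M + i.+1%:Z)%R.
have pt_inj : injective pt by move=> i j /addrI [].
have ptR i : (pt i)%:~R = (Num.floor M)%:~R + 1 + i%:R :> R.
  by rewrite /pt intrD -pmulrn -natr1; ring.
have pt_itv (i : 'I_K) : M <= (pt i)%:~R <= M + L.
  rewrite ptR; have := ler0n R i.
  have : i.+1%:R <= K%:R :> R by rewrite ler_nat.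
  rewrite -natr1 KR => *; apply/andP; split; lra.
set A := [set n : int | _].
have finA : finite_set A.
  apply: (@sub_finite_set _ _ ((fun i : nat => Num.floor M + i%:Z)%R @` `I_K.+1)).
    move=> n [/andP[n1' n2'] _].
    have h1 : (Num.floor M <= n)%R by rewrite -(ler_int R); lra.
    have h2 : (n <= Num.floor (M + L))%R by rewrite floor_ge_int.
    exists `|(n - Num.floor M)%R|%N; last by rewrite gez0_abs ?subr_ge0// addrC subrK.
    by rewrite /= ltnS -lez_nat KE gez0_abs ?subr_ge0// lerD2r.
  exact/finite_image/finite_II.
pose bad (i : 'I_K) := [exists j : 'I_(n2 - n1).+1,
  `|T (n1 + j)%N - gamma * (pt i)%:~R| < e].
pose good := [set i : 'I_K | ~~ bad i]%SET.
have goodA (i : 'I_K) : i \in good -> A (pt i).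
  rewrite inE => /existsPn gi; split; first exact: pt_itv.
  apply: lt_le_trans e4; rewrite -[mdist _ _]/(special_dist _ _).
  apply: (@shadow_close e q _ u v n1 n2) => //.
    have /andP[p1 p2] := pt_itv i.
    rewrite -/(T n1) -/(T n2); apply/andP; split.
      by rewrite -ler_pdivrMr.
    by rewrite -ler_pdivlMr//; apply: le_trans p2 _; rewrite /M /L -mulrDl; rewrite addrC subrK.
  move=> m /andP[n1m mn2]; have mj : (m - n1 < (n2 - n1).+1)%N by rewrite ltnS leq_sub2r.
  have := gi (Ordinal mj); rewrite -leNgt /= subnKC//.
  by rewrite [_%:~R * gamma]mulrC.
have good_card : (#|good| <= #|` fset_set A|)%N.
  have := @uniq_leq_size _ [seq pt i | i : 'I_K <- enum good] (fset_set A).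
  rewrite size_map -cardE; apply.
    by rewrite map_inj_uniq ?enum_uniq// => i j /pt_inj/val_inj.
  move=> n /mapP[i]; rewrite mem_enum => /goodA Ai ->.
  by rewrite in_fset_set// inE.
(* The default [ord0] is never reached for a bad sample. *)
pose w (i : 'I_K) : 'I_(n2 - n1).+1 := odflt ord0
  [pick j : 'I_(n2 - n1).+1 | `|T (n1 + j)%N - gamma * (pt i)%:~R| < e].
have wP i : bad i -> `|T (n1 + w i)%N - gamma * (pt i)%:~R| < e.
  by rewrite /w; case: pickP => //= h /existsP[j]; rewrite h.
have w_inj : {in ~: good &, injective w}%SET.
  move=> i j; rewrite !inE !negbK => /wP bi /wP bj wij.
  move: bi bj; rewrite wij !ltr_norml => /andP[? ?] /andP[? ?].
  apply/val_inj/pt_inj/eqP; rewrite /= eq_le.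
  have lt1 (m n : int) : gamma * m%:~R - gamma * n%:~R < gamma -> (m <= n)%R.
    by rewrite -mulrBr gtr_pMr// -intrB -[1]/(1%:~R) ltr_int; clear; lia.
  by apply/andP; split; apply: lt1; lra.
have bad_card : (#|~: good|%SET <= #|[set j : 'I_(n2 - n1).+1 | `[< exists z : int,
     (`|T (n1 + j)%N - gamma * z%:~R| < e)%R >]]%SET|)%N.
  rewrite -(card_in_imset w_inj); apply: subset_leq_card; apply/fintype.subsetP => j.
  move=> /imsetP[i ib ->]; rewrite inE; apply/asboolP; exists (pt i).
  by apply: wP; move: ib; rewrite !inE negbK.
have := cardsC good; rewrite card_ord => cK.
have : (#|good| + #|~: good|%SET)%:R = K%:R :> R by rewrite cK.
rewrite natrD; move: good_card; rewrite -(ler_nat R) => h1.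
move: bad_card; rewrite -(ler_nat R) => h2 h3.
rewrite lerBlDr (le_trans KL)// -h3; exact: lerD.
Qed.

End shadowing.

Section piecewise_roof.
Context {R : realType} (f : R -> R) (k : nat) (b : nat -> R).
Hypothesis pac : piecewise_ac f k b.

(** On a period the lift is bounded by compactness and the floors are 0 or -1; the finitely many
    values at breakpoints are arbitrary and enter the bound separately. *)
Lemma piecewise_ac_bounded : exists2 Fm : R, 0 < Fm & forall x, f (frac x) <= Fm.
Proof.
have [k0 bk blt _] := pac.
pose G := continuous_lift f k b.
have cG : {within `[b 0%N, b 0%N + 1], continuous G}.
  exact/continuous_subspaceT/(continuous_lift_continuous pac).
have b01 : b 0%N <= b 0%N + 1 by rewrite lerDl.
have [c _ hc] := EVT_max b01 cG.
pose Fm := `|G c| + \sum_(j < k) `|jump f (b j)| + \sum_(j < k) `|f (frac (b j))| + 1.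
exists Fm; first by rewrite /Fm ltr_wpDl// !addr_ge0// sumr_ge0.
move=> x; have [[j [jk [m xE]]]|off] :=
    pselect (exists j, (j < k)%N /\ exists m : int, x = b j + m%:~R).
  have h1 : `|f (frac (b j))| <= \sum_(j < k) `|f (frac (b j))|.
    by rewrite (bigD1 (Ordinal jk))//= lerDl sumr_ge0.
  have h2 : 0 <= \sum_(j < k) `|jump f (b j)| by exact: sumr_ge0.
  have := ler_norm (f (frac (b j))); have := normr_ge0 (G c).
  by rewrite xE fracDint /Fm; lra.
pose m := Num.floor (x - b 0%N); pose y := x - m%:~R.
have [m1 m2] := floor_itv_le (x - b 0%N); rewrite -/m in m1 m2.
have y1 : b 0%N <= y by rewrite /y; lra.
have y2 : y < b 0%N + 1 by rewrite /y; lra.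
have -> : frac x = frac y by rewrite /y -intrN fracDint.
rewrite (continuous_liftE pac); last first.
  move=> j m' jk; apply/eqP => yE; apply: off; exists j; split=> //; exists (m' + m).
  by rewrite intrD addrA -yE /y subrK.
have Gy : G y <= `|G c|.
  by apply: le_trans (ler_norm _); apply: hc; rewrite in_itv/= y1 ltW.
have : - \sum_(j < k) jump f (b j) * (Num.floor (y - b j))%:~R <= \sum_(j < k) `|jump f (b j)|.
  rewrite -sumrN; apply: ler_sum => j _; rewrite (le_trans (ler_norm _))// normrN normrM.
  rewrite ler_piMr// ler_norml.
  have [f1 f2] := floor_itv_le (y - b j).
  have j1 : b 0%N <= b j by rewrite (breakpoints_le pac)//= ltnW.
  have j2 : b j < b 0%N + 1.
    by rewrite -bk (lt_le_trans (blt j (ltn_ord j)))// (breakpoints_le pac)//= ltn_ord leqnn.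
  have : (-1 <= Num.floor (y - b j))%R by rewrite floor_ge_int mulrN1z; lra.
  have : (Num.floor (y - b j) <= 0)%R by rewrite floor_le0; lra.
  by rewrite -!(ler_int R) mulrN1z mulr0z => h1 h2; apply/andP; split; lra.
have : 0 <= \sum_(j < k) `|f (frac (b j))| by exact: sumr_ge0.
rewrite /Fm -/(G y); lra.
Qed.

End piecewise_roof.

Lemma birkhoff_sum_nat {R : realType} (a : R) (f : R -> R) (n : nat) (x : R) :
  birkhoff_sum a f n x = birkhoff a (f \o frac) n x.
Proof. by []. Qed.

Lemma birkhoffDint {R : realType} (a : R) (f : R -> R) (n : nat) (x : R) (l : int) :
  birkhoff a (f \o frac) n (x + l%:~R) = birkhoff a (f \o frac) n x.
Proof. by apply: eq_bigr => i _; rewrite /= addrAC fracDint. Qed.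

Lemma regularDint {R : realType} (a : R) (k : nat) (b : nat -> R) (x : R) (l : int) :
  regular a k b x -> regular a k b (x + l%:~R).
Proof.
move=> rx i j m jk; have := rx i j (m - l) jk; apply: contra_neq => e.
by rewrite intrB addrA -e; ring.
Qed.

(** * The Ratner estimate for regular points *)

Section ratner_estimate.
Context {R : realType} (a : R) (f : roof R) (k : nat) (b : nat -> R) (p : R).
Hypotheses (a01 : 0 < a < 1) (ia : irrational a)
  (bpq : has_ubound (partial_quotients a)) (pac : piecewise_ac f k b).
Let S := sum_of_jumps f k b.
Let C := sup (partial_quotients a) + 1.
Let D := jump_combinations f k b C.
Hypotheses (S0 : S != 0) (pS : 0 < p < `|S|).
Let P : set R := [set Num.sg S * p - d | d in D] `|` [set - Num.sg S * p + d | d in D].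

Let pq_le n : (partial_quotient a n)%:~R <= sup (partial_quotients a).
Proof. by apply: ub_le_sup => //; exists n. Qed.

Let badly (m l : int) : (0 < m)%R ->
  1 <= (sup (partial_quotients a) + 2) * m%:~R * `|m%:~R * a - l%:~R|.
Proof. exact: badly_approximable. Qed.

Let sup_ge0 : 0 <= sup (partial_quotients a).
Proof.
apply: le_trans (pq_le 0); rewrite ler0z.
by have := convergent_inv a01 ia 0 => -[_ [_ _ _]]; lia.
Qed.

Let incrG (eta : R) : 0 < eta ->
  exists n0 : nat, forall n x h, (n0 <= n)%N -> 0 <= h -> n%:R * h <= 1 ->
  `|increments a (continuous_lift f k b) n x h - n%:R * h * S| <= eta.
Proof.
(* Absolute continuity of the lift is available on the period that starts at [b 0], hence the
   translation. *)
move=> eta0; pose G (x : R) := continuous_lift f k b (x + b 0%N).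
have GS z : G (z + 1) = G z + S.
  by rewrite /G addrAC continuous_liftD1.
have cG : continuous G.
  move=> x; apply: (@cvg_comp _ _ _ (fun z => z + b 0%N) (continuous_lift f k b)
    _ (nbhs (x + b 0%N))).
    by apply: cvgD; [exact: cvg_id|exact: cvg_cst].
  exact: (continuous_lift_continuous pac).
have [n0 h0] := lift_increments badly (dirichlet_approx a01 ia) eta0 GS cG (continuous_lift_ac pac).
exists n0 => n x h nn hh nh; have := h0 n (x - b 0%N) h nn hh nh.
rewrite /increments /G; congr (`|_ - _| <= _); apply: eq_bigr => i _.
by congr (continuous_lift _ _ _ _ - continuous_lift _ _ _ _); ring.
Qed.

Let FE (x : R) : (forall j (m : int), (j < k)%N -> x != b j + m%:~R) ->
  (f \o frac) x = continuous_lift f k b x -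
    \sum_(j < k) jump f (b j) * (Num.floor (x - b j))%:~R.
Proof. exact: continuous_liftE. Qed.

Let GS z : continuous_lift f k b (z + 1) = continuous_lift f k b z + S.
Proof. exact: continuous_liftD1. Qed.

(** Whichever base point comes first on the short arc plays [x] in [constant_window]; exchanging the
    points reverses the drift, hence the two halves of [P]. Equal base points would put [v] on the
    orbit of [u]. *)
Lemma window_for_pair (e : R) : 0 < e ->
  exists2 kappa : R, 0 < kappa & forall N : nat, exists2 delta : R, 0 < delta &
  forall u v : special_space f,
    regular a k b (val u).1 -> regular a k b (val v).1 ->
    (forall t, special_flow a t u <> v) -> special_dist u v < delta ->
  exists (n1 n2 : nat) (q : R),
  [/\ (N <= n1)%N, (n1 + N <= n2)%N, kappa * n2%:R <= n2%:R - n1%:R, P q &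
      forall m : nat, (n1 <= m <= n2)%N ->
        `|birkhoff_sum a f m (val v).1 - birkhoff_sum a f m (val u).1 - q| <= e].
Proof.
move=> e0.
have [kappa kappa0 hk] := @constant_window R a (sup (partial_quotients a) + 2) k b
  (fun j => jump f (b j)) (f \o frac) (continuous_lift f k b) badly incrG FE S0 p e pS e0.
exists kappa => // N; have [delta delta0 hd] := hk N; exists delta => // u v ru rv uv duv.
(* With [s] the supremum of the digits, the counts are at most [s + 3], while [D] allows
   [2 (s + 1) + 1 = 2 s + 3]. *)
have in_D (c : nat -> int) :
    (forall j, (0 <= c j)%R /\ (c j)%:~R <= 1 + (sup (partial_quotients a) + 2)) ->
    D (\sum_(j < k) jump f (b j) * (c j)%:~R).
  move=> hc; exists (fun j : 'I_k => c j).
    move=> j; have [c0 c1] := hc j; split=> //; apply: le_trans c1 _.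
    by rewrite /C; have := sup_ge0; lra.
  by apply: eq_bigr => j _; rewrite mulrC.
have [u01 us] := special_point_itv u; have [v01 vs] := special_point_itv v.
have [l hl] := dist_int_attained ((val u).1 - (val v).1).
have hdl : `|(val u).1 - (val v).1 - l%:~R| < delta.
  by rewrite -hl; apply: le_lt_trans duv; rewrite /special_dist lerDl.
have [w0|w0|w0] := ltgtP ((val u).1 - (val v).1 - l%:~R) 0; last first.
- have xE : (val u).1 = (val v).1.
    by apply: dist_int_eq => //; rewrite hl w0 normr0.
  exfalso; apply: (uv ((val v).2 - (val u).2)); apply: val_inj.
  rewrite (@special_flowE _ _ _ _ _ 0).
    by rewrite rotation0// birkhoff_sum0 subr0 addrC subrK xE -surjective_pairing.
  by rewrite birkhoff_sumD1 birkhoff_sum0 rotation0// add0r addrC subrK xE.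
- have h01 : 0 < (val u).1 - (val v).1 - l%:~R < delta.
    by rewrite w0/=; move: hdl; rewrite gtr0_norm.
  have uE : (val v).1 + l%:~R + ((val u).1 - (val v).1 - l%:~R) = (val u).1 by ring.
  have ru' : regular a k b ((val v).1 + l%:~R + ((val u).1 - (val v).1 - l%:~R)) by rewrite uE.
  have [n1 [n2 [c [h1 h2 h3 h4 h5]]]] := hd _ _ (regularDint l rv) ru' h01.
  exists n1, n2, (- Num.sg S * p + \sum_(j < k) jump f (b j) * (c j)%:~R); split => //.
    by right; exists (\sum_(j < k) jump f (b j) * (c j)%:~R) => //; exact: in_D.
  move=> m /h5; rewrite uE birkhoffDint !birkhoff_sum_nat -normrN; congr (`|_| <= _).
  by rewrite -/S; ring.
- have h01 : 0 < - ((val u).1 - (val v).1 - l%:~R) < delta.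
    by rewrite oppr_gt0 w0/=; move: hdl; rewrite ltr0_norm.
  have vE : (val u).1 - ((val u).1 - (val v).1 - l%:~R) = (val v).1 + l%:~R by ring.
  have rv' : regular a k b ((val u).1 - ((val u).1 - (val v).1 - l%:~R)).
    by rewrite vE; exact: regularDint.
  have [n1 [n2 [c [h1 h2 h3 h4 h5]]]] := hd _ _ ru rv' h01.
  exists n1, n2, (Num.sg S * p - \sum_(j < k) jump f (b j) * (c j)%:~R); split => //.
    by left; exists (\sum_(j < k) jump f (b j) * (c j)%:~R) => //; exact: in_D.
  by move=> m /h5; rewrite vE birkhoffDint !birkhoff_sum_nat.
Qed.

Lemma ratner_estimate (gamma eps : R) : 0 < gamma -> 0 < eps ->
  exists2 kappa : R, 0 < kappa & forall N : nat, exists2 delta : R, 0 < delta &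
  forall u v : special_space f,
    regular a k b (val u).1 -> regular a k b (val v).1 ->
    (forall t, special_flow a t u <> v) -> mdist u v < delta ->
  exists M L q : R,
        [/\ N%:R <= M, N%:R <= L, kappa <= L / M, P q &
        1 - eps <
          #|` fset_set [set n : int | M <= n%:~R <= M + L /\
               mdist (special_flow a (n%:~R * gamma) u)
                 (special_flow a (n%:~R * gamma + q) v) < eps]|%:R
          / L].
Proof.
move=> gamma0 eps0.
have [c c0 hc] := birkhoff_sum_ge a f.
have [Fm Fm0 hFm] := piecewise_ac_bounded pac.
(* There are at most [eps2 (n2 - n1 + 1) <= 2 eps2 gamma L / c = eps L / 2] near-lattice indices;
   the other [eps L / 2] pays for the [1] lost in [shadow_count]. *)
pose eps2 := eps * c / (4 * gamma).
have eps20 : 0 < eps2 by rewrite divr_gt0 ?mulr_gt0.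
have [e1 e10 [L0 hL0]] := @near_lattice_density R a (sup (partial_quotients a) + 2) k b
  (fun j => jump f (b j)) (f \o frac) (continuous_lift f k b) badly GS incrG FE S0
  gamma eps2 gamma0 eps20.
pose e := Num.min e1 (Num.min (gamma / 2) (eps / 4)).
have e0 : 0 < e by rewrite !lt_min e10/= !divr_gt0.
have ee1 : e <= e1 by rewrite ge_min lexx.
have eg : 2 * e <= gamma.
  have : e <= gamma / 2 by rewrite !ge_min lexx orbT.
  lra.
have e4 : 4 * e <= eps.
  have : e <= eps / 4 by rewrite !ge_min lexx !orbT.
  lra.
have e20 : 0 < e / 2 by lra.
have [kappa0 kappa00 hk] := window_for_pair e20.
exists (c * kappa0 / Fm); first by rewrite divr_gt0// mulr_gt0.
move=> N.
(* [N1] makes [M] and [L] at least [N], with [Fm] compensating the initial height of [u]; [N2] makes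
   [1 < eps L / 2]. *)
pose N1 := (Num.truncn ((N.+1%:R * gamma + Fm) / c)).+1.
pose N2 := (Num.truncn (2 * gamma / (eps * c))).+1.
have [delta delta0 hd] := hk (maxn L0 (maxn N1 N2)).
exists (Num.min delta (e / 4)); first by rewrite lt_min delta0 divr_gt0.
move=> u v ru rv uv; rewrite lt_min => /andP[duv1 duv2].
have [n1 [n2 [q [hn1 hn2 hkap Pq hq]]]] := hd u v ru rv uv duv1.
have n12 : (n1 <= n2)%N by rewrite (leq_trans _ hn2)// leq_addr.
have := shadow_count gamma0 e0 eg e4 n12 hq duv2.
set T := fun m : nat => birkhoff_sum a f m (val u).1 - (val u).2.
set M := T n1 / gamma; set L := (T n2 - T n1) / gamma => /= count.
have [u01 /andP[us0 usf]] := special_point_itv u.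
have usFm : (val u).2 <= Fm.
  by apply: le_trans (ltW usf) _; have := hFm (val u).1; rewrite frac_id.
have bs_le (n : nat) : birkhoff_sum a f n (val u).1 <= Fm * n%:R.
  rewrite birkhoff_sum_nat /birkhoff -[X in _ * X%:R]card_ord mulr_natr -sumr_const.
  by apply: ler_sum => i _; exact: hFm.
have nR : n1%:R <= n2%:R :> R by rewrite ler_nat.
have dn (m : nat) : (m <= maxn L0 (maxn N1 N2))%N -> m%:R <= n2%:R - n1%:R :> R.
  by move=> mN; rewrite lerBrDl -natrD ler_nat (leq_trans _ hn2)// leq_add2l.
have T_incr : c * (n2%:R - n1%:R) <= T n2 - T n1.
  have e12 : n2%:Z = (n1%:Z + (n2 - n1)%N)%R by rewrite -PoszD subnKC.
  rewrite /T -natrB// e12 birkhoff_sumD.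
  rewrite opprB addrACA addrA.
  rewrite [X in _ <= X](_ : _ =
    birkhoff_sum a f (n2 - n1)%N (rotation a n1 (val u).1)); first exact: hc.
  ring.
have N1c : N.+1%:R * gamma + Fm <= c * N1%:R.
  by rewrite [leRHS]mulrC -ler_pdivrMr// ltW// truncnS_gt.
have N2c : 2 * gamma < eps * c * N2%:R.
  by rewrite [ltRHS]mulrC -ltr_pdivrMr ?mulr_gt0// truncnS_gt.
have cn1 : c * N1%:R <= c * n1%:R.
  rewrite ler_pM2l// ler_nat; apply: leq_trans hn1.
  by rewrite !leq_max leqnn orbT.
have Mge : N.+1%:R <= M.
  rewrite /M ler_pdivlMr// /T lerBrDr; apply: le_trans (hc (val u).1 n1).
  by apply: le_trans cn1; apply: le_trans N1c; rewrite lerD2l.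
have NN : N%:R <= N.+1%:R :> R by rewrite ler_nat.
have M0 : 0 < M by apply: lt_le_trans Mge; rewrite ltr0n.
have L_ge : c * (n2%:R - n1%:R) / gamma <= L by rewrite ler_pM2r ?invr_gt0.
have dN1 : N1%:R <= n2%:R - n1%:R :> R by apply: dn; rewrite !leq_max leqnn orbT.
have dN2 : N2%:R <= n2%:R - n1%:R :> R by apply: dn; rewrite !leq_max leqnn !orbT.
have Lge : N%:R <= L.
  apply: le_trans L_ge; rewrite ler_pdivlMr//.
  apply: (@le_trans _ _ (c * N1%:R)); last by rewrite ler_pM2l.
  apply: le_trans N1c; apply: (@le_trans _ _ (N.+1%:R * gamma)); first by rewrite ler_pM2r.
  by rewrite lerDl ltW.
have L2 : 1 < eps / 2 * L.
  have h : 2 * gamma < eps * c * (n2%:R - n1%:R).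
    by apply: lt_le_trans N2c _; rewrite ler_pM2l// mulr_gt0.
  apply: (@lt_le_trans _ _ (eps / 2 * (c * (n2%:R - n1%:R) / gamma))).
    have -> : eps / 2 * (c * (n2%:R - n1%:R) / gamma) = eps * c * (n2%:R - n1%:R) / (2 * gamma).
      by field; rewrite gt_eqF.
    by rewrite ltr_pdivlMr ?mul1r// mulr_gt0.
  by rewrite ler_pM2l// divr_gt0.
have Lpos : 0 < L.
  by rewrite -(pmulr_rgt0 _ (_ : 0 < eps / 2)) ?divr_gt0//; apply: lt_trans L2.
exists M, L, q; split => //.
- by apply: le_trans NN Mge.
- rewrite ler_pdivlMr//.
  have M_le : M <= Fm * n2%:R / gamma.
    rewrite ler_pM2r ?invr_gt0// /T lerBlDr; apply: le_trans (bs_le n1) _.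
    by rewrite ler_wpDr// ler_pM2l.
  apply: le_trans L_ge; apply: le_trans (_ : c * kappa0 / Fm * (Fm * n2%:R / gamma) <= _).
    by rewrite ler_pM2l// divr_gt0// mulr_gt0.
  have -> : c * kappa0 / Fm * (Fm * n2%:R / gamma) = c * (kappa0 * n2%:R) / gamma.
    by field; rewrite !gt_eqF.
  by rewrite ler_pM2r ?invr_gt0// ler_pM2l.
rewrite ltr_pdivlMr//; apply: lt_le_trans count.
set B := #|_|%:R.
suff hB : B <= eps / 2 * L.
  have -> : (1 - eps) * L = L - (eps / 2 * L + eps / 2 * L) by field.
  by rewrite -[ltRHS]addrA -opprD ltrD2l ltrN2 ltr_leD.
have -> : eps / 2 * L = eps2 * 2 * (gamma * L / c).
  by rewrite /eps2; field; rewrite !gt_eqF.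
have gL : n2%:R - n1%:R <= gamma * L / c.
  rewrite ler_pdivlMr// mulrC; apply: le_trans T_incr _.
  by rewrite /L mulrC mulfVK// gt_eqF.
have dn1 : 1 <= n2%:R - n1%:R :> R by apply: le_trans dN1; rewrite ler1n.
apply: (@le_trans _ _ (eps2 * (n2 - n1).+1%:R)); last first.
  rewrite -mulrA ler_pM2l// -natr1 natrB// mulr_natl mulr2n; apply: (lerD gL _).
  exact: le_trans dn1 gL.
(* The density bound is applied from the start of the window, with [T n1] as the time already
   elapsed. *)
have rn1 : regular a k b ((val u).1 + n1%:R * a) by exact: regularD.
apply: le_trans (hL0 _ (T n1) (n2 - n1).+1 rn1 _); last first.
  by apply: leqW; rewrite leq_subRL// (leq_trans _ hn2)// leq_add2l leq_maxl.
rewrite /B ler_nat; apply: subset_leq_card; apply/fintype.subsetP => j.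
rewrite inE => /asboolP[z hz]; rewrite inE; apply/asboolP; exists z.
apply: lt_le_trans ee1; move: hz; congr (`|_ - _| < _).
by rewrite /T !birkhoff_sum_nat birkhoffD; ring.
Qed.

End ratner_estimate.

(** * Invariant measure *)

Section plane.
Context {R : realType}.
Notation lam := (@lebesgue_measure R).
Notation Rm := (measurableTypeR R).

Lemma measurable_addr (c : R) : measurable_fun [set: Rm] (fun x : Rm => (x + c : Rm)).
Proof. exact: measurable_funD. Qed.

Lemma lebesgue_measure_shift (c : R) (A : set Rm) : measurable A ->
  pushforward lam (fun x : Rm => (x + c : Rm)) A = lam A.
Proof.
move=> mA; apply/esym/lebesgue_measure_unique => //; first exact: measurable_addr.
move=> mf _ [[x y]] _ <-; rewrite /pushforward.
rewrite [X in _ = lam X](_ : _ = `]x - c, y - c]%classic); last first.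
  by apply/seteqP; split => z /=; rewrite !in_itv/= ltrBlDr lerBrDr.
rewrite !lebesgue_measure_itv/= !lte_fin ltrD2r; case: ifP => // _.
by rewrite -!EFinB; congr (_%:E); ring.
Qed.

(** By Fubini: the vertical sections are translated, and so is the base. *)
Lemma plane_shear_preserving (c : R) (tau : R -> R) (B : set (Rm * Rm)) :
  measurable_fun [set: Rm] (tau : Rm -> Rm) -> measurable B ->
  (lam \x lam)%E ((fun z : R * R => (z.1 + c, z.2 + tau z.1)) @^-1` B) = (lam \x lam)%E B.
Proof.
move=> mtau mB; rewrite /product_measure1.
pose g (x : Rm) : \bar R := lam (xsection B x).
transitivity (\int[lam]_x g (x + c)%R)%E.
  apply: eq_integral => x _; rewrite /= /g.
  have -> : xsection ((fun z : R * R => (z.1 + c, z.2 + tau z.1)) @^-1` B) x =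
      (fun s : R => s + tau x) @^-1` xsection B (x + c).
    by apply/seteqP; split => s; rewrite /xsection/= !inE.
  by apply: lebesgue_measure_shift; exact: measurable_xsection.
have mg : measurable_fun [set: Rm] g by exact: measurable_fun_xsection.
transitivity (\int[pushforward lam (fun x : Rm => (x + c)%R : Rm)]_y g y)%E.
  rewrite ge0_integral_pushforward//; first exact: measurable_addr.
apply: eq_measure_integral => //; first exact: measurable_addr.
by move=> mf A mA _; exact: lebesgue_measure_shift.
Qed.

End plane.

Section measurable_roof.
Context {R : realType} (f : R -> R) (k : nat) (b : nat -> R).
Hypothesis pac : piecewise_ac f k b.
Notation Rm := (measurableTypeR R).

Lemma piecewise_ac_measurable : measurable_fun [set: Rm] (f \o frac : Rm -> Rm).
Proof.
pose E (i : nat) : set Rm := if @pickle_inv (bool * nat * int)%type i is Some (c, j, l) then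
  if (j < k)%N then
    if c then [set b j + (l : int)%:~R] else `]b j + l%:~R, b j.+1 + l%:~R[%classic
  else set0 else set0.
have mE i : measurable (E i).
  rewrite /E; case: (@pickle_inv (bool * nat * int)%type i) => [[[[] j] l]|] //; case: ifP => // _.
have -> : [set: Rm] = \bigcup_i E i.
  apply/esym/seteqP; split=> // x _; pose l := Num.floor (x - b 0%N).
  have [l1 l2] := floor_itv_le (x - b 0%N).
  have [|j jk /andP[j1 j2]] := breakpoint_locate pac (x := x - l%:~R).
    by rewrite /l; apply/andP; split; lra.
  move: j1; rewrite le_eqVlt => /orP[/eqP j1|j1].
    exists (choice.pickle (true, j, l)) => //; rewrite /E pickleK_inv jk /=.
    by rewrite j1 subrK.
  exists (choice.pickle (false, j, l)) => //; rewrite /E pickleK_inv jk /= in_itv/=.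
  by rewrite -ltrBrDr j1 -ltrBlDr.
apply/measurable_fun_bigcup => // i; rewrite /E.
case: (@pickle_inv (bool * nat * int)%type i) => [[[[] j] l]|]; last exact: measurable_fun_set0.
  by case: ifP => _; [exact: measurable_fun_set1|exact: measurable_fun_set0].
case: ifP => jk; last exact: measurable_fun_set0.
apply: open_continuous_measurable_fun; first exact: interval_open.
move=> x; rewrite inE/= in_itv/= => /andP[x1 x2].
have [_ _ _ acF] := pac.
have c0 : (f \o frac) y @[y --> x - l%:~R] --> (f \o frac) (x - l%:~R).
  by apply: ac_itv_continuous (acF j jk) _; apply/andP; split; lra.
have -> : f \o frac = (f \o frac) \o (fun y : R => y - l%:~R).
  by apply/funext => y /=; rewrite -intrN fracDint.
apply: (@cvg_comp _ _ _ (fun y : R => y - l%:~R) (f \o frac) _ (nbhs (x - l%:~R))) => //.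
by apply: cvgB; [exact: cvg_id|exact: cvg_cst].
Qed.

Lemma measurable_birkhoff_sum (a : R) (n : int) :
  measurable_fun [set: Rm] (birkhoff_sum a f n : Rm -> Rm).
Proof.
have ms (m : nat) (c : nat -> R) : measurable_fun [set: Rm]
    (fun x : Rm => (\sum_(i < m) f (frac (x + c i)) : Rm)).
  elim: m => [|m IH].
    by under eq_fun do rewrite big_ord0; exact: measurable_cst.
  under eq_fun do rewrite big_ord_recr/=.
  apply: measurable_funD => //.
  by apply: (measurableT_comp piecewise_ac_measurable); exact: measurable_addr.
case: n => n; first exact: (ms n (fun i => i%:Z%:~R * a)).
by apply: measurable_funN; exact: (ms n.+1 (fun i => (- (i.+1)%:Z)%:~R * a)).
Qed.

End measurable_roof.

Section special_borel.
Context {R : realType} (f : roof R) (k : nat) (b : nat -> R).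
Hypothesis pac : piecewise_ac f k b.
Notation X := (special_space f).
Notation Rm := (measurableTypeR R).
Notation lam := (@lebesgue_measure R).

Definition special_range : set (Rm * Rm) := range (val : X -> R * R).

Lemma special_rangeP (z : R * R) :
  special_range z <-> (0 <= z.1 < 1) && (0 <= z.2 < f z.1).
Proof.
split=> [[u _ <-]|h]; first exact: (special_valP u).
by exists (SpecialPoint h).
Qed.

Lemma special_openP (U : set X) : open U <->
  forall u, U u -> exists2 e : R, 0 < e & forall v, special_dist u v < e -> U v.
Proof.
rewrite openE; split=> [oU u /oU|h u /h[e e0 he]].
  rewrite /interior => /nbhs_ballP[e /= e0 he]; exists e => // v uv; exact: he.
by apply/nbhs_ballP; exists e => // v; exact: he.
Qed.

Lemma measurable_special_range : measurable special_range.
Proof.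
have mF : measurable_fun [set: Rm] (f \o frac : Rm -> Rm) by exact: piecewise_ac_measurable pac.
have -> : special_range = ((fst : Rm * Rm -> Rm) @^-1` `[0, 1[%classic) `&`
   (((snd : Rm * Rm -> Rm) @^-1` `[0, +oo[%classic) `&`
   ((fun z : Rm * Rm => z.2 < (f \o frac) z.1) @^-1` [set true])).
  apply/seteqP; split => z.
    move=> /special_rangeP /andP[z1 /andP[z2 z3]]; split; first by rewrite /= in_itv.
    by split; rewrite /= ?in_itv/= ?z2// frac_id.
  move=> [/=]; rewrite !in_itv/= andbT => z1 [z2]; rewrite frac_id// => z3.
  by apply/special_rangeP; rewrite z1 z2 z3.
apply: measurableI; first by rewrite -[X in measurable X]setTI; exact: measurable_fst.
apply: measurableI; first by rewrite -[X in measurable X]setTI; exact: measurable_snd.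
rewrite -[X in measurable X]setTI; apply: measurable_fun_ltr => //.
exact: (measurableT_comp mF).
Qed.

Lemma val_special_measurable : measurable_fun [set: borel X] (val : borel X -> Rm * Rm).
Proof.
have m1 : measurable_fun [set: borel X] (fst \o val : borel X -> Rm).
  (* The rays []c, +oo[] have open preimages in the circle metric. Rays to the left would not: every
     neighbourhood of 0 wraps around to points close to 1. *)
  apply: (measurability _ (RGenOInfty.measurableE R)) => _ [_ [c ->] <-].
  rewrite setTI; apply: sub_sigma_algebra; apply/special_openP => u.
  rewrite /= in_itv/= andbT => cu.
  have [/andP[u0 u1] _] := special_point_itv u.
  have [c0|c0] := ltP c 0.
    exists 1 => // v _; rewrite /= in_itv/= andbT.
    by have [/andP[v0 _] _] := special_point_itv v; exact: lt_le_trans v0.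
  exists (Num.min ((val u).1 - c) (1 - (val u).1)).
    by rewrite lt_min !subr_gt0 cu.
  move=> v; rewrite lt_min /= in_itv/= andbT => /andP[uv1 uv2].
  have [/andP[v0 v1] _] := special_point_itv v.
  have [n nE] := dist_int_attained ((val u).1 - (val v).1).
  have dle : dist_int ((val u).1 - (val v).1) <= special_dist u v.
    by rewrite /special_dist lerDl.
  have h1 := le_lt_trans dle uv1; have h2 := le_lt_trans dle uv2.
  rewrite nE in h1 h2; move: h1 h2; rewrite !ltr_norml => /andP[h1 h2] /andP[h3 h4].
  have [n0|n0|n0] := ltgtP n 0.
  - have : n%:~R <= -1 :> R by rewrite -(mulrN1z 1) ler_int -ltzD1 addNr.
    lra.
  - have : 1 <= n%:~R :> R by rewrite ler1z.
    lra.
  - by move: h2; rewrite n0 subr0; lra.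
have m2 : measurable_fun [set: borel X] (snd \o val : borel X -> Rm).
  apply: (measurability _ (RGenOInfty.measurableE R)) => _ [_ [c ->] <-].
  rewrite setTI; apply: sub_sigma_algebra; apply/special_openP => u.
  rewrite /= in_itv/= andbT => cu.
  exists ((val u).2 - c); first by rewrite subr_gt0.
  move=> v uv; rewrite /= in_itv/= andbT.
  have : `|(val u).2 - (val v).2| < (val u).2 - c.
    by apply: le_lt_trans uv; rewrite /special_dist lerDr dist_int_ge0.
  by move=> /(le_lt_trans (ler_norm _)); lra.
exact/measurable_fun_pairP.
Qed.

Lemma dist_int_lipschitz (x y : R) : dist_int x <= dist_int y + `|x - y|.
Proof.
have [n ->] := dist_int_attained y; apply: le_trans (dist_int_le _ n) _.
by rewrite (_ : x - n%:~R = y - n%:~R + (x - y)) ?ler_normD//; ring.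
Qed.

Lemma dist_int_continuous : continuous (@dist_int R).
Proof.
move=> x; apply/cvgrPdist_lt => e e0; exists e => //= y xy.
apply: le_lt_trans xy; rewrite ler_norml.
have := dist_int_lipschitz x y; have := dist_int_lipschitz y x; rewrite (distrC y x).
by move=> *; apply/andP; split; lra.
Qed.

Definition rational_ball (c : rat * rat) (n : nat) : set (Rm * Rm) :=
  [set z | dist_int (z.1 - ratr c.1) + `|z.2 - ratr c.2| < n.+1%:R^-1 ].

Lemma measurable_rational_ball c n : measurable (rational_ball c n).
Proof.
have md : measurable_fun [set: Rm] (@dist_int R : Rm -> Rm).
  by apply: continuous_measurable_fun; exact: dist_int_continuous.
have -> : rational_ball c n = [set: Rm * Rm] `&` ((fun z : Rm * Rm =>
   (dist_int (z.1 + - ratr c.1) + `|z.2 + - ratr c.2| : Rm) < n.+1%:R^-1) @^-1` [set true]).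
  by rewrite setTI; apply/seteqP; split.
apply: measurable_fun_ltr => //; apply: measurable_funD.
  apply: (measurableT_comp md).
  by apply: (measurableT_comp (measurable_addr _)); exact: measurable_fst.
apply: (measurableT_comp (@normr_measurable R setT)).
by apply: (measurableT_comp (measurable_addr _)); exact: measurable_snd.
Qed.

(** A total left inverse of [val]: it turns images under [val] into preimages. *)
Definition special_retract (z : Rm * Rm) : borel X := insubd (point : X) z.

Lemma special_retractK (u : X) : special_retract (val u) = u.
Proof. exact: valKd. Qed.

Lemma val_special_retract z : special_range z -> val (special_retract z) = z.
Proof. by move=> /special_rangeP h; rewrite insubdK. Qed.

Lemma image_special_val (A : set X) :
  [set val u | u in A] = special_range `&` special_retract @^-1` A.
Proof.
apply/seteqP; split => [_ [u Au <-]|z [Yz /= Az]].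
  by split; [exists u|rewrite /= special_retractK].
by exists (special_retract z) => //; exact: val_special_retract.
Qed.

(** On the range, an open set is the union of the countably many rational balls whose trace it
    contains. Off the range the retraction is constant, so the preimage there is everything or
    nothing. *)
Lemma measurable_special_retract : measurable_fun [set: Rm * Rm] special_retract.
Proof.
apply: (@measurability _ _ _ (borel X) _ _ (@open X)) => // _ [U oU <-].
rewrite setTI.
have mU : measurable (special_range `&` special_retract @^-1` U).
  have -> : special_range `&` special_retract @^-1` U = special_range `&`
     \bigcup_i (if @pickle_inv (rat * rat * nat)%type i is Some (c, n) then
        if `[< forall z, special_range z -> rational_ball c n z -> U (special_retract z) >]
        then rational_ball c n else set0 else set0).
    apply/seteqP; split => z [Yz]; last first.
      move=> [i _]; case: pickle_inv => [[c n]|//]; case: asboolP => // h zb.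
      by split => //; exact: h.
    move=> Uz; split=> //.
    have [e e0 he] := (special_openP U).1 oU _ Uz.
    pose n := Num.truncn (2 / e).
    have ne : 2 * n.+1%:R^-1 < e.
      by rewrite ltr_pdivrMr ?ltr0n// mulrC -ltr_pdivrMr// truncnS_gt.
    have n0 : 0 < n.+1%:R^-1 :> R by rewrite invr_gt0 ltr0n.
    have rat_near (r x : R) : 0 < r -> exists q : rat, `|x - ratr q| < r / 2.
      move=> r0; have [|q] := @rat_in_itvoo R (x - r / 2) (x + r / 2); first lra.
      rewrite in_itv/= => /andP[q1 q2]; exists q.
      by rewrite ltr_norml; apply/andP; split; lra.
    have [q1 hq1] := rat_near _ z.1 n0; have [q2 hq2] := rat_near _ z.2 n0.
    have ballz : rational_ball (q1, q2) n z.
      rewrite /rational_ball/=; have := dist_int_le (z.1 - ratr q1) 0; rewrite subr0.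
      by move: (_^-1) hq1 hq2 => r; lra.
    exists (choice.pickle ((q1, q2), n)); first by [].
    rewrite pickleK_inv.
    rewrite ifT//; apply/asboolP => w Yw ballw; apply: he.
    apply: lt_trans ne; rewrite /special_dist (val_special_retract Yz) (val_special_retract Yw).
    move: ballz ballw; rewrite /rational_ball/= => bz bw.
    have d1 : dist_int (z.1 - w.1) <= dist_int (z.1 - ratr q1) + dist_int (w.1 - ratr q1).
      rewrite -(dist_intN (w.1 - _)); apply: le_trans (dist_intD _ _).
      by rewrite (_ : z.1 - ratr q1 - (w.1 - ratr q1) = z.1 - w.1)//; ring.
    have d2 : `|z.2 - w.2| <= `|z.2 - ratr q2| + `|w.2 - ratr q2|.
      rewrite -(normrN (w.2 - _)); apply: le_trans (ler_normD _ _).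
      by rewrite (_ : z.2 - ratr q2 - (w.2 - ratr q2) = z.2 - w.2)//; ring.
    by move: (_^-1) bz bw => r; lra.
  apply: measurableI; first exact: measurable_special_range.
  apply: bigcup_measurable => i _; case: pickle_inv => [[c n]|//].
  by case: ifP => // _; exact: measurable_rational_ball.
have [Up|Up] := pselect (U point).
  have -> : special_retract @^-1` U =
      (special_range `&` special_retract @^-1` U) `|` ~` special_range.
    apply/seteqP; split => z /=.
      by move=> Uz; have [Yz|nYz] := pselect (special_range z); [left|right].
    case=> [[]//|nYz]; rewrite /special_retract /insubd insubN//.
    by apply/negP => /special_rangeP.
  by apply: measurableU => //; apply: measurableC; exact: measurable_special_range.
have -> // : special_retract @^-1` U = special_range `&` special_retract @^-1` U.
apply/seteqP; split => z /=; last by case.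
move=> Uz; split => //; apply: contrapT => nYz; apply: Up; move: Uz.
rewrite /special_retract /insubd insubN//.
by apply/negP => /special_rangeP.
Qed.

Lemma measurable_image_special_val (A : set (borel X)) : measurable A ->
  measurable ([set val u | u in (A : set X)] : set (Rm * Rm)).
Proof.
move=> mA; rewrite image_special_val; apply: measurableI.
  exact: measurable_special_range.
by rewrite -[X in measurable X]setTI; exact: measurable_special_retract.
Qed.

Lemma measurable_preimage_special_val (B : set (Rm * Rm)) : measurable B ->
  measurable ((val : X -> R * R) @^-1` B : set (borel X)).
Proof.
by move=> mB; rewrite -[X in measurable X]setTI; exact: val_special_measurable.
Qed.

Lemma special_range_measure : exists2 v : R, 0 < v & (lam \x lam)%E special_range = v%:E.
Proof.
have [c c0 fc] := roof_bounded_away f; have [Fm Fm0 hFm] := piecewise_ac_bounded pac.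
have box (y : R) : 0 < y ->
    (lam \x lam)%E ((`[0, 1[%classic : set Rm) `*` (`[0, y[%classic : set Rm)) = y%:E.
  move=> y0.
  transitivity (lam `[0%R, 1%R[%classic * lam `[0%R, y[%classic)%E.
    by apply: product_measure1E.
  by rewrite !lebesgue_measure_itv/= !lte_fin ltr01 y0 !sube0 -EFinM mul1r.
have lo : (c%:E <= (lam \x lam)%E special_range)%E.
  rewrite -(box c c0); apply: le_measure; rewrite ?inE//.
  - by apply: measurableX.
  - exact: measurable_special_range.
  - move=> [x s] [/=]; rewrite !in_itv/= => x01 /andP[s0 sc].
    by apply/special_rangeP; rewrite /= x01 s0 (lt_le_trans sc)// fc.
have hi : ((lam \x lam)%E special_range <= Fm%:E)%E.
  rewrite -(box Fm Fm0); apply: le_measure; rewrite ?inE//.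
  - exact: measurable_special_range.
  - by apply: measurableX.
  - move=> [x s] /special_rangeP /= /andP[x01 /andP[s0 sf]]; split; rewrite /= in_itv/= ?s0//.
    by rewrite (lt_le_trans sf)//; have := hFm x; rewrite frac_id.
move: lo hi; case: ((lam \x lam)%E special_range) => [v| |] //.
  by rewrite !lee_fin => lo _; exists v => //; exact: lt_le_trans c0 lo.
Qed.

Lemma special_borel_probability : borel_probability (@special_measure R f).
Proof.
have [v v0 vE] := special_range_measure.
pose mu : set (borel X) -> \bar R := @special_measure R f.
have v0' : 0 <= v^-1 by rewrite invr_ge0 ltW.
pose ms : {measure set (Rm * Rm) -> \bar R} := mscale (NngNum v0') (lam \x lam)%E.
have muE (A : set (borel X)) : mu A = ms [set val u | u in (A : set X)].
  by rewrite /mu /special_measure /ms /mscale/= -/special_range vE /= muleC.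
have mu0 : mu set0 = 0%E by rewrite muE image_set0; exact: (measure0 ms).
have mu_ge0 A : (0 <= mu A)%E.
  rewrite muE /ms /mscale; apply: mule_ge0; first by rewrite lee_fin.
  by apply: integral_ge0.
have mu_add : semi_sigma_additive mu.
  move=> A mA tA mUA; rewrite muE image_bigcup.
  under eq_fun do under eq_bigr do rewrite muE.
  apply: (@measure_semi_sigma_additive _ _ _ ms).
  - by move=> n; exact: measurable_image_special_val.
  - apply/trivIsetP => i j _ _ ij; apply/seteqP; split => // z [[u Au <-] [w Aw /val_inj wu]].
    have /trivIsetP /(_ i j I I ij) Aij := tA.
    have : (A i `&` A j) u by split; [exact: Au|rewrite -wu].
    by rewrite Aij.
  - by apply: bigcup_measurable => n _; exact: measurable_image_special_val.
have mu1 : mu [set: borel X] = 1%E.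
  rewrite muE; transitivity (v^-1%:E * (lam \x lam) special_range)%E; first by [].
  by rewrite vE -EFinM mulVf ?gt_eqF.
pose M : {measure set (borel X) -> \bar R} :=
  HB.pack mu (isMeasure.Build _ _ _ mu mu0 mu_ge0 mu_add).
by exists (HB.pack_for (probability (borel X) R) (Measure.sort M)
  (Measure_isProbability.Build _ _ _ M mu1)).
Qed.

End special_borel.

Section countable_union.
Context {d : measure_display} {T : measurableType d} {R : realType} (I : countType).

Lemma measure_countable_bigcup (m : {measure set T -> \bar R}) (F G : I -> set T) :
  (forall i, measurable (F i)) -> (forall i, measurable (G i)) ->
  (forall i j x, F i x -> F j x -> i = j) -> (forall i j x, G i x -> G j x -> i = j) ->
  (forall i, m (F i) = m (G i)) -> m (\bigcup_i F i) = m (\bigcup_i G i).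
Proof.
pose seq_of (H : I -> set T) (j : nat) := if @pickle_inv I j is Some i then H i else set0.
have E (H : I -> set T) : (forall i, measurable (H i)) ->
    (forall i j x, H i x -> H j x -> i = j) ->
    m (\bigcup_i H i) = (\sum_(0 <= j <oo) m (seq_of H j))%E.
  move=> mH dH; have -> : \bigcup_i H i = \bigcup_j seq_of H j.
    apply/seteqP; split => x [i _ xi].
      by exists (choice.pickle i); [|rewrite /seq_of pickleK_inv].
    by move: xi; rewrite /seq_of; case: pickle_inv => // j xj; exists j.
  rewrite measure_bigcup//; first by apply: eq_eseriesl => j; rewrite in_setT.
    by move=> j _; rewrite /seq_of; case: pickle_inv.
  move=> i j _ _ [x []]; rewrite /seq_of.
  case Ei : (pickle_inv i) => [i'|//]; case Ej : (pickle_inv j) => [j'|//] xi xj.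
  have := @pickle_invK I i; have := @pickle_invK I j; rewrite Ei Ej /= => <- <-.
  by rewrite (dH _ _ _ xi xj).
move=> mF mG dF dG FG; rewrite (E F)// (E G)//; apply: eq_eseriesr => j _.
by rewrite /seq_of; case: pickle_inv.
Qed.

End countable_union.

Section special_flow_measure.
Context {R : realType} (a : R) (f : roof R) (k : nat) (b : nat -> R).
Hypothesis pac : piecewise_ac f k b.
Notation X := (special_space f).
Notation Rm := (measurableTypeR R).
Notation lam := (@lebesgue_measure R).
Notation bs := (birkhoff_sum a f).

(** [i.1] is the number of returns up to time [t] and [i.2] the integer part that the rotation
    drops. With both fixed, the flow is the restriction of a shear of the plane. *)
Definition flow_piece (t : R) (i : int * int) : set (Rm * Rm) :=
  special_range f `&` [set z | bs i.1 z.1 <= z.2 + t < bs (i.1 + 1) z.1 /\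
    Num.floor (z.1 + i.1%:~R * a) = i.2].

Definition flow_shear (t : R) (i : int * int) (z : Rm * Rm) : Rm * Rm :=
  (z.1 + (i.1%:~R * a - i.2%:~R), z.2 + (t - bs i.1 z.1)).

Definition flow_unshear (t : R) (i : int * int) (z : Rm * Rm) : Rm * Rm :=
  let c := i.1%:~R * a - i.2%:~R in
  (z.1 + - c, z.2 + - (t - bs i.1 (z.1 + - c))).

Lemma flow_shearK t i : cancel (flow_shear t i) (flow_unshear t i).
Proof.
by move=> [x s]; rewrite /flow_shear /flow_unshear/=; rewrite !addrK.
Qed.

Lemma flow_unshearK t i : cancel (flow_unshear t i) (flow_shear t i).
Proof.
by move=> [x s]; rewrite /flow_shear /flow_unshear/=; rewrite !subrK.
Qed.

Lemma measurable_flow_shear t i : measurable_fun [set: Rm * Rm] (flow_shear t i).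
Proof.
apply/measurable_fun_pairP; split.
  by apply: (measurableT_comp (measurable_addr _)); exact: measurable_fst.
apply: measurable_funD; first exact: measurable_snd.
apply: measurable_funB => //.
by apply: (measurableT_comp (measurable_birkhoff_sum pac a i.1)); exact: measurable_fst.
Qed.

Lemma measurable_flow_unshear t i : measurable_fun [set: Rm * Rm] (flow_unshear t i).
Proof.
apply/measurable_fun_pairP; split.
  by apply: (measurableT_comp (measurable_addr _)); exact: measurable_fst.
apply: measurable_funD; first exact: measurable_snd.
apply: measurable_funN; apply: measurable_funB => //.
apply: (measurableT_comp (measurable_birkhoff_sum pac a i.1)).
by apply: (measurableT_comp (measurable_addr _)); exact: measurable_fst.
Qed.

Lemma measurable_flow_piece t i : measurable (flow_piece t i).
Proof.
have mbs n : measurable_fun [set: Rm * Rm] (fun z : Rm * Rm => (bs n z.1 : Rm)).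
  by apply: (measurableT_comp (measurable_birkhoff_sum pac a n)); exact: measurable_fst.
have mt : measurable_fun [set: Rm * Rm] (fun z : Rm * Rm => (z.2 + t : Rm)).
  by apply: (measurableT_comp (measurable_addr _)); exact: measurable_snd.
have -> : flow_piece t i = special_range f `&`
   (((fun z : Rm * Rm => bs i.1 z.1 <= z.2 + t) @^-1` [set true]) `&`
   (((fun z : Rm * Rm => z.2 + t < bs (i.1 + 1) z.1) @^-1` [set true]) `&`
   ((fun z : Rm * Rm => z.1 + i.1%:~R * a) @^-1` `[i.2%:~R, (i.2 + 1)%:~R[%classic))).
  apply/seteqP; split => z.
    move=> [Yz [/andP[z1 z2] z3]]; split => //; split => //; split => //=.
    by rewrite in_itv/= -z3; exact: floor_itv.
  move=> [Yz [z1 [z2 /=]]]; rewrite in_itv/= => z3; split => //; split; first by rewrite z1.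
  exact: floor_def.
apply: measurableI; first exact: measurable_special_range pac.
apply: measurableI.
  by rewrite -[X in measurable X]setTI; apply: measurable_fun_ler => //; exact: mbs.
apply: measurableI.
  by rewrite -[X in measurable X]setTI; apply: measurable_fun_ltr => //; exact: mbs.
rewrite -[X in measurable X]setTI.
have m1 : measurable_fun [set: Rm * Rm] (fun z : Rm * Rm => (z.1 + i.1%:~R * a : Rm)).
  by apply: (measurableT_comp (measurable_addr _)); exact: measurable_fst.
exact: m1.
Qed.

Lemma flow_piece_uniq t i j z : flow_piece t i z -> flow_piece t j z -> i = j.
Proof.
move: i j => [n l] [n' l'] [_ [/= hn <-]] [_ [/= hn' <-]].
by rewrite (birkhoff_index_uniq hn hn').
Qed.

Lemma flow_piece_cover t (u : X) : exists i, flow_piece t i (val u).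
Proof.
have [n hn] := birkhoff_index a f (val u).1 ((val u).2 + t).
exists (n, Num.floor ((val u).1 + n%:~R * a)); split; last by [].
by exists u.
Qed.

Lemma flow_pieceE t i (u : X) : flow_piece t i (val u) ->
  val (special_flow a t u) = flow_shear t i (val u).
Proof.
move: i => [n l] [_ [/= hn hl]]; rewrite (special_flowE hn) /flow_shear/=.
by rewrite /rotation /frac hl !addrA.
Qed.

Lemma image_preimage_flow t (A : set X) :
  [set val u | u in special_flow a t @^-1` A] =
  \bigcup_i (flow_piece t i `&` flow_shear t i @^-1` [set val u | u in A]).
Proof.
apply/seteqP; split => [_ [u Au <-]|z [i _ [[[u _ <-] h] [v Av vE]]]].
  have [i hi] := flow_piece_cover t u; exists i => //; split => //.
  by exists (special_flow a t u); [|exact: flow_pieceE].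
have hi : flow_piece t i (val u) by split => //; exists u.
by exists u => //=; rewrite -(val_inj (etrans vE (esym (flow_pieceE hi)))).
Qed.

Lemma flow_image_cover t (A : set X) :
  [set val u | u in A] =
  \bigcup_i ([set val u | u in A] `&` flow_unshear t i @^-1` flow_piece t i).
Proof.
apply/seteqP; split => [_ [u Au <-]|z [i _ []]//].
pose v := special_flow a (- t) u.
have uE : special_flow a t v = u by rewrite -special_flowD subrr special_flow0.
have [i hi] := flow_piece_cover t v.
exists i => //; split; first by exists u.
by rewrite /= -uE (flow_pieceE hi) flow_shearK.
Qed.

Lemma flow_image_uniq t i j (u : X) :
  flow_piece t i (flow_unshear t i (val u)) ->
  flow_piece t j (flow_unshear t j (val u)) -> i = j.
Proof.
move=> hi hj; have [[v _ vE] _] := hi; have [[w _ wE] _] := hj.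
rewrite -vE in hi; rewrite -wE in hj.
have vu : special_flow a t v = u.
  by apply: val_inj; rewrite (flow_pieceE hi) vE flow_unshearK.
have wu : special_flow a t w = u.
  by apply: val_inj; rewrite (flow_pieceE hj) wE flow_unshearK.
have vw : v = w.
  rewrite -[v](special_flow0 a) -[w](special_flow0 a) -(addNr t) !special_flowD.
  by rewrite vu wu.
by apply: flow_piece_uniq hi _; rewrite vw.
Qed.

Lemma measurable_image_preimage_flow t i (A : set (borel X)) : measurable A ->
  measurable (flow_piece t i `&` flow_shear t i @^-1` [set val u | u in (A : set X)]).
Proof.
move=> mA; apply: measurableI; first exact: measurable_flow_piece.
rewrite -[X in measurable X]setTI; apply: measurable_flow_shear => //.
exact: (measurable_image_special_val pac).
Qed.

(** The pieces partition the preimage of [A], and their sheared images partition [A] because the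
    flow at time [t] is invertible; each shear preserves area. *)
Lemma special_flow_preserving :
  measure_preserving_flow (@special_measure R f) (@special_flow R a f).
Proof.
split; [exact: special_flow0|exact: special_flowD| |].
  move=> t _ A mA; rewrite setTI.
  have -> : (special_flow a t : X -> X) @^-1` A = (val : X -> R * R) @^-1`
      (\bigcup_i (flow_piece t i `&` flow_shear t i @^-1` [set val u | u in (A : set X)])).
    rewrite -image_preimage_flow; apply/seteqP; split => u /=; first by exists u.
    by move=> [v Av /val_inj <-].
  apply: measurable_preimage_special_val; apply: countable_bigcupT_measurable => // i.
  exact: measurable_image_preimage_flow.
move=> t A mA; rewrite /special_measure; congr (_ * _)%E.
have mB := measurable_image_special_val pac mA.
rewrite image_preimage_flow [X in _ = _ X](flow_image_cover t).
apply: measure_countable_bigcup.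
- by move=> i; exact: measurable_image_preimage_flow.
- move=> i; apply: measurableI => //; rewrite -[X in measurable X]setTI.
  by apply: measurable_flow_unshear => //; exact: measurable_flow_piece.
- by move=> i j z [hi _] [hj _]; exact: flow_piece_uniq hi hj.
- by move=> i j _ [[u _ <-] hi] [_ hj]; exact: flow_image_uniq hi hj.
- move=> i; have mW : measurable ([set val u | u in (A : set X)] `&`
      flow_unshear t i @^-1` flow_piece t i).
    apply: measurableI => //; rewrite -[X in measurable X]setTI.
    by apply: measurable_flow_unshear => //; exact: measurable_flow_piece.
  have mtau : measurable_fun [set: Rm] (fun x : Rm => (t - bs i.1 x : Rm)).
    by apply: measurable_funB => //; exact: measurable_birkhoff_sum pac a i.1.
  apply: etrans (plane_shear_preserving (i.1%:~R * a - i.2%:~R) mtau mW).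
  congr (_ _); apply/seteqP; split => z /=.
    by move=> [h1 h2]; split => //; rewrite flow_shearK.
  by move=> [h1]; rewrite flow_shearK.
Qed.

End special_flow_measure.

(** * Sigma-compactness *)

Section special_sigma_compact.
Context {R : realType} (f : roof R) (k : nat) (b : nat -> R).
Hypothesis pac : piecewise_ac f k b.
Notation X := (special_space f).
Notation F := (f \o frac).

(** Fibres are rescaled to unit height, so that compact products exhaust the half-open fibres. On a
    closed subarc inside a piece, or at a single breakpoint, the roof is continuous and the images
    are compact. *)
Definition special_chart (z : R * R) : X := insubd (point : X) (frac z.1, z.2 * F z.1).

Lemma val_special_chart z : 0 <= z.2 < 1 ->
  val (special_chart z) = (frac z.1, z.2 * F z.1).
Proof.
move=> /andP[z0 z1]; rewrite insubdK// unfold_in/= frac_itv/=.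
have fz : 0 < f (frac z.1) by exact: roof_gt0 (frac_itv _).
by rewrite mulr_ge0 ?(ltW fz)//= gtr_pMl.
Qed.

Lemma compact_special_chart (A : set R) (c : R) : c < 1 -> compact A ->
  {within A, continuous F} -> compact (special_chart @` (A `*` `[0, c]%classic)).
Proof.
move=> c1 cA /subspace_continuousP cF.
apply: continuous_compact; last by apply: compact_setX => //; exact: segment_compact.
have unit (s : R) : `[0, c]%classic s -> 0 <= s < 1.
  by rewrite /= in_itv/= => /andP[-> sc]; exact: le_lt_trans c1.
apply/subspace_continuousP => -[y s] [/= Ay sc].
apply/cvg_ballP => e e0; rewrite near_withinE.
have c2 : (fun z : R * R => z.2 * F z.1) z @[z --> within (A `*` `[0, c]%classic) (nbhs (y, s))]
    --> s * F y.
  apply: cvgM.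
    by apply: cvg_within_filter; exact: cvg_snd.
  apply/cvgrPdist_lt => d d0; rewrite near_withinE.
  have := (cvgrPdist_lt _ _).1 (cF y Ay) d d0; rewrite near_withinE => h.
  have : \forall z \near nbhs (y, s), A z.1 -> `|F y - F z.1| < d.
    by apply: (@cvg_fst R R (nbhs y) (nbhs s) _ (fun x : R => A x -> `|F y - F x| < d)); exact: h.
  by apply: filterS => z hz [Az _]; exact: hz.
have e2 : 0 < e / 2 by rewrite divr_gt0.
have {}c2 := (cvgrPdist_lt _ _).1 c2 _ e2.
have c3 : \forall z \near nbhs (y, s), `|y - z.1| < e / 2.
  apply: (@cvg_fst R R (nbhs y) (nbhs s) _ (fun x : R => `|y - x| < e / 2)).
  by exists (e / 2) => //= x.
have {c2} : \forall z \near nbhs (y, s), (A `*` `[0, c]%classic) z ->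
    `|s * F y - z.2 * F z.1| < e / 2 by exact: c2.
apply: filterS2 c3 => z yz zs [Az zc]; have {}zs := zs (conj Az zc).
rewrite /ball/= /special_dist !val_special_chart/=; [|exact: unit..].
have -> : e = e / 2 + e / 2 by field.
apply: ltrD => //; apply: le_lt_trans yz; rewrite /frac.
have := dist_int_le (y - (Num.floor y)%:~R - (z.1 - (Num.floor z.1)%:~R))
  (Num.floor z.1 - Num.floor y).
rewrite intrB (_ : y - _ - _ - _ = y - z.1)//; ring.
Qed.

Definition arc_exhaustion (j : nat) (m : option nat) : set R :=
  if m is Some m then `[b j + m.+1%:R^-1, b j.+1 - m.+1%:R^-1]%classic else [set b j].

Lemma compact_arc_exhaustion j m : compact (arc_exhaustion j m).
Proof. by case: m => [m|]; [exact: segment_compact|exact: compact_set1]. Qed.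

Lemma continuous_arc_exhaustion j m : (j < k)%N ->
  {within arc_exhaustion j m, continuous F}.
Proof.
move=> jk; apply/subspace_continuousP => x; case: m => [m|/= ->].
  rewrite /= in_itv/= => /andP[x1 x2]; apply: cvg_within_filter.
  have [_ _ _ acF] := pac.
  have m0 : 0 < m.+1%:R^-1 :> R by rewrite invr_gt0 ltr0n.
  apply: (ac_itv_continuous (acF j jk)).
  by move: (_^-1) m0 x1 x2 => r r0 x1 x2; apply/andP; split; lra.
apply/cvgrPdist_lt => e e0; rewrite near_withinE.
by apply: nearW => z /= ->; rewrite subrr normr0.
Qed.

Lemma special_sigma_compact : sigma_compact (special_space f).
Proof.
exists (fun i => if @pickle_inv (nat * option nat * nat)%type i is Some (j, m, n) then
  if (j < k)%N then special_chart @` (arc_exhaustion j m `*` `[0, 1 - n.+1%:R^-1]%classic)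
  else set0 else set0).
  move=> i; case: pickle_inv => [[[j m] n]|]; last exact: compact0.
  case: ifP => jk; last exact: compact0.
  apply: compact_special_chart.
  - by rewrite ltrBlDr ltrDl invr_gt0 ltr0n.
  - exact: compact_arc_exhaustion.
  - exact: continuous_arc_exhaustion.
apply/seteqP; split => // u _.
have [x01 /andP[s0 sf]] := special_point_itv u.
pose x := (val u).1; have fx : 0 < f x by exact: roof_gt0.
have inv_lt (d : R) : 0 < d -> exists n : nat, n.+1%:R^-1 <= d.
  move=> d0; exists (Num.truncn d^-1).
  by rewrite invf_ple ?posrE ?ltr0n// ltW// truncnS_gt.
pose y := x - (Num.floor (x - b 0%N))%:~R.
have [l1 l2] := floor_itv_le (x - b 0%N).
have [|j jk /andP[j1 j2]] := breakpoint_locate pac (x := y).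
  by rewrite /y; apply/andP; split; lra.
have fy : frac y = x by rewrite /y -intrN fracDint frac_id.
have [m ym] : exists m, arc_exhaustion j m y.
  move: j1; rewrite le_eqVlt => /orP[/eqP j1|j1]; first by exists None.
  have [|n hn] := inv_lt (Num.min (y - b j) (b j.+1 - y)).
    by rewrite lt_min !subr_gt0 j1.
  exists (Some n); rewrite /= in_itv/=.
  move: hn; rewrite le_min; move: (_^-1) => r /andP[h1 h2].
  by apply/andP; split; lra.
pose s := (val u).2 / f x.
have [|n hn] := inv_lt (1 - s); first by rewrite subr_gt0 ltr_pdivrMr// mul1r.
have s1 : s < 1 by rewrite ltr_pdivrMr// mul1r.
have s0' : 0 <= s by rewrite divr_ge0// ltW.
exists (choice.pickle (j, m, n)); first by [].
rewrite pickleK_inv jk; exists (y, s).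
  split => //=; rewrite in_itv/= s0'/=; move: hn; move: (_^-1) => r; lra.
apply: val_inj; rewrite val_special_chart/=; last by rewrite s0'.
by rewrite fy /s divfK ?gt_eqF// -surjective_pairing.
Qed.

End special_sigma_compact.

(** * Regular points form a measurable set of full measure *)

Section regular_points.
Context {R : realType} (a : R) (f : roof R) (k : nat) (b : nat -> R).
Hypothesis pac : piecewise_ac f k b.
Notation X := (special_space f).
Notation Rm := (measurableTypeR R).
Notation lam := (@lebesgue_measure R).

Definition regular_points : set (borel X) := [set u | regular a k b (val (u : X)).1].

Lemma regular_pointsP : exists2 Q : set Rm, measurable Q /\ lam Q = 0%E &
  ~` regular_points = (val : X -> R * R) @^-1` (Q `*` [set: R]).
Proof.
pose Q := [set x : Rm | ~ regular a k b x].
have cQ : countable Q.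
  apply: (@sub_countable _ _ _ (range (fun i : nat * nat * int =>
    b i.1.2 + i.2%:~R - i.1.1%:R * a))).
    apply: subset_card_le => x nrx; apply: contrapT => nx; apply: nrx => i j m jk.
    apply/eqP => xE; apply: nx; exists (i, j, m) => //=.
    by rewrite -xE addrK.
  by apply: sub_countable (card_image_le _ _) _.
exists Q; last by apply/seteqP; split => u //= [].
split; last exact: countable_lebesgue_measure0.
by apply: countable_measurable => // x; exact: measurable_set1.
Qed.

Lemma measurable_regular_points : measurable regular_points.
Proof.
have [Q [mQ _] QE] := regular_pointsP.
rewrite -[regular_points]setCK QE; apply: measurableC.
by apply: measurable_preimage_special_val; exact: measurableX.
Qed.

Lemma special_measure_regular_points : @special_measure R f regular_points = 1%E.
Proof.
have [P muP] := special_borel_probability pac.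
have mZ := measurable_regular_points; have [Q [mQ Q0] QE] := regular_pointsP.
rewrite muP// -[regular_points]setCK probability_setC; last exact: measurableC.
rewrite (_ : P _ = 0%E) ?sube0// -muP; last exact: measurableC.
rewrite /special_measure QE (_ : (_ \x _)%E _ = 0%E) ?mul0e//.
apply/eqP; rewrite eq_le measure_ge0 andbT.
have -> : 0%E = (lam \x lam)%E (Q `*` [set: Rm]).
  apply/esym; apply: etrans (product_measure1E _ _ _ _) _ => //.
  by rewrite [X in (X * _)%E]Q0 mul0e.
apply: le_measure; rewrite ?inE.
- apply: (measurable_image_special_val pac).
  by apply: measurable_preimage_special_val; exact: measurableX.
- exact: measurableX.
- by move=> _ [u Qu <-].
Qed.

End regular_points.

(** * The finite set of shifts *)

Section shifts.
Context {R : realType} (f : R -> R) (k : nat) (b : nat -> R) (C : R).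
Local Notation D := (jump_combinations f k b C).

Lemma finite_jump_combinations : finite_set D.
Proof.
pose K := (Num.truncn (2 * C + 1)).+1.
apply: (@sub_finite_set _ _ (range (fun g : {ffun 'I_k -> 'I_K} =>
    \sum_(j < k) (g j : nat)%:R * jump f (b j)))); last exact: finite_image.
move=> _ [n nC <-].
have nK j : (`|n j|%N < K)%N.
  have [n0 n1] := nC j.
  have C0 : 0 <= 2 * C + 1 by apply: le_trans n1; rewrite ler0z.
  rewrite ltnS truncn_ge_nat//; move: n1; by rewrite -[n j]gez0_abs.
exists [ffun j => Ordinal (nK j)] => //; apply: eq_bigr => j _.
by rewrite ffunE /=; have [n0 _] := nC j; rewrite natr_absz ger0_norm.
Qed.

(** A zero shift means [p = sg S * d] with [d] in [D], which puts [p] in [D] or [-D] according to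
    the sign of [S]. *)
Lemma shifts_nonzero (S p : R) : S != 0 -> ~ (D `|` [set - d | d in D]) p ->
  ~ ([set Num.sg S * p - d | d in D] `|` [set - Num.sg S * p + d | d in D]) 0.
Proof.
move=> S0 np; have [->|->] : Num.sg S = 1 \/ Num.sg S = -1.
  by case: sgrP S0 => //; [left|right].
all: case=> -[d Dd /eqP]; rewrite ?mulN1r ?mul1r ?opprK => /eqP h; apply: np.
- by left; rewrite (_ : p = d)//; lra.
- by left; rewrite (_ : p = d)//; lra.
- by right; exists d => //; lra.
- by right; exists d => //; lra.
Qed.

End shifts.

Theorem theorem8 (R : realType) (alpha : R) (f : roof R)
    (k : nat) (beta : nat -> R) (p : R) :
  0 < alpha < 1 -> irrational alpha ->
  has_ubound (partial_quotients alpha) ->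
  piecewise_ac f k beta ->
  let S := sum_of_jumps f k beta in
  let C := sup (partial_quotients alpha) + 1 in
  let D := jump_combinations f k beta C in
  S != 0 ->
  0 < p < `|S| -> ~ (D `|` [set - d | d in D]) p ->
  forall gamma : R, 0 < gamma ->
  property_R (@special_measure R f) (@special_flow R alpha f) gamma
    ([set Num.sg S * p - d | d in D] `|` [set - Num.sg S * p + d | d in D]).
Proof.
move=> a01 ia bpq pac S C D S0 pS pD gamma gamma0; split.
  split; [exact: special_sigma_compact pac|exact: special_borel_probability pac|].
  exact: special_flow_preserving pac.
split.
  split; last by rewrite gt_eqF.
    by rewrite finite_setU; split; apply: finite_image; exact: finite_jump_combinations.
  exact: shifts_nonzero.
move=> eps eps0.
have [kappa kappa0 H] := ratner_estimate a01 ia bpq pac S0 pS gamma0 eps0.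
exists kappa => // N; have [delta delta0 h] := H N.
exists delta, (regular_points alpha k beta); split => //.
- exact: measurable_regular_points.
- by rewrite special_measure_regular_points// lte_fin ltrBlDr ltrDl.
Qed.
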